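(* Let $\Omega\subseteq\mathbb{H}$ be a domain, let $f:\Omega\to\hat{\mathbb{H}}=\mathbb{H}\cup\{\infty\}$ be a function and let $\rho>0$ be such that $\overline{\mathbb{B}_{\rho}}\subset\Omega$, $f(0)\neq0,\infty$, and $f(y)\neq0,\infty$ for every $y\in\partial\mathbb{B}_\rho$. (i) Suppose $f$ is a slice preserving semiregular function. Let $\{r_k\}_k$ and $\{p_h\}_h$ be its real zeros and real poles, and let $\{\mathbb{S}_{a_i}\}_i$ and $\{\mathbb{S}_{b_j}\}_j$ be its spherical zeros and spherical poles, everything repeated according to multiplicity. Then $$\begin{aligned}\log|f(0)| ={}& \frac{1}{|\partial \mathbb{B}_{\rho}|}\int_{\partial \mathbb{B}_{\rho}}\log|f(y)|\,d\sigma(y)-\frac{\rho^{2}}{8}\,\Delta\log|f(x)|_{|x=0}\\ &+\sum_{|p_{h}|<\rho}\left(\log\frac{\rho}{|p_{h}|}+\frac14\,\frac{p_{h}^{4}-\rho^{4}}{\rho^{2}p_{h}^{2}}\right)-\sum_{|r_{k}|<\rho}\left(\log\frac{\rho}{|r_{k}|}+\frac14\,\frac{r_{k}^{4}-\rho^{4}}{\rho^{2}r_{k}^{2}}\right)\\ &+\sum_{|b_{j}|<\rho}\left(\log\frac{\rho^{2}}{|b_{j}|^{2}}+\frac14\,\frac{\rho^{4}-|b_{j}|^{4}}{\rho^{2}|b_{j}|^{4}}\,[2|b_{j}|^{2}-(b_{j}+b_{j}^{c})^{2}]\right)\\ &-\sum_{|a_{i}|<\rho}\left(\log\frac{\rho^{2}}{|a_{i}|^{2}}+\frac14\,\frac{\rho^{4}-|a_{i}|^{4}}{\rho^{2}|a_{i}|^{4}}\,[2|a_{i}|^{2}-(a_{i}+a_{i}^{c})^{2}]\right).\end{aligned}$$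 (ii) Suppose $f$ is a PQL function $f(x)=a_{0}\prod_{k=1}^{N}(x-q_{k})^{M_{k}}a_{k}$ with $M_k=\pm1$ and $|q_k|<\rho$ for every $k$. Then $$\log|f(0)|=\frac{1}{|\partial \mathbb{B}_{\rho}|}\int_{\partial \mathbb{B}_{\rho}}\log|f(y)|\,d\sigma(y)-\frac{\rho^{2}}{8}\,\Delta\log|f(x)|_{|x=0}-\sum_{k=1}^{N}M_{k}\left(\log\frac{\rho}{|q_{k}|}+\frac14\,\frac{|q_{k}|^{4}-\rho^{4}}{\rho^{2}|q_{k}|^{2}}\right).$$
   Context: $\mathbb{H}$ denotes the quaternions, identified with $\mathbb{R}^4$, $x^c$ is the usual conjugate, $|x|^2=xx^c$, $\mathbb{B}_\rho=\{|x|<\rho\}$, $d\sigma$ is the 3-dimensional surface measure on $\partial\mathbb{B}_\rho$ and $|\partial\mathbb{B}_\rho|$ its total mass, $\Delta$ is the Laplacian of $\mathbb{R}^4$. $\mathbb{S}=\{I\in\mathbb{H}: I^2=-1\}$, $\mathbb{C}_I=\mathbb{R}+I\mathbb{R}$, and $\mathbb{S}_{\alpha+I\beta}=\{\alpha+J\beta: J\in\mathbb{S}\}$. Slice functions. Let $\mathbb{H}_{\mathbb{C}}=\mathbb{H}\otimes_{\mathbb{R}}\mathbb{C}=\{p+\imath q: p,q\in\mathbb{H}\}$ with product $(p_1+\imath q_1)(p_2+\imath q_2)=p_1p_2-q_1q_2+\imath(p_1q_2+q_1p_2)$ and $\overline{p+\imath q}=p-\imath q$. For an open $D\subseteq\mathbb{C}$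 symmetric under complex conjugation, $\Omega_D=\{\alpha+I\beta:\alpha+i\beta\in D, I\in\mathbb{S}\}$ (a circular set; a slice domain if it is a domain and $D\cap\mathbb{R}\ne\emptyset$). A stem function is $F=F_1+\imath F_2:D\to\mathbb{H}_{\mathbb{C}}$ with $F(\bar z)=\overline{F(z)}$; it induces the slice function $f=\mathcal{I}(F):\Omega_D\to\mathbb{H}$, $f(\alpha+I\beta)=F_1(\alpha+i\beta)+IF_2(\alpha+i\beta)$. $f$ is regular if $F$ is $C^1$ and $\partial F/\partial\alpha+\imath\,\partial F/\partial\beta=0$, and slice preserving if $f(\Omega_D\cap\mathbb{C}_J)\subset\mathbb{C}_J$ for all $J\in\mathbb{S}$ (equivalently $F_1,F_2$ are real valued). A semiregular function on $\Omega_D$ is a function regular on some circular open $\Omega_{D'}\subset\Omega_D$ such that every point of $\Omega_D\setminus\Omega_{D'}$ is a pole or a removable singularity; the value $\infty$ is assigned at poles. In case (i), $\Omega$ is understood to be a circular (slice) domain. For $q\in\mathbb{H}$, $(x-q)^s=x^2-x(q+q^c)+qq^c$; it vanishes exactly on $\mathbb{S}_q$. A slice preserving semiregular function not identically zero on a slice domain containing $\overline{\mathbb{B}_\rho}$ can be written on $\mathbb{B}_\rho$ as a finite product of factors $(x-r)^{n}$ ($r\in\mathbb{R}$) and $((x-q)^s)^{n}$ ($q\notin\mathbb{R}$), with nonzero integer exponents (positive for zeros, negative for poles), times a slice preserving regular function without zeros in $\mathbb{B}_\rho$. The multiplicity of a real zero/pole $r$ or of a spherical zero/pole $\mathbb{S}_q$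 here is the absolute value $|n|$ of the corresponding exponent. The terms attached to a sphere $\mathbb{S}_a$ do not depend on the chosen representative $a$. A PQL function is $f(x)=a_{0}(x-q_{1})^{M_{1}}a_{1}(x-q_2)^{M_2}a_2\cdots(x-q_{N})^{M_{N}}a_{N}$ with pointwise quaternionic multiplication, $q_k\in\mathbb{H}$ and $a_k\in\mathbb{H}\setminus\{0\}$ (repetitions allowed) and $M_k\in\{\pm1\}$. For a PQL function the hypothesis $f(0)\ne0,\infty$ means $q_k\neq0$ for all $k$. *)

(* Defs.v *)
From Stdlib Require Import Reals ZArith List ClassicalEpsilon.
From Coquelicot Require Import Coquelicot.
Import ListNotations.
Open Scope R_scope.

(** * Quaternions *)

(* (x0, x1, x2, x3) stands for x0 + x1 i + x2 j + x3 k.  As an iterated product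
   of R, [quat] inherits the topology and the R-vector space structure
   (plus, minus, opp, scal, zero) of R^4. *)
Definition quat : Type := (R * R * R * R)%type.

Definition q0 (x : quat) : R := fst (fst (fst x)).
Definition q1 (x : quat) : R := snd (fst (fst x)).
Definition q2 (x : quat) : R := snd (fst x).
Definition q3 (x : quat) : R := snd x.

Definition qreal (r : R) : quat := (r, 0, 0, 0).
Definition qzero : quat := qreal 0.
Definition qone : quat := qreal 1.

Definition qmul (x y : quat) : quat :=
  (q0 x * q0 y - q1 x * q1 y - q2 x * q2 y - q3 x * q3 y,
   q0 x * q1 y + q1 x * q0 y + q2 x * q3 y - q3 x * q2 y,
   q0 x * q2 y - q1 x * q3 y + q2 x * q0 y + q3 x * q1 y,
   q0 x * q3 y + q1 x * q2 y - q2 x * q1 y + q3 x * q0 y).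

Definition qconj (x : quat) : quat := (q0 x, - q1 x, - q2 x, - q3 x).

Definition qdot (x y : quat) : R :=
  q0 x * q0 y + q1 x * q1 y + q2 x * q2 y + q3 x * q3 y.

Definition qnorm (x : quat) : R := sqrt (qdot x x).

Definition qinv (x : quat) : quat := scal (/ qdot x x) (qconj x).

Fixpoint qpow_nat (x : quat) (n : nat) : quat :=
  match n with
  | O => qone
  | S m => qmul x (qpow_nat x m)
  end.

Definition qpow (x : quat) (n : Z) : quat :=
  match n with
  | Z0 => qone
  | Zpos p => qpow_nat x (Pos.to_nat p)
  | Zneg p => qinv (qpow_nat x (Pos.to_nat p))
  end.

Definition is_real_quat (x : quat) : Prop := exists r : R, x = qreal r.

Definition imag_unit (I : quat) : Prop := qmul I I = opp qone.

(* al + I be *)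
Definition slice_pt (al : R) (I : quat) (be : R) : quat :=
  plus (qreal al) (scal be I).

(* x belongs to C_I *)
Definition in_slice (I x : quat) : Prop := exists al be : R, x = slice_pt al I be.

(* x belongs to the sphere S_a *)
Definition on_sphere (a x : quat) : Prop :=
  exists (al be : R) (I J : quat),
    imag_unit I /\ imag_unit J /\ a = slice_pt al I be /\ x = slice_pt al J be.

(* (x - q)^s *)
Definition qsym (q x : quat) : quat :=
  plus (minus (qmul x x) (qmul x (plus q (qconj q)))) (qmul q (qconj q)).

(** * Domains *)

Definition is_connected (U : quat -> Prop) : Prop :=
  forall A B : quat -> Prop,
    open A -> open B ->
    (forall x, U x -> A x \/ B x) ->
    (exists x, U x /\ A x) -> (exists x, U x /\ B x) ->
    exists x, U x /\ A x /\ B x.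

Definition is_domain (U : quat -> Prop) : Prop :=
  open U /\ (exists x, U x) /\ is_connected U.

Definition sym_open (D : C -> Prop) : Prop :=
  open D /\ (forall z, D z -> D (Cconj z)).

(* Omega_D *)
Definition circ (D : C -> Prop) (x : quat) : Prop :=
  exists (al be : R) (I : quat), D (al, be) /\ imag_unit I /\ x = slice_pt al I be.

(** * Slice regular functions *)

(* The pair (p, q) stands for p + iota q in the complexified quaternions. *)
Definition HC : Type := (quat * quat)%type.
Definition HCconj (w : HC) : HC := (fst w, opp (snd w)).
Definition iota_mul (w : HC) : HC := (opp (snd w), fst w).

Definition is_stem (D : C -> Prop) (F : C -> HC) : Prop :=
  forall z, D z -> F (Cconj z) = HCconj (F z).

(* F is C^1 on the open set D, with dF/d(alpha) + iota dF/d(beta) = 0 there;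
   Fa and Fb are the two partial derivatives. *)
Definition stem_holomorphic (D : C -> Prop) (F : C -> HC) : Prop :=
  exists Fa Fb : C -> HC, forall z : C, D z ->
    is_derive (fun t : R => F (t, snd z)) (fst z) (Fa z) /\
    is_derive (fun t : R => F (fst z, t)) (snd z) (Fb z) /\
    continuous Fa z /\ continuous Fb z /\
    plus (Fa z) (iota_mul (Fb z)) = zero.

Definition induces (D : C -> Prop) (F : C -> HC) (f : quat -> quat) : Prop :=
  forall (al be : R) (I : quat), D (al, be) -> imag_unit I ->
    f (slice_pt al I be) = plus (fst (F (al, be))) (qmul I (snd (F (al, be)))).

(* f is (slice) regular on Omega_D; its values elsewhere are irrelevant. *)
Definition regular (D : C -> Prop) (f : quat -> quat) : Prop :=
  sym_open D /\
  exists F : C -> HC, is_stem D F /\ stem_holomorphic D F /\ induces D F f.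

(** * Semiregular functions *)

(* A function with values in H u {infinity}; [None] is infinity. *)
Definition qhat_fun : Type := quat -> option quat.

(* h is regular on a circular neighbourhood Omega_E of x and coincides there,
   off S_x, with f0, which is defined on Omega_D'. *)
Definition regular_ext (D' : C -> Prop) (f0 : quat -> quat) (x : quat)
    (E : C -> Prop) (h : quat -> quat) : Prop :=
  regular E h /\ circ E x /\
  (forall y, circ E y -> ~ on_sphere x y -> circ D' y /\ h y = f0 y).

Definition is_pole (D' : C -> Prop) (f0 : quat -> quat) (x : quat) : Prop :=
  (exists (m : nat) (E : C -> Prop) (h : quat -> quat),
     regular_ext D' (fun y => qmul (qpow_nat (qsym x y) m) (f0 y)) x E h) /\
  ~ (exists (E : C -> Prop) (h : quat -> quat), regular_ext D' f0 x E h).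

(* The value of f is infinity at a pole, and at a removable singularity it is the
   value of the regular extension. *)
Definition semiregular (D : C -> Prop) (f : qhat_fun) : Prop :=
  sym_open D /\
  exists (D' : C -> Prop) (f0 : quat -> quat),
    (forall z, D' z -> D z) /\
    regular D' f0 /\
    (forall x, circ D' x -> f x = Some (f0 x)) /\
    (forall x, circ D x -> ~ circ D' x ->
       (exists (E : C -> Prop) (h : quat -> quat),
          regular_ext D' f0 x E h /\ f x = Some (h x))
       \/ (is_pole D' f0 x /\ f x = None)).

Definition slice_preserving (U : quat -> Prop) (f : qhat_fun) : Prop :=
  forall J x v : quat, imag_unit J -> U x -> in_slice J x ->
    f x = Some v -> in_slice J v.

(** * Zeros, poles and multiplicities *)

Definition real_zero (f : qhat_fun) (r : R) : Prop := f (qreal r) = Some qzero.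
Definition real_pole (f : qhat_fun) (r : R) : Prop := f (qreal r) = None.
Definition spherical_zero (f : qhat_fun) (a : quat) : Prop :=
  ~ is_real_quat a /\ forall x, on_sphere a x -> f x = Some qzero.
Definition spherical_pole (f : qhat_fun) (a : quat) : Prop :=
  ~ is_real_quat a /\ forall x, on_sphere a x -> f x = None.

(* The product of the (x - r)^n for (r, n) in rl and of the ((x - q)^s)^n
   for (q, n) in sl. *)
Definition factor_prod (rl : list (R * Z)) (sl : list (quat * Z)) (x : quat) : quat :=
  qmul
    (fold_right qmul qone
       (map (fun c => qpow (minus x (qreal (fst c))) (snd c)) rl))
    (fold_right qmul qone (map (fun c => qpow (qsym (fst c) x) (snd c)) sl)).

Definition factor_pole (rl : list (R * Z)) (sl : list (quat * Z)) (x : quat) : Prop :=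
  (exists r n, In (r, n) rl /\ (n < 0)%Z /\ x = qreal r) \/
  (exists q n, In (q, n) sl /\ (n < 0)%Z /\ on_sphere q x).

(* On the ball B_rho, f is [factor_prod rl sl] times g, with g regular, slice
   preserving and without zeros. *)
Definition factorization (f : qhat_fun) (rho : R)
    (rl : list (R * Z)) (sl : list (quat * Z)) (g : quat -> quat) : Prop :=
  (forall r n, In (r, n) rl -> Rabs r < rho /\ n <> 0%Z) /\
  ForallOrdPairs (fun c d => fst c <> fst d) rl /\
  (forall q n, In (q, n) sl -> qnorm q < rho /\ ~ is_real_quat q /\ n <> 0%Z) /\
  ForallOrdPairs (fun c d => ~ on_sphere (fst c) (fst d)) sl /\
  regular (fun z : C => Cmod z < rho) g /\
  slice_preserving (fun x => qnorm x < rho) (fun x => Some (g x)) /\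
  (forall x, qnorm x < rho -> g x <> qzero) /\
  (forall x, qnorm x < rho ->
     (factor_pole rl sl x -> f x = None) /\
     (~ factor_pole rl sl x -> f x = Some (qmul (factor_prod rl sl x) (g x)))).

(* The exponent of x - r, resp. of (x - a)^s, in a factorization of f on B_rho is
   n: the multiplicity is n for a zero and -n for a pole. *)
Definition real_exponent (f : qhat_fun) (rho r : R) (n : Z) : Prop :=
  exists rl sl g, factorization f rho rl sl g /\ In (r, n) rl.
Definition sphere_exponent (f : qhat_fun) (rho : R) (a : quat) (n : Z) : Prop :=
  exists rl sl g q, factorization f rho rl sl g /\ In (q, n) sl /\ on_sphere a q.

Definition count {A : Type} (P : A -> Prop) (l : list A) : Z :=
  Z.of_nat (length
    (filter (fun x => if excluded_middle_informative (P x) then true else false) l)).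

(* Each list consists of the zeros or poles of the given kind lying in B_rho, each
   occurring as often as its multiplicity.  A sphere is listed through points on it;
   different occurrences of a sphere may use different points. *)
Definition lists_real_zeros (f : qhat_fun) (rho : R) (rs : list R) : Prop :=
  (forall r, In r rs -> Rabs r < rho /\ real_zero f r) /\
  (forall r, Rabs r < rho -> real_zero f r ->
     real_exponent f rho r (count (fun s => s = r) rs)).
Definition lists_real_poles (f : qhat_fun) (rho : R) (ps : list R) : Prop :=
  (forall p, In p ps -> Rabs p < rho /\ real_pole f p) /\
  (forall p, Rabs p < rho -> real_pole f p ->
     real_exponent f rho p (- count (fun s => s = p) ps)).
Definition lists_spherical_zeros (f : qhat_fun) (rho : R) (as_ : list quat) : Prop :=
  (forall a, In a as_ -> qnorm a < rho /\ spherical_zero f a) /\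
  (forall a, qnorm a < rho -> spherical_zero f a ->
     sphere_exponent f rho a (count (on_sphere a) as_)).
Definition lists_spherical_poles (f : qhat_fun) (rho : R) (bs : list quat) : Prop :=
  (forall b, In b bs -> qnorm b < rho /\ spherical_pole f b) /\
  (forall b, qnorm b < rho -> spherical_pole f b ->
     sphere_exponent f rho b (- count (on_sphere b) bs)).

(** * PQL functions *)

(* a_0 (x-q_1)^{M_1} a_1 ... (x-q_N)^{M_N} a_N *)
Fixpoint pql (a q : nat -> quat) (M : nat -> Z) (N : nat) (x : quat) : quat :=
  match N with
  | O => a O
  | S n => qmul (qmul (pql a q M n x) (qpow (minus x (q N)) (M N))) (a N)
  end.

(* Where some (x - q_k)^{-1} is undefined no value of f is prescribed. *)
Definition is_pql (Omega : quat -> Prop) (f : qhat_fun)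
    (a q : nat -> quat) (M : nat -> Z) (N : nat) : Prop :=
  (forall k, (k <= N)%nat -> a k <> qzero) /\
  (forall k, (1 <= k <= N)%nat -> M k = 1%Z \/ M k = (-1)%Z) /\
  (forall x, Omega x ->
     (forall k, (1 <= k <= N)%nat -> M k = (-1)%Z -> x <> q k) ->
     f x = Some (pql a q M N x)).

(** * Analysis on R^4 *)

(* log |f(x)|, with a dummy value where f(x) is infinity. *)
Definition log_abs (f : qhat_fun) (x : quat) : R :=
  match f x with
  | Some v => ln (qnorm v)
  | None => 0
  end.

Definition second_partial (u : quat -> R) (x e : quat) : R :=
  Derive_n (fun t : R => u (plus x (scal t e))) 2 0.

Definition laplacian (u : quat -> R) (x : quat) : R :=
  second_partial u x (1, 0, 0, 0) + second_partial u x (0, 1, 0, 0)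
  + second_partial u x (0, 0, 1, 0) + second_partial u x (0, 0, 0, 1).

(* Spherical coordinates on the sphere of radius rho, for a, b in [0, PI] and
   c in [0, 2 PI]. *)
Definition sphere_param (rho a b c : R) : quat :=
  (rho * cos a,
   rho * (sin a * cos b),
   rho * (sin a * (sin b * cos c)),
   rho * (sin a * (sin b * sin c))).

Definition qDerive (g : R -> quat) (t : R) : quat :=
  (Derive (fun s => q0 (g s)) t, Derive (fun s => q1 (g s)) t,
   Derive (fun s => q2 (g s)) t, Derive (fun s => q3 (g s)) t).

Definition gram_det (u v w : quat) : R :=
  qdot u u * (qdot v v * qdot w w - qdot v w * qdot v w)
  - qdot u v * (qdot u v * qdot w w - qdot v w * qdot u w)
  + qdot u w * (qdot u v * qdot v w - qdot v v * qdot u w).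

(* The density of the 3-dimensional surface measure in these coordinates; it
   equals rho^3 (sin a)^2 sin b. *)
Definition sphere_density (rho a b c : R) : R :=
  sqrt (gram_det (qDerive (fun s => sphere_param rho s b c) a)
                 (qDerive (fun s => sphere_param rho a s c) b)
                 (qDerive (fun s => sphere_param rho a b s) c)).

Definition sphere_integral (rho : R) (g : quat -> R) : R :=
  RInt (fun a => RInt (fun b => RInt (fun c =>
    g (sphere_param rho a b c) * sphere_density rho a b c)
    0 (2 * PI)) 0 PI) 0 PI.

Definition sphere_area (rho : R) : R := sphere_integral rho (fun _ => 1).

(** * The terms of the formula *)

(* For a quaternion q this is used with s = |q|. *)
Definition real_term (rho s : R) : R :=
  ln (rho / Rabs s) + 1 / 4 * ((s ^ 4 - rho ^ 4) / (rho ^ 2 * s ^ 2)).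

(* b + b^c is real, so (b + b^c)^2 is the square of its real part. *)
Definition sphere_term (rho : R) (b : quat) : R :=
  ln (rho ^ 2 / qnorm b ^ 2)
  + 1 / 4 * ((rho ^ 4 - qnorm b ^ 4) / (rho ^ 2 * qnorm b ^ 4))
    * (2 * qnorm b ^ 2 - q0 (plus b (qconj b)) ^ 2).

Definition sum_over {A : Type} (t : A -> R) (l : list A) : R :=
  fold_right Rplus 0 (map t l).

(* Main.v *)
Require Import Defs.
From Stdlib Require Import Reals ZArith List Lra Lia Classical ClassicalEpsilon.
From Coquelicot Require Import Coquelicot.
Open Scope R_scope.

(** On each slice [log |f|] is [log |G|] with G holomorphic, and on the sphere of radius rho it
    depends only on the angle a to the real axis, with density proportional to [sin a ^ 2].  For
    zero-free G the Fourier coefficients of order 0 and 2 of [log |G|] on circles give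
    [mean = log |G(0)| - rho^2 m / 4], where m is the second derivative of [log |G|] at 0 along
    the real axis; the Laplacian in R^4 of the slice function is m - 3 m = - 2 m, which is the
    formula without zeros and poles.  A factor z - w has on |z| = rho the modulus of the
    zero-free rho - conj(w) z / rho, and comparing both at 0 yields the terms of the zeros and
    poles.  In the PQL case [log |f|] is a sum of functions [log |x - q|], whose spherical means
    are, by rotation invariance, those for the real point q = |q|. *)

(** * Calculus in the plane *)

(** A branch of log G is avoided: h = log |G| is a real function whose gradient is read off from
    G'/G, and its coefficient of order 2 follows by parts from the coefficients of order -1 and 3 of
    G'/G. Cauchy's theorem enters only through a differential equation in the radius: c_k(r) = int G
    e^{ika} da satisfies r c_k' = -k c_k. For G'/G to be holomorphic in the C^1 sense of [hol], G
    needs a second derivative, obtained by differentiating Cauchy's formula in the centre. A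
    factorization lives on the open ball only, so nothing is known of G across the sphere; there log
    |f| comes from local stems of f, and the formula reaches the radius rho by continuity. The
    hypotheses on the lists attach to each zero or pole a factorization of its own. Exponents are
    compared through the limit of log |f| / log t along a horizontal approach, which depends on f
    alone. If no factorization is available, there are no zeros and poles in the ball, and f itself
    is glued into one holomorphic function. *)

Definition cont2 (f : R -> R -> R) (x y : R) : Prop :=
  continuous (fun z : R * R => f (fst z) (snd z)) (x, y).

Lemma cont_plus {T : UniformSpace} (f g : T -> R) x :
  continuous f x -> continuous g x -> continuous (fun t => f t + g t) x.
Proof. exact (continuous_plus (V := R_NormedModule) f g x). Qed.

Lemma cont_opp {T : UniformSpace} (f : T -> R) x :
  continuous f x -> continuous (fun t => - f t) x.
Proof. exact (continuous_opp (V := R_NormedModule) f x). Qed.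

Lemma cont_minus {T : UniformSpace} (f g : T -> R) x :
  continuous f x -> continuous g x -> continuous (fun t => f t - g t) x.
Proof. exact (continuous_minus (V := R_NormedModule) f g x). Qed.

Lemma cont_mult {T : UniformSpace} (f g : T -> R) x :
  continuous f x -> continuous g x -> continuous (fun t => f t * g t) x.
Proof. exact (continuous_mult (K := R_AbsRing) f g x). Qed.

Lemma cont_const {T : UniformSpace} (c : R) (x : T) : continuous (fun _ => c) x.
Proof. exact (continuous_const c x). Qed.

Lemma cont_comp {T : UniformSpace} (g : R -> R) (f : T -> R) x :
  continuous f x -> continuous g (f x) -> continuous (fun t => g (f t)) x.
Proof. exact (continuous_comp f g x). Qed.

Lemma cont_comp2 {T : UniformSpace} (p : R -> R -> R) (f g : T -> R) x :
  continuous f x -> continuous g x -> cont2 p (f x) (g x) ->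
  continuous (fun t => p (f t) (g t)) x.
Proof. exact (continuous_comp_2 f g p x). Qed.

Lemma cont_cos {T : UniformSpace} (f : T -> R) x :
  continuous f x -> continuous (fun t => cos (f t)) x.
Proof. intros H; apply cont_comp; [exact H | apply continuous_cos]. Qed.

Lemma cont_sin {T : UniformSpace} (f : T -> R) x :
  continuous f x -> continuous (fun t => sin (f t)) x.
Proof. intros H; apply cont_comp; [exact H | apply continuous_sin]. Qed.

Lemma cont_pow {T : UniformSpace} (f : T -> R) n x :
  continuous f x -> continuous (fun t => f t ^ n) x.
Proof.
  intros H; induction n as [|n IH]; simpl;
    [apply cont_const | apply cont_mult; assumption].
Qed.

Lemma cont_inv {T : UniformSpace} (f : T -> R) x :
  continuous f x -> f x <> 0 -> continuous (fun t => / f t) x.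
Proof. intros H H0; apply cont_comp; [exact H | apply continuous_Rinv; exact H0]. Qed.

Lemma cont_div {T : UniformSpace} (f g : T -> R) x :
  continuous f x -> continuous g x -> g x <> 0 -> continuous (fun t => f t / g t) x.
Proof. intros; apply cont_mult; [|apply cont_inv]; assumption. Qed.

Lemma cont_ln {T : UniformSpace} (f : T -> R) x :
  continuous f x -> 0 < f x -> continuous (fun t => ln (f t)) x.
Proof.
  intros H H0; apply cont_comp; [exact H|].
  apply (ex_derive_continuous (V := R_NormedModule)); eexists; apply is_derive_ln, H0.
Qed.

Ltac cont :=
  repeat match goal with
  | H : ?P |- ?P => exact H
  | |- continuous (fun _ => _ + _) _ => apply cont_plus
  | |- continuous (fun _ => _ - _) _ => apply cont_minus
  | |- continuous (fun _ => - _) _ => apply cont_opp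
  | |- continuous (fun _ => _ * _) _ => apply cont_mult
  | |- continuous (fun _ => _ / _) _ => apply cont_div
  | |- continuous (fun _ => / _) _ => apply cont_inv
  | |- continuous (fun _ => cos _) _ => apply cont_cos
  | |- continuous (fun _ => sin _) _ => apply cont_sin
  | |- continuous (fun _ => ln _) _ => apply cont_ln
  | |- continuous (fun _ => _ ^ _) _ => apply cont_pow
  | |- continuous (Rmult ?k) _ => apply (cont_mult (fun _ => k) (fun t => t))
  | |- continuous cos _ => apply continuous_cos
  | |- continuous sin _ => apply continuous_sin
  | |- continuous (Rplus ?k) _ => apply (cont_plus (fun _ => k) (fun t => t))
  | |- continuous (fun _ => ?c) _ => apply (cont_const c)
  | |- continuous (fun z => z) _ => apply continuous_id
  | |- continuous (fun z => fst z) (_, _) => apply continuous_fst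
  | |- continuous (fun z => snd z) (_, _) => apply continuous_snd
  | |- continuous fst (_, _) => apply continuous_fst
  | |- continuous snd (_, _) => apply continuous_snd
  end.

Lemma cont_all_RInt (f : R -> R) a b : (forall x, continuous f x) -> ex_RInt f a b.
Proof. intros H; apply (ex_RInt_continuous (V := R_CompleteNormedModule)); auto. Qed.

Lemma is_derive_val (f : R -> R) (x l l' : R) : is_derive f x l -> l = l' -> is_derive f x l'.
Proof. now intros H <-. Qed.

Lemma der_plus (f g : R -> R) (x df dg : R) :
  is_derive f x df -> is_derive g x dg -> is_derive (fun t => f t + g t) x (df + dg).
Proof. exact (is_derive_plus f g x df dg). Qed.

Lemma der_opp (f : R -> R) (x df : R) : is_derive f x df -> is_derive (fun t => - f t) x (- df).
Proof. exact (is_derive_opp f x df). Qed.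

Lemma der_minus (f g : R -> R) (x df dg : R) :
  is_derive f x df -> is_derive g x dg -> is_derive (fun t => f t - g t) x (df - dg).
Proof. exact (is_derive_minus f g x df dg). Qed.

Lemma der_mult (f g : R -> R) (x df dg : R) :
  is_derive f x df -> is_derive g x dg ->
  is_derive (fun t => f t * g t) x (df * g x + f x * dg).
Proof. intros Hf Hg; apply (is_derive_mult f g x df dg Hf Hg); intros; apply Rmult_comm. Qed.

Lemma der_div (f g : R -> R) (x df dg : R) :
  is_derive f x df -> is_derive g x dg -> g x <> 0 ->
  is_derive (fun t => f t / g t) x ((df * g x - f x * dg) / g x ^ 2).
Proof. exact (is_derive_div f g x df dg). Qed.

Lemma der_comp (f g : R -> R) (x df dg : R) :
  is_derive f (g x) df -> is_derive g x dg -> is_derive (fun t => f (g t)) x (dg * df).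
Proof. exact (is_derive_comp f g x df dg). Qed.

Lemma der_const (c x : R) : is_derive (fun _ => c) x 0.
Proof. exact (is_derive_const c x). Qed.

Lemma der_id (x : R) : is_derive (fun t => t) x 1.
Proof. exact (is_derive_id x). Qed.

Lemma der_cont (f : R -> R) (x l : R) : is_derive f x l -> continuous f x.
Proof. intros H; apply (ex_derive_continuous (V := R_NormedModule)); now exists l. Qed.

(** Total differentiability at the point needs only one partial derivative to exist nearby and be
    continuous; the other is needed at the point alone. *)
Lemma chain2 (u ux uy : R -> R -> R) (X Y : R -> R) (t X' Y' : R) :
  locally (X t, Y t)
    (fun z : R * R => is_derive (fun x => u x (snd z)) (fst z) (ux (fst z) (snd z))) ->
  is_derive (fun y => u (X t) y) (Y t) (uy (X t) (Y t)) ->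
  cont2 ux (X t) (Y t) ->
  is_derive X t X' -> is_derive Y t Y' ->
  is_derive (fun s => u (X s) (Y s)) t (X' * ux (X t) (Y t) + Y' * uy (X t) (Y t)).
Proof.
  intros H1 H2 H3 HX HY.
  pose proof (is_derive_filterdiff u (X t) (Y t) ux (uy (X t) (Y t)) H1 H2 H3) as H.
  pose proof (filterdiff_comp'_2 X Y u t _ _
    (fun a b : R => plus (scal a (ux (X t) (Y t))) (scal b (uy (X t) (Y t)))) HX HY H) as K.
  unfold is_derive; eapply filterdiff_ext_lin; [exact K|].
  intros y; unfold scal, plus; simpl; unfold mult; simpl; ring.
Qed.

Lemma cont2_partials (u ux uy : R -> R -> R) (x y : R) :
  locally (x, y)
    (fun z : R * R => is_derive (fun t => u t (snd z)) (fst z) (ux (fst z) (snd z))) ->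
  is_derive (fun t => u x t) y (uy x y) ->
  cont2 ux x y -> cont2 u x y.
Proof.
  intros H1 H2 H3.
  pose proof (is_derive_filterdiff u x y ux (uy x y) H1 H2 H3) as H.
  unfold cont2. apply (filterdiff_continuous (K := R_AbsRing)
    (U := prod_NormedModule R_AbsRing R_NormedModule R_NormedModule) (V := R_NormedModule)).
  eexists; exact H.
Qed.

(** * Integrals depending on a parameter *)

(** Near the compact segment of points (x0, t) the integrand is uniformly close to its value at x0,
    by a finite cover; continuity is needed only at the points of that segment. *)
Lemma cont_param {T : UniformSpace} (f : T -> R -> R) (a b : R) (x0 : T) :
  a <= b ->
  (forall t, a <= t <= b -> continuous (fun z : T * R => f (fst z) (snd z)) (x0, t)) ->
  locally x0 (fun x => ex_RInt (f x) a b) ->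
  continuous (fun x => RInt (f x) a b) x0.
Proof.
  intros Hab Hc He.
  apply filterlim_locally; intros eps.
  (* The summand 1 keeps the denominator positive when a = b and makes the final inequality
     strict. *)
  assert (Hk : 0 < eps / (2 * (b - a + 1))).
  { apply Rdiv_lt_0_compat; [apply eps | lra]. }
  set (k := mkposreal _ Hk).
  assert (Hd : forall t, exists d : posreal, a <= t <= b ->
     forall x s, ball x0 d x -> Rabs (s - t) < d -> Rabs (f x s - f x0 t) < k).
  { intros t. destruct (classic (a <= t <= b)) as [Ht|Ht].
    - pose proof (proj1 (filterlim_locally _ _) (Hc t Ht) k) as [d Hd].
      exists d; intros _ x s Hx Hs. apply (Hd (x, s)). split; assumption.
    - exists (mkposreal 1 Rlt_0_1); intros H; contradiction. }
  set (delta := fun t => proj1_sig (constructive_indefinite_description _ (Hd t))).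
  assert (Hdelta : forall t, a <= t <= b ->
     forall x s, ball x0 (delta t) x -> Rabs (s - t) < delta t -> Rabs (f x s - f x0 t) < k).
  { intros t Ht; unfold delta; destruct constructive_indefinite_description; auto. }
  destruct (compactness_value_1d a b delta) as [d Hcomp].
  assert (Hunif : forall x, ball x0 d x -> forall s, a <= s <= b ->
     Rabs (f x s - f x0 s) <= 2 * k).
  (* [compactness_value_1d] gives the cover under a double negation, which the proof of a non-strict
     inequality absorbs. *)
  { intros x Hx s Hs. apply Rnot_lt_le; intros Habs.
    apply (Hcomp s Hs); intros [t [Ht [Hst Hdt]]].
    assert (A1 := Hdelta t Ht x s (ball_le _ _ _ Hdt _ Hx) Hst).
    assert (A2 := Hdelta t Ht x0 s (ball_center _ _) Hst).
    revert Habs; apply Rle_not_lt.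
    replace (f x s - f x0 s) with ((f x s - f x0 t) - (f x0 s - f x0 t)) by ring.
    eapply Rle_trans; [apply Rabs_triang|]. rewrite Rabs_Ropp. lra. }
  destruct He as [d2 He].
  assert (Hm : 0 < Rmin d d2) by (apply Rmin_pos; [apply d | apply d2]).
  exists (mkposreal _ Hm); intros x Hx.
  assert (B1 : ball x0 d x) by (apply (ball_le _ _ _ (Rmin_l d d2) _ Hx)).
  assert (B2 : ball x0 d2 x) by (apply (ball_le _ _ _ (Rmin_r d d2) _ Hx)).
  pose proof (RInt_correct (V := R_CompleteNormedModule) _ _ _ (He x B2)) as I1.
  pose proof (RInt_correct (V := R_CompleteNormedModule) _ _ _ (He x0 (ball_center _ _))) as I0.
  pose proof (norm_RInt_le_const (V := R_NormedModule) _ a b _ (2 * k) Hab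
    (fun s Hs => Hunif x B1 s Hs) (is_RInt_minus _ _ _ _ _ _ I1 I0)) as Hn.
  change (Rabs (RInt (f x) a b - RInt (f x0) a b) < eps).
  eapply Rle_lt_trans; [exact Hn|].
  unfold k; simpl. apply Rlt_le_trans with ((b - a + 1) * (2 * (eps / (2 * (b - a + 1))))).
  - apply Rmult_lt_compat_r; [|lra].
    apply Rmult_lt_0_compat; [lra | exact Hk].
  - right; field; lra.
Qed.

Lemma der_param (f df : R -> R -> R) (a b x : R) :
  locally x (fun y => forall t, is_derive (fun u => f u t) y (df y t)) ->
  (forall t, cont2 df x t) ->
  locally x (fun y => forall t, continuous (f y) t) ->
  is_derive (fun y => RInt (f y) a b) x (RInt (df x) a b).
Proof.
  intros H1 H2 H3.
  assert (E : forall t, Derive (fun u => f u t) x = df x t).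
  { intros t; apply is_derive_unique. exact (locally_singleton _ _ H1 t). }
  eapply is_derive_val; [apply is_derive_RInt_param|].
  - revert H1; apply filter_imp; intros y Hy t _; eexists; apply Hy.
  - intros t _.
    apply continuity_2d_pt_ext_loc with df.
    + destruct H1 as [d H1]; exists d; intros u v Hu Hv.
      symmetry; apply is_derive_unique, H1, Hu.
    + apply continuity_2d_pt_filterlim, H2.
  - revert H3; apply filter_imp; intros y Hy; apply cont_all_RInt, Hy.
  - apply RInt_ext; intros t _; apply E.
Qed.

Lemma der_param_all (f df : R -> R -> R) (a b x : R) :
  (forall y t, is_derive (fun u => f u t) y (df y t)) ->
  (forall y t, cont2 df y t) -> (forall y t, continuous (f y) t) ->
  is_derive (fun y => RInt (f y) a b) x (RInt (df x) a b).
Proof. intros; apply der_param; auto; apply filter_forall; auto. Qed.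

Lemma cont_param_all {T : UniformSpace} (f : T -> R -> R) (a b : R) (x : T) :
  a <= b -> (forall y t, continuous (fun z : T * R => f (fst z) (snd z)) (y, t)) ->
  continuous (fun y => RInt (f y) a b) x.
Proof.
  intros Hab H; apply cont_param; auto.
  apply filter_forall; intros y; apply cont_all_RInt; intros t.
  apply (continuous_comp (fun t => (y, t)) (fun z : T * R => f (fst z) (snd z))); [|apply H].
  apply (continuous_comp_2 (fun _ : R => y) (fun t : R => t) pair).
  - apply continuous_const.
  - apply continuous_id.
  - apply continuous_ext with (fun z => z); [now intros [] | apply continuous_id].
Qed.

Lemma RInt_val (f : R -> R) (a b l : R) : is_RInt f a b l -> RInt f a b = l.
Proof. exact (is_RInt_unique (V := R_CompleteNormedModule) f a b l). Qed.

Lemma RInt_spec (f : R -> R) (a b : R) : ex_RInt f a b -> is_RInt f a b (RInt f a b).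
Proof. exact (RInt_correct (V := R_CompleteNormedModule) f a b). Qed.

Lemma RInt_deriv (f df : R -> R) (a b : R) :
  (forall x, is_derive f x (df x)) -> (forall x, continuous df x) ->
  RInt df a b = f b - f a.
Proof.
  intros H1 H2; apply is_RInt_unique.
  apply (is_RInt_derive (V := R_CompleteNormedModule)); auto.
Qed.

Lemma cst_of_zero_der (f : R -> R) (a b : R) :
  (forall t, Rmin a b <= t <= Rmax a b -> is_derive f t 0) -> f a = f b.
Proof.
  intros H. destruct (Rtotal_order a b) as [h|[h|h]].
  - apply (eq_is_derive (V := R_NormedModule)); [|exact h].
    intros t Ht; apply H; rewrite Rmin_left, Rmax_right; lra.
  - now subst.
  - symmetry; apply (eq_is_derive (V := R_NormedModule)); [|exact h].
    intros t Ht; apply H; rewrite Rmin_right, Rmax_left; lra.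
Qed.

(* [ring] and [field] fail on equations whose type is R only up to conversion. *)
Ltac in_R := match goal with |- @eq _ ?a ?b => change (@eq R a b) end.
Ltac rring := in_R; apply Rminus_diag_uniq; ring.

Ltac conjs := repeat match goal with |- _ /\ _ => split end.

Lemma RInt_add (f g : R -> R) a b : ex_RInt f a b -> ex_RInt g a b ->
  @eq R (RInt (fun x => f x + g x) a b) (RInt f a b + RInt g a b).
Proof. exact (RInt_plus (V := R_CompleteNormedModule) f g a b). Qed.

Lemma RInt_sub (f g : R -> R) a b : ex_RInt f a b -> ex_RInt g a b ->
  @eq R (RInt (fun x => f x - g x) a b) (RInt f a b - RInt g a b).
Proof. exact (RInt_minus (V := R_CompleteNormedModule) f g a b). Qed.

Lemma RInt_mul (f : R -> R) c a b : ex_RInt f a b ->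
  @eq R (RInt (fun x => c * f x) a b) (c * RInt f a b).
Proof. exact (RInt_scal (V := R_CompleteNormedModule) f a b c). Qed.

Lemma RInt_cst (c a b : R) : @eq R (RInt (fun _ => c) a b) ((b - a) * c).
Proof. exact (RInt_const (V := R_CompleteNormedModule) a b c). Qed.

(** * Holomorphic functions in real coordinates *)

(* u + iv is holomorphic with derivative p + is. *)
Definition hol (D : R -> R -> Prop) (u v p s : R -> R -> R) : Prop :=
  (forall x y, D x y -> locally (x, y) (fun z : R * R => D (fst z) (snd z))) /\
  forall x y, D x y ->
    is_derive (fun t => u t y) x (p x y) /\ is_derive (fun t => u x t) y (- s x y) /\
    is_derive (fun t => v t y) x (s x y) /\ is_derive (fun t => v x t) y (p x y) /\
    cont2 p x y /\ cont2 s x y.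

(** -i (u + iv) = v - iu: every statement about the real part u thereby becomes one about v. *)
Lemma hol_mul_neg_i D u v p s :
  hol D u v p s -> hol D v (fun x y => - u x y) s (fun x y => - p x y).
Proof.
  intros [Ho H]; split; [exact Ho|]; intros x y Hxy.
  destruct (H x y Hxy) as (h1 & h2 & h3 & h4 & h5 & h6).
  conjs; try assumption.
  - eapply is_derive_val; [exact h4 | ring].
  - apply der_opp, h1.
  - eapply is_derive_val; [apply der_opp, h2 | ring].
  - unfold cont2; apply cont_opp, h5.
Qed.

Lemma hol_locally D u v p s x y (P : R -> R -> Prop) :
  hol D u v p s -> D x y -> (forall x y, D x y -> P x y) ->
  locally (x, y) (fun z : R * R => P (fst z) (snd z)).
Proof. intros [Ho _] Hxy HP; generalize (Ho x y Hxy); apply filter_imp; intros z; apply HP. Qed.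

Lemma hol_cont D u v p s x y : hol D u v p s -> D x y -> cont2 u x y.
Proof.
  intros Hh Hxy; apply cont2_partials with p (fun x y => - s x y).
  - apply (hol_locally D u v p s x y
      (fun x y => is_derive (fun t => u t y) x (p x y)) Hh Hxy), Hh.
  - apply Hh, Hxy.
  - apply Hh, Hxy.
Qed.

Lemma hol_chain D u v p s X Y t X' Y' :
  hol D u v p s -> D (X t) (Y t) -> is_derive X t X' -> is_derive Y t Y' ->
  is_derive (fun t => u (X t) (Y t)) t (X' * p (X t) (Y t) - Y' * s (X t) (Y t)).
Proof.
  intros Hh Hxy HX HY.
  eapply is_derive_val; [apply chain2 with (ux := p) (uy := fun x y => - s x y)|];
    try eassumption; try (apply Hh, Hxy); [|ring].
  apply (hol_locally D u v p s _ _
    (fun x y => is_derive (fun t => u t y) x (p x y)) Hh Hxy), Hh.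
Qed.

Notation polar f x y r a := (f (x + r * cos a) (y + r * sin a)) (only parsing).

Lemma hol_polar_r D u v p s x0 y0 r a :
  hol D u v p s -> polar D x0 y0 r a ->
  is_derive (fun r => polar u x0 y0 r a) r
    (polar p x0 y0 r a * cos a
     - polar s x0 y0 r a * sin a).
Proof.
  intros Hh HD.
  eapply is_derive_val.
  - apply (hol_chain D u v p s (fun r => x0 + r * cos a) (fun r => y0 + r * sin a) r
      (cos a) (sin a) Hh HD); auto_derive; trivial; ring.
  - ring.
Qed.

Lemma hol_polar_a D u v p s x0 y0 r a :
  hol D u v p s -> polar D x0 y0 r a ->
  is_derive (fun a => polar u x0 y0 r a) a
    (- r * (polar p x0 y0 r a * sin a
            + polar s x0 y0 r a * cos a)).
Proof.
  intros Hh HD.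
  eapply is_derive_val.
  - apply (hol_chain D u v p s (fun a => x0 + r * cos a) (fun a => y0 + r * sin a) a
      (- r * sin a) (r * cos a) Hh HD); auto_derive; trivial; ring.
  - ring.
Qed.

Lemma cont_polar {T : UniformSpace} (f : R -> R -> R) x0 y0 (r a : T -> R) t :
  cont2 f (x0 + r t * cos (a t)) (y0 + r t * sin (a t)) ->
  continuous r t -> continuous a t ->
  continuous (fun t => f (x0 + r t * cos (a t)) (y0 + r t * sin (a t))) t.
Proof. intros; apply cont_comp2; cont. Qed.

(** * Fourier coefficients of a holomorphic function on circles *)

Lemma locally_abs_lt (r R0 : R) : Rabs r < R0 -> locally r (fun r => Rabs r < R0).
Proof.
  intros H; exists (mkposreal (R0 - Rabs r) (Rlt_Rminus _ _ H)); intros y Hy.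
  change (Rabs (y - r) < R0 - Rabs r) in Hy.
  replace y with ((y - r) + r) by ring. eapply Rle_lt_trans; [apply Rabs_triang | lra].
Qed.

(* [int (u + iv) e^{ika} da], real part, over the circle of radius r. *)
Definition circ_coef (u v : R -> R -> R) (x0 y0 k r : R) : R :=
  RInt (fun a => polar u x0 y0 r a * cos (k * a)
                 - polar v x0 y0 r a * sin (k * a)) (- PI) PI.

(** Differentiating G(z0 + r e^{ia}) in r produces G' e^{ia}, which raises the order by one. The
    relation comes from the derivative in a of G e^{ika}, which is i (r G' e^{i(k+1)a} + k G
    e^{ika}) and integrates to zero over a period. The condition sin (k PI) = 0 says that k is an
    integer. *)
Lemma circ_coef_ode D u v p s x0 y0 R0 k r :
  hol D u v p s ->
  (forall r a, Rabs r < R0 -> polar D x0 y0 r a) ->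
  sin (k * PI) = 0 -> Rabs r < R0 ->
  is_derive (circ_coef u v x0 y0 k) r (circ_coef p s x0 y0 (k + 1) r) /\
  r * circ_coef p s x0 y0 (k + 1) r + k * circ_coef u v x0 y0 k r = 0.
Proof.
  intros Hh HD Hk Hr.
  assert (Hi := hol_mul_neg_i _ _ _ _ _ Hh).
  assert (Hu : forall r a, Rabs r < R0 -> polar (cont2 u) x0 y0 r a).
  { intros; apply (hol_cont D u v p s); auto. }
  assert (Hv : forall r a, Rabs r < R0 -> polar (cont2 v) x0 y0 r a).
  { intros; eapply (hol_cont D v); [exact Hi | auto]. }
  assert (Hp : forall r a, Rabs r < R0 -> polar (cont2 p) x0 y0 r a).
  { intros; apply Hh; auto. }
  assert (Hs : forall r a, Rabs r < R0 -> polar (cont2 s) x0 y0 r a).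
  { intros; apply Hh; auto. }
  assert (Cu : forall f, (forall r a, Rabs r < R0 -> polar (cont2 f) x0 y0 r a) ->
     forall r a, Rabs r < R0 ->
     continuous (fun z : R * R => f (x0 + fst z * cos (snd z)) (y0 + fst z * sin (snd z))) (r, a)).
  { intros f Hf r' a Hr'. apply (cont_polar f x0 y0 fst snd (r', a)); cont; apply Hf, Hr'. }
  assert (Cu1 : forall f, (forall r a, Rabs r < R0 -> polar (cont2 f) x0 y0 r a) ->
     forall r a, Rabs r < R0 ->
     continuous (fun a => polar f x0 y0 r a) a).
  { intros f Hf r' a Hr'. apply (cont_polar f x0 y0 (fun _ => r') (fun a => a) a); cont;
    apply Hf, Hr'. }
  split.
  - apply der_param with
      (f := fun r a => polar u x0 y0 r a * cos (k * a)
                 - polar v x0 y0 r a * sin (k * a))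
      (df := fun r a => polar p x0 y0 r a * cos ((k + 1) * a)
                 - polar s x0 y0 r a * sin ((k + 1) * a)).
    + generalize (locally_abs_lt _ _ Hr); apply filter_imp; intros r' Hr' a.
      eapply is_derive_val.
      * apply der_minus; (apply der_mult; [|apply der_const]).
        -- eapply hol_polar_r; [exact Hh | auto].
        -- eapply hol_polar_r; [exact Hi | auto].
      * replace ((k + 1) * a) with (k * a + a) by ring.
        rewrite cos_plus, sin_plus; simpl; ring.
    + intros a; unfold cont2; cont; apply Cu; auto.
    + generalize (locally_abs_lt _ _ Hr); apply filter_imp; intros r' Hr' a.
      cont; apply Cu1; auto.
  - assert (I : RInt (fun a =>
        r * (polar p x0 y0 r a * cos ((k + 1) * a)
             - polar s x0 y0 r a * sin ((k + 1) * a))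
        + k * (polar u x0 y0 r a * cos (k * a)
             - polar v x0 y0 r a * sin (k * a))) (- PI) PI = 0).
    (* The antiderivative is the imaginary part of G e^{ika}; its values at -PI and PI agree because
       sin (k PI) = 0. *)
    { rewrite RInt_deriv with (f := fun a =>
        polar u x0 y0 r a * sin (k * a)
        + polar v x0 y0 r a * cos (k * a)).
      - replace (k * - PI) with (- (k * PI)) by ring.
        rewrite !sin_neg, !cos_neg, Hk, sin_PI.
        replace (- 0) with 0 by ring. rring.
      - intros a; eapply is_derive_val.
        + apply der_plus; apply der_mult.
          * eapply hol_polar_a; [exact Hh | auto].
          * apply (der_comp sin (fun a => k * a) a (cos (k * a)) k);
              [apply is_derive_sin | auto_derive; trivial; ring].
          * eapply hol_polar_a; [exact Hi | auto].
          * apply (der_comp cos (fun a => k * a) a (- sin (k * a)) k);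
              [apply is_derive_cos | auto_derive; trivial; ring].
        + replace ((k + 1) * a) with (k * a + a) by ring.
          rewrite cos_plus, sin_plus; simpl; ring.
      - intros a; cont; apply Cu1; auto. }
    rewrite <- I.
    rewrite RInt_add, !RInt_mul; [reflexivity | | | |];
      apply cont_all_RInt; intros a; cont; apply Cu1; auto.
Qed.

(** Q(x)/x has derivative zero away from 0, hence is constant on each side of 0, and its limit at 0
    is Q'(0). No continuity of Q' enters. *)
Lemma homogeneous_ode (Q Q' : R -> R) (R0 r : R) :
  (forall r, Rabs r < R0 -> is_derive Q r (Q' r) /\ r * Q' r - Q r = 0) ->
  Rabs r < R0 -> Q r = Q' 0 * r.
Proof.
  intros H Hr.
  assert (HR0 : Rabs 0 < R0) by (rewrite Rabs_R0; eapply Rle_lt_trans; [apply Rabs_pos | exact Hr]).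
  assert (Q0 : Q 0 = 0) by (destruct (H 0 HR0); lra).
  destruct (Req_dec r 0) as [->|Hr0]; [lra|].
  (* Scaling r by t in (0, 1] moves towards 0 on the side of r, so both signs of r are treated at
     once. *)
  assert (Hq : forall t, 0 < t <= 1 -> Q (t * r) / (t * r) = Q r / r).
  { intros t Ht.
    assert (E : Q (t * r) / (t * r) = Q (1 * r) / (1 * r)).
    { apply (cst_of_zero_der (fun t => Q (t * r) / (t * r)) t 1).
      intros x Hx; rewrite Rmin_left, Rmax_right in Hx by lra.
      assert (Hxr : Rabs (x * r) < R0).
      { rewrite Rabs_mult, (Rabs_pos_eq x) by lra.
        apply Rle_lt_trans with (1 * Rabs r); [|lra].
        apply Rmult_le_compat_r; [apply Rabs_pos | lra]. }
      destruct (H _ Hxr) as [D1 D2].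
      assert (x * r <> 0) by (apply Rmult_integral_contrapositive; split; lra).
      eapply is_derive_val.
      - apply der_div; [| |assumption].
        + apply (der_comp Q (fun x => x * r) x (Q' (x * r)) r D1).
          auto_derive; trivial; ring.
        + auto_derive; [trivial | reflexivity].
      - assert (E : Q (x * r) = x * r * Q' (x * r)) by lra.
        cbv beta; rewrite E; field; lra. }
    rewrite E; f_equal; [f_equal|]; ring. }
  assert (L : Q r / r = Q' 0).
  { apply Rminus_diag_uniq. apply NNPP; intros Hne.
    (* At every t r the difference quotient of Q at 0 equals Q r / r exactly, so choosing epsilon to
       be the supposed gap gives a contradiction. *)
    assert (He : 0 < Rabs (Q r / r - Q' 0)) by (apply Rabs_pos_lt, Hne).
    destruct (H 0 HR0) as [D1 _]; apply is_derive_Reals in D1.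
    destruct (D1 _ He) as [d Hd].
    set (t := Rmin 1 (d / (2 * Rabs r))).
    assert (Hra : 0 < Rabs r) by (apply Rabs_pos_lt; assumption).
    assert (Hdr : 0 < d / (2 * Rabs r)) by (apply Rdiv_lt_0_compat; [apply d | lra]).
    assert (Ht : 0 < t <= 1) by (split; [apply Rmin_pos; lra | apply Rmin_l]).
    specialize (Hd (t * r)).
    rewrite Rplus_0_l, Q0, Rminus_0_r, (Hq t Ht) in Hd.
    apply (Rlt_irrefl (Rabs (Q r / r - Q' 0))), Hd.
    - apply Rmult_integral_contrapositive; split; lra.
    - rewrite Rabs_mult, (Rabs_pos_eq t) by lra.
      apply Rle_lt_trans with (d / (2 * Rabs r) * Rabs r).
      + apply Rmult_le_compat_r; [lra | apply Rmin_r].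
      + replace (d / (2 * Rabs r) * Rabs r) with (d / 2) by (field; lra).
        generalize (cond_pos d); lra. }
  rewrite <- L; field; assumption.
Qed.

Lemma circ_coef_at_0 (u v : R -> R -> R) x0 y0 :
  circ_coef u v x0 y0 0 0 = 2 * PI * u x0 y0.
Proof.
  unfold circ_coef. rewrite (RInt_ext _ (fun _ => u x0 y0)).
  - rewrite RInt_cst. rring.
  - intros a _. rewrite !Rmult_0_l, !Rplus_0_r, cos_0, sin_0. rring.
Qed.

(** Cauchy's formula for the derivative, real part: for k = -1 the equation reads r Q' = Q, and
    Q'(0) is the order-0 coefficient of G' on the circle of radius 0. *)
Lemma circ_coef_neg1 D u v p s x0 y0 R0 r :
  hol D u v p s ->
  (forall r a, Rabs r < R0 -> polar D x0 y0 r a) -> Rabs r < R0 ->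
  circ_coef u v x0 y0 (-1) r = 2 * PI * p x0 y0 * r.
Proof.
  intros Hh HD Hr.
  assert (Hk : sin (-1 * PI) = 0).
  { replace (-1 * PI) with (- PI) by ring. rewrite sin_neg, sin_PI; ring. }
  rewrite (homogeneous_ode (circ_coef u v x0 y0 (-1)) (circ_coef p s x0 y0 0) R0 r).
  - now rewrite circ_coef_at_0.
  - intros t Ht.
    destruct (circ_coef_ode D u v p s x0 y0 R0 (-1) t Hh HD Hk Ht) as [A B].
    replace (-1 + 1) with 0 in A, B by ring. split; [exact A | lra].
  - exact Hr.
Qed.

Lemma sin_nat_PI (n : nat) : sin (INR n * PI) = 0.
Proof. apply sin_eq_0_1; exists (Z.of_nat n); now rewrite INR_IZR_INZ. Qed.

(** By the equation r^k c_k(r) is constant, and it vanishes at r = 0: a holomorphic function has no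
    negative powers in its Laurent series. At r = 0 itself the equation says k c_k = 0. *)
Lemma circ_coef_pos D u v p s x0 y0 R0 (n : nat) r :
  hol D u v p s ->
  (forall r a, Rabs r < R0 -> polar D x0 y0 r a) -> Rabs r < R0 ->
  circ_coef u v x0 y0 (INR (S n)) r = 0.
Proof.
  intros Hh HD Hr.
  assert (H := fun t => circ_coef_ode D u v p s x0 y0 R0 _ t Hh HD (sin_nat_PI (S n))).
  set (Q := circ_coef u v x0 y0 (INR (S n))) in *.
  assert (HR0 : 0 < R0) by (eapply Rle_lt_trans; [apply Rabs_pos | exact Hr]).
  assert (Hn : INR (S n) <> 0) by (apply not_0_INR; discriminate).
  destruct (Req_dec r 0) as [->|Hr0].
  - destruct (H 0) as [_ H0]; [rewrite Rabs_R0; exact HR0|].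
    rewrite Rmult_0_l, Rplus_0_l in H0.
    now apply Rmult_integral in H0; destruct H0.
  - assert (E : r ^ S n * Q r = 0 ^ S n * Q 0).
    { apply (cst_of_zero_der (fun r => r ^ S n * Q r)).
      intros t Ht.
      assert (Htr : Rabs t < R0).
      { eapply Rle_lt_trans; [|exact Hr]; revert Ht.
        unfold Rmin, Rmax; destruct Rle_dec; split_Rabs; lra. }
      destruct (H t Htr) as [A B].
      eapply is_derive_val; [apply der_mult; [|exact A]|].
      - apply (is_derive_pow (fun t => t) (S n) t 1), der_id.
      - set (c := circ_coef p s x0 y0 (INR (S n) + 1) t) in *.
        cbv beta; change (pred (S n)) with n; rewrite <- (tech_pow_Rmult t n).
        assert (E : t * c = - (INR (S n) * Q t)) by lra.
        replace (t * t ^ n * c) with (t ^ n * (t * c)) by ring.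
        rewrite E; ring. }
    simpl (0 ^ S n) in E; rewrite !Rmult_0_l in E.
    apply Rmult_integral in E; destruct E as [E|E]; [|exact E].
    exfalso; exact (pow_nonzero r (S n) Hr0 E).
Qed.

(** * Discs, gluing and higher derivatives *)

Definition disc (R0 x y : R) : Prop := Cmod (x, y) < R0.

Lemma Cmod_polar r a : Cmod (r * cos a, r * sin a) = Rabs r.
Proof.
  unfold Cmod; simpl fst; simpl snd.
  replace ((r * cos a) ^ 2 + (r * sin a) ^ 2) with (Rsqr r).
  - apply sqrt_Rsqr_abs.
  - generalize (sin2_cos2 a); unfold Rsqr; intros E.
    replace ((r * cos a) ^ 2 + (r * sin a) ^ 2)
      with (r * r * (sin a * sin a + cos a * cos a)) by ring.
    rewrite E; ring.
Qed.

Lemma Cmod_opp_snd x y : Cmod (x, - y) = Cmod (x, y).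
Proof. unfold Cmod; simpl fst; simpl snd; f_equal; ring. Qed.

Lemma Cmod_add_polar x y r a :
  Cmod (x + r * cos a, y + r * sin a) <= Cmod (x, y) + Rabs r.
Proof.
  rewrite <- (Cmod_polar r a).
  apply (Cmod_triangle (x, y) (r * cos a, r * sin a)).
Qed.

Lemma Cmod_cont (z : R * R) : continuous (fun z : R * R => Cmod z) z.
Proof.
  unfold Cmod. apply (cont_comp sqrt); [|apply continuous_sqrt].
  destruct z as [x y]; cont.
Qed.

Lemma disc_open R0 x y : disc R0 x y -> locally (x, y) (fun z => disc R0 (fst z) (snd z)).
Proof.
  intros H. apply (filter_imp (fun z : R * R => Cmod z < R0)).
  - intros [a b]; exact (fun h => h).
  - apply (Cmod_cont (x, y) (fun t => t < R0)).
    exists (mkposreal (R0 - Cmod (x, y)) (Rlt_Rminus _ _ H)); intros t Ht.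
    change (Rabs (t - Cmod (x, y)) < R0 - Cmod (x, y)) in Ht. split_Rabs; lra.
Qed.

Lemma disc_circle R0 x y r a :
  Cmod (x, y) + Rabs r < R0 -> polar (disc R0) x y r a.
Proof. intros H; unfold disc; eapply Rle_lt_trans; [apply Cmod_add_polar | exact H]. Qed.

Lemma locally_pair_l {U V : UniformSpace} (P : U * V -> Prop) x y :
  locally (x, y) P -> locally x (fun t => P (t, y)).
Proof. intros [d H]; exists d; intros t Ht; apply H; split; [exact Ht | apply ball_center]. Qed.

Lemma locally_pair_r {U V : UniformSpace} (P : U * V -> Prop) x y :
  locally (x, y) P -> locally y (fun t => P (x, t)).
Proof. intros [d H]; exists d; intros t Ht; apply H; split; [apply ball_center | exact Ht]. Qed.

(** The derivatives are given as [Derive] of u and v themselves, so they do not depend on the local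
    representation and no choice among the representations is needed. *)
Lemma hol_of_local (D : R -> R -> Prop) (u v : R -> R -> R) :
  (forall x y, D x y -> locally (x, y) (fun z : R * R => D (fst z) (snd z))) ->
  (forall x y, D x y -> exists E U V P S, hol E U V P S /\ E x y /\
     forall x y, E x y -> u x y = U x y /\ v x y = V x y) ->
  hol D u v (fun x y => Derive (fun t => u t y) x) (fun x y => Derive (fun t => v t y) x).
Proof.
  intros HD Hloc; split; [exact HD|]. intros x y Hxy.
  destruct (Hloc x y Hxy) as (E & U & V & P & S & [LE Hh] & HE & K).
  assert (Dx : forall (f F : R -> R -> R) (l x y : R), (forall x y, E x y -> f x y = F x y) -> E x y ->
    is_derive (fun t => F t y) x l -> is_derive (fun t : R => f t y) x l).
  { intros f F l x' y' HfF H'; apply is_derive_ext_loc.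
    generalize (locally_pair_l _ _ _ (LE x' y' H')); apply filter_imp; intros; symmetry; auto. }
  assert (Dy : forall (f F : R -> R -> R) (l x y : R), (forall x y, E x y -> f x y = F x y) -> E x y ->
    is_derive (fun t => F x t) y l -> is_derive (fun t : R => f x t) y l).
  { intros f F l x' y' HfF H'; apply is_derive_ext_loc.
    generalize (locally_pair_r _ _ _ (LE x' y' H')); apply filter_imp; intros; symmetry; auto. }
  assert (Ku := fun x y H => proj1 (K x y H)). assert (Kv := fun x y H => proj2 (K x y H)).
  assert (UP : forall x y, E x y -> Derive (fun t => u t y) x = P x y)
    by (intros; apply is_derive_unique, (Dx u U); trivial; now apply Hh).
  assert (US : forall x y, E x y -> Derive (fun t => v t y) x = S x y)
    by (intros; apply is_derive_unique, (Dx v V); trivial; now apply Hh).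
  assert (CL : forall f F : R -> R -> R, (forall x y, E x y -> f x y = F x y) -> cont2 F x y -> cont2 f x y).
  { intros f F HfF; apply continuous_ext_loc.
    generalize (LE x y HE); apply filter_imp; intros; symmetry; auto. }
  rewrite (UP x y HE), (US x y HE). destruct (Hh x y HE) as (h1 & h2 & h3 & h4 & h5 & h6).
  conjs; [apply (Dx u U) | apply (Dy u U) | apply (Dx v V) | apply (Dy v V) |
    apply (CL _ P) | apply (CL _ S)]; trivial.
Qed.

Lemma circ_coef_cont (f g : R -> R -> R) x y k r :
  locally (x, y) (fun z : R * R => forall a,
    cont2 f (fst z + r * cos a) (snd z + r * sin a) /\
    cont2 g (fst z + r * cos a) (snd z + r * sin a)) ->
  cont2 (fun x y => circ_coef f g x y k r) x y.
Proof.
  intros H.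
  apply (cont_param (fun (z : R * R) a =>
    f (fst z + r * cos a) (snd z + r * sin a) * cos (k * a)
    - g (fst z + r * cos a) (snd z + r * sin a) * sin (k * a)) (- PI) PI (x, y)).
  - generalize PI_RGT_0; lra.
  - intros a _; destruct (locally_singleton _ _ H a) as [Hf Hg].
    assert (Cx : continuous (fun z : (R * R) * R => fst (fst z)) (x, y, a)).
    { apply continuous_comp; apply continuous_fst. }
    assert (Cy : continuous (fun z : (R * R) * R => snd (fst z)) (x, y, a)).
    { apply continuous_comp; [apply continuous_fst | apply continuous_snd]. }
    cont; apply cont_comp2; cont; assumption.
  - revert H; apply filter_imp; intros z Hz; apply cont_all_RInt; intros a.
    destruct (Hz a) as [Hf Hg].
    cont; apply cont_comp2; cont; assumption.
Qed.

(** The radius is fixed and the centre moves with velocity (X', Y'). In the imaginary direction G'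
    is multiplied by i, which is minus the factor -i that turns (p, s) into (s, -p). *)
Lemma circ_coef_der D u v p s (X Y : R -> R) X' Y' t k r :
  hol D u v p s ->
  (forall t, is_derive X t X') -> (forall t, is_derive Y t Y') ->
  locally t (fun t => forall a, polar D (X t) (Y t) r a) ->
  is_derive (fun t => circ_coef u v (X t) (Y t) k r) t
    (X' * circ_coef p s (X t) (Y t) k r
     - Y' * circ_coef s (fun x y => - p x y) (X t) (Y t) k r).
Proof.
  intros Hh HX HY HD. assert (Hi := hol_mul_neg_i _ _ _ _ _ Hh).
  assert (CX : forall t, continuous X t) by (intros; eapply der_cont, HX).
  assert (CY : forall t, continuous Y t) by (intros; eapply der_cont, HY).
  assert (H0 := fun a => proj2 Hh _ _ (locally_singleton _ _ HD a)).
  assert (Ex : forall f g, (forall a, polar (cont2 f) (X t) (Y t) r a) ->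
    (forall a, polar (cont2 g) (X t) (Y t) r a) ->
    ex_RInt (fun a => polar f (X t) (Y t) r a * cos (k * a)
      - polar g (X t) (Y t) r a * sin (k * a)) (- PI) PI).
  { intros f g Hf Hg; apply cont_all_RInt; intros a; cont; apply cont_comp2; cont; auto. }
  eapply is_derive_val; [apply der_param with
    (f := fun t a => polar u (X t) (Y t) r a * cos (k * a) - polar v (X t) (Y t) r a * sin (k * a))
    (df := fun t a =>
      X' * (polar p (X t) (Y t) r a * cos (k * a) - polar s (X t) (Y t) r a * sin (k * a))
      - Y' * (polar s (X t) (Y t) r a * cos (k * a) - - polar p (X t) (Y t) r a * sin (k * a)))|].
  - revert HD; apply filter_imp; intros t' Ht a.
    assert (HX' : is_derive (fun t => X t + r * cos a) t' X')
      by (eapply is_derive_val; [apply der_plus; [apply HX | apply der_const] | ring]).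
    assert (HY' : is_derive (fun t => Y t + r * sin a) t' Y')
      by (eapply is_derive_val; [apply der_plus; [apply HY | apply der_const] | ring]).
    eapply is_derive_val.
    + apply der_minus; (apply der_mult; [|apply der_const]).
      * apply (hol_chain _ _ _ _ _ _ _ _ _ _ Hh (Ht a) HX' HY').
      * apply (hol_chain _ _ _ _ _ _ _ _ _ _ Hi (Ht a) HX' HY').
    + cbv beta; rring.
  - intros a. destruct (H0 a) as (_ & _ & _ & _ & h5 & h6).
    assert (CX2 : continuous (fun z : R * R => X (fst z)) (t, a)) by (apply cont_comp; cont; apply CX).
    assert (CY2 : continuous (fun z : R * R => Y (fst z)) (t, a)) by (apply cont_comp; cont; apply CY).
    unfold cont2; cont; apply cont_comp2; cont; assumption.
  - revert HD; apply filter_imp; intros t' Ht a.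
    assert (hu := hol_cont _ _ _ _ _ _ _ Hh (Ht a)).
    assert (hv := hol_cont _ _ _ _ _ _ _ Hi (Ht a)).
    cont; apply cont_comp2; cont; assumption.
  - assert (E1 := Ex p s (fun a => proj1 (proj2 (proj2 (proj2 (proj2 (H0 a))))))
      (fun a => proj2 (proj2 (proj2 (proj2 (proj2 (H0 a))))))).
    assert (E2 := Ex s (fun x y => - p x y)
      (fun a => proj2 (proj2 (proj2 (proj2 (proj2 (H0 a))))))
      (fun a => cont_opp _ _ (proj1 (proj2 (proj2 (proj2 (proj2 (H0 a)))))))).
    rewrite RInt_sub, (RInt_mul _ X'), (RInt_mul _ Y'); [reflexivity | exact E2 | exact E1 | |].
    + exact (ex_RInt_scal _ _ _ X' E1).
    + exact (ex_RInt_scal _ _ _ Y' E2).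
Qed.

(* Cauchy's formula for the derivative, G'(z) = (2 pi r)^{-1} int G(z + r e^{ia}) e^{-ia} da,
   can be differentiated under the integral with r fixed. *)
Lemma hol_deriv R0 u v p s :
  hol (disc R0) u v p s ->
  hol (disc R0) p s (fun x y => Derive (fun t => p t y) x) (fun x y => Derive (fun t => s t y) x).
Proof.
  intros Hh; apply hol_of_local; [apply Hh|]. intros x0 y0 H0.
  assert (Hi := hol_mul_neg_i _ _ _ _ _ Hh).
  unfold disc in H0.
  (* A quarter of the distance to the boundary: for centres in [disc R1], all circles of radius
     below 2r stay in [disc R0], which leaves the circle of radius r the margin that Cauchy's
     formula requires. *)
  set (r := (R0 - Cmod (x0, y0)) / 4). assert (Hr : 0 < r) by (unfold r; lra).
  set (R1 := Cmod (x0, y0) + r). set (cst := 2 * PI * r).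
  assert (Hcst : cst <> 0).
  { generalize PI_RGT_0; intros; apply Rgt_not_eq; apply Rmult_lt_0_compat; lra. }
  assert (Hc : forall x y, disc R1 x y -> forall t a, Rabs t < 2 * r ->
    polar (disc R0) x y t a).
  { unfold disc, R1; intros x y Hxy t a Ht. apply disc_circle. unfold r in *; lra. }
  assert (Hra : Rabs r < 2 * r) by (rewrite Rabs_pos_eq; lra).
  assert (Hl : forall x y, disc R1 x y -> locally (x, y) (fun z : R * R => forall a,
    disc R0 (fst z + r * cos a) (snd z + r * sin a))).
  { intros x y Hxy; generalize (disc_open _ _ _ Hxy); apply filter_imp; intros z Hz a.
    apply Hc; assumption. }
  assert (Hcont : forall x y, disc R1 x y -> locally (x, y) (fun z : R * R => forall a,
    cont2 p (fst z + r * cos a) (snd z + r * sin a) /\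
    cont2 s (fst z + r * cos a) (snd z + r * sin a))).
  { intros x y Hxy; generalize (Hl x y Hxy); apply filter_imp; intros z Hz a.
    destruct (proj2 Hh _ _ (Hz a)) as (_ & _ & _ & _ & h5 & h6); split; assumption. }
  assert (Div : forall (f : R -> R) (x l l' : R), is_derive f x l -> l / cst = l' ->
    is_derive (fun t => f t / cst) x l').
  { intros f x l l' Hf <-; eapply is_derive_val; [apply der_mult; [exact Hf | apply der_const]|].
    cbv beta; unfold Rdiv; rring. }
  exists (disc R1), (fun x y => circ_coef u v x y (-1) r / cst),
    (fun x y => circ_coef v (fun x y => - u x y) x y (-1) r / cst),
    (fun x y => circ_coef p s x y (-1) r / cst),
    (fun x y => circ_coef s (fun x y => - p x y) x y (-1) r / cst).
  split; [split|split].
  - intros; now apply disc_open.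
  - intros x y Hxy. specialize (Hl x y Hxy); specialize (Hcont x y Hxy).
    assert (DX := fun u v p s Hh => circ_coef_der (disc R0) u v p s (fun t => t) (fun _ => y) 1 0
      x (-1) r Hh der_id (der_const y) (locally_pair_l _ _ _ Hl)).
    assert (DY := fun u v p s Hh => circ_coef_der (disc R0) u v p s (fun _ => x) (fun t => t) 0 1
      y (-1) r Hh (der_const x) der_id (locally_pair_r _ _ _ Hl)).
    cbv beta in DX, DY.
    conjs.
    + eapply Div; [exact (DX _ _ _ _ Hh) | field; exact Hcst].
    + eapply Div; [exact (DY _ _ _ _ Hh) | field; exact Hcst].
    + eapply Div; [exact (DX _ _ _ _ Hi) | field; exact Hcst].
    + eapply Div; [exact (DY _ _ _ _ Hi)|].
      f_equal.
      unfold circ_coef.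
      rewrite (RInt_ext (fun a => - polar p x y r a * cos (-1 * a) - _)
        (fun a => -1 * (polar p x y r a * cos (-1 * a) -
           polar s x y r a * sin (-1 * a)))) by (intros; rring).
      rewrite RInt_mul; [rring|].
      apply cont_all_RInt; intros a.
      destruct (proj2 Hh _ _ (Hc x y Hxy r a Hra)) as (_ & _ & _ & _ & h5 & h6).
      cont; apply cont_comp2; cont; assumption.
    + apply cont_mult; [|apply cont_const]. exact (circ_coef_cont p s x y (-1) r Hcont).
    + apply cont_mult; [|apply cont_const].
      apply (circ_coef_cont s (fun x y => - p x y) x y (-1) r).
      revert Hcont; apply filter_imp; intros z Hz a; split; [apply Hz | apply cont_opp, Hz].
  - unfold disc, R1; lra.
  - intros x y Hxy. split; apply (Rmult_eq_reg_r cst); trivial; unfold Rdiv;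
      rewrite (Rmult_assoc _ (/ cst)), Rinv_l, Rmult_1_r by exact Hcst; symmetry.
    + rewrite (circ_coef_neg1 (disc R0) u v p s x y (2 * r)); auto. unfold cst; ring.
    + rewrite (circ_coef_neg1 (disc R0) _ _ s (fun x y => - p x y) x y (2 * r)); auto.
      unfold cst; ring.
Qed.

(** * Jets and circle means of log |G| *)

(** [Derive_n] has default values where derivatives fail to exist and is therefore not additive;
    this predicate also asserts existence. *)
Definition is_d2 (f : R -> R) (m : R) : Prop :=
  exists f' : R -> R, locally 0 (fun t => is_derive f t (f' t)) /\ is_derive f' 0 m.

Lemma is_d2_Derive_n f m : is_d2 f m -> Derive_n f 2 0 = m.
Proof.
  intros [f' [H1 H2]]. simpl.
  rewrite (Derive_ext_loc _ f').
  - apply is_derive_unique, H2.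
  - revert H1; apply filter_imp; intros t Ht; apply is_derive_unique, Ht.
Qed.

Lemma is_d2_ext_loc f g m : locally 0 (fun t => f t = g t) -> is_d2 f m -> is_d2 g m.
Proof.
  intros He [f' [H1 H2]]; exists f'; split; [|exact H2].
  generalize (filter_and _ _ (locally_locally _ _ He) H1); apply filter_imp; intros t [A B].
  apply is_derive_ext_loc with f; assumption.
Qed.

Lemma is_d2_plus f g m n : is_d2 f m -> is_d2 g n -> is_d2 (fun t => f t + g t) (m + n).
Proof.
  intros [f' [H1 H2]] [g' [K1 K2]]; exists (fun t => f' t + g' t); split.
  - generalize (filter_and _ _ H1 K1); apply filter_imp; intros t [A B]; apply der_plus; assumption.
  - apply der_plus; assumption.
Qed.

Lemma is_d2_scal c f m : is_d2 f m -> is_d2 (fun t => c * f t) (c * m).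
Proof.
  assert (K : forall f x l, is_derive f x l -> is_derive (fun t => c * f t) x (c * l)).
  { intros h x l Hl; eapply is_derive_val; [apply der_mult; [apply der_const | exact Hl]|].
    cbv beta; rring. }
  intros [f' [H1 H2]]; exists (fun t => c * f' t); split; [|apply K, H2].
  revert H1; apply filter_imp; intros t; apply K.
Qed.

Lemma is_d2_const c : is_d2 (fun _ => c) 0.
Proof.
  exists (fun _ => 0); split; [|apply der_const].
  apply filter_forall; intros t; apply der_const.
Qed.

(* The mean of h over the circle of radius r, with the weight [sin^2] that the measure of
   the 3-sphere induces, for h harmonic with second derivatives m and -m at 0. *)
Definition jet_formula (h : R -> R -> R) (r m : R) : Prop :=
  is_d2 (fun t => h t 0) m /\ is_d2 (fun t => h 0 t) (- m) /\
  is_RInt (fun a => h (r * cos a) (r * sin a) * sin a ^ 2) (- PI) PI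
    (PI * (h 0 0 - r ^ 2 * m / 4)).

Lemma der_sq (f : R -> R) (x l : R) :
  is_derive f x l -> is_derive (fun t => f t ^ 2) x (2 * f x * l).
Proof. intros H; eapply is_derive_val; [apply (is_derive_pow f 2 x l H)|]. simpl; ring. Qed.

(** The function is G'/G, written as G' times the conjugate of G over |G|^2. Its derivative involves
    G'', which [hol_deriv] supplies. *)
Lemma hol_log_deriv R0 u v p s :
  hol (disc R0) u v p s -> (forall x y, disc R0 x y -> 0 < u x y ^ 2 + v x y ^ 2) ->
  exists p' s',
    hol (disc R0) (fun x y => (p x y * u x y + s x y * v x y) / (u x y ^ 2 + v x y ^ 2))
        (fun x y => (s x y * u x y - p x y * v x y) / (u x y ^ 2 + v x y ^ 2)) p' s'.
Proof.
  intros Hh Hpos.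
  pose proof (hol_deriv _ _ _ _ _ Hh) as H2.
  set (p2 := fun x y => Derive (fun t => p t y) x) in H2.
  set (s2 := fun x y => Derive (fun t => s t y) x) in H2.
  (* (G'/G)' = (G'' G - G'^2) / G^2 *)
  set (g1 := fun x y => p2 x y * u x y - s2 x y * v x y - (p x y ^ 2 - s x y ^ 2)).
  set (g2 := fun x y => p2 x y * v x y + s2 x y * u x y - 2 * p x y * s x y).
  (* Division by G^2 is multiplication by its conjugate over |G|^4. *)
  exists (fun x y => (g1 x y * (u x y ^ 2 - v x y ^ 2) + g2 x y * (2 * u x y * v x y))
    / (u x y ^ 2 + v x y ^ 2) ^ 2).
  exists (fun x y => (g2 x y * (u x y ^ 2 - v x y ^ 2) - g1 x y * (2 * u x y * v x y))
    / (u x y ^ 2 + v x y ^ 2) ^ 2).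
  split; [apply Hh|]. intros x y Hxy.
  assert (Hi := hol_mul_neg_i _ _ _ _ _ Hh).
  pose proof (hol_cont _ _ _ _ _ _ _ Hh Hxy) as cu.
  pose proof (hol_cont _ _ _ _ _ _ _ Hi Hxy) as cv.
  destruct (proj2 Hh x y Hxy) as (ux & uy & vx & vy & cp & cs).
  destruct (proj2 H2 x y Hxy) as (px & py & sx & sy & cp2 & cs2).
  fold (p2 x y) in px, py, sx, sy; fold (s2 x y) in px, py, sx, sy.
  specialize (Hpos x y Hxy).
  assert (HN : u x y ^ 2 + v x y ^ 2 <> 0) by lra.
  assert (HN2 : (u x y ^ 2 + v x y ^ 2) ^ 2 <> 0) by (apply pow_nonzero, HN).
  unfold g1, g2; conjs.
  5, 6: unfold cont2; cont; exact HN2.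
  1, 2: eapply is_derive_val; [apply der_div; [apply der_plus; apply der_mult; eassumption
      | apply der_plus; apply der_sq; eassumption | exact HN]|].
  3, 4: eapply is_derive_val; [apply der_div; [apply der_minus; apply der_mult; eassumption
      | apply der_plus; apply der_sq; eassumption | exact HN]|].
  all: cbv beta; in_R; field; exact HN.
Qed.

Ltac along_path C :=
  match goal with |- continuous (fun t => ?f (@?x t) (@?y t)) _ => apply (C f) end; auto.

(** With psi = G'/G = ps1 + i ps2, the gradient of h = log |G| is (ps1, -ps2), so derivatives of h
    along radii and circles are coefficients of psi. They give int h = 2 PI h(0) and int h cos 2a =
    PI r^2 m / 2 with m = Re psi'(0); the weight is sin^2 a = (1 - cos 2a) / 2. *)
Lemma hol_log_jet R0 u v p s :
  hol (disc R0) u v p s -> (forall x y, disc R0 x y -> 0 < u x y ^ 2 + v x y ^ 2) ->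
  exists m, forall r, 0 < r < R0 ->
    jet_formula (fun x y => ln (u x y ^ 2 + v x y ^ 2) / 2) r m.
Proof.
  intros Hh Hpos.
  set (h := fun x y => ln (u x y ^ 2 + v x y ^ 2) / 2).
  destruct (hol_log_deriv _ _ _ _ _ Hh Hpos) as (p' & s' & Hpsi).
  set (ps1 := fun x y => (p x y * u x y + s x y * v x y) / (u x y ^ 2 + v x y ^ 2)) in Hpsi.
  set (ps2 := fun x y => (s x y * u x y - p x y * v x y) / (u x y ^ 2 + v x y ^ 2)) in Hpsi.
  assert (Hpsi' := hol_mul_neg_i _ _ _ _ _ Hpsi).
  assert (Hlog : forall X Y t dX dY, 0 < X t ^ 2 + Y t ^ 2 -> is_derive X t dX -> is_derive Y t dY ->
     is_derive (fun t => ln (X t ^ 2 + Y t ^ 2) / 2) t ((X t * dX + Y t * dY) / (X t ^ 2 + Y t ^ 2))).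
  { intros X Y t dX dY Hp HX HY. eapply is_derive_val.
    - apply der_mult; [|apply der_const].
      apply (der_comp ln (fun t => X t ^ 2 + Y t ^ 2)); [apply is_derive_ln, Hp|].
      apply der_plus; apply der_sq; eassumption.
    - cbv beta; in_R; field; lra. }
  assert (hx : forall x y, disc R0 x y -> is_derive (fun t => h t y) x (ps1 x y)).
  { intros x y Hxy; destruct (proj2 Hh x y Hxy) as (ux & uy & vx & vy & cp & cs).
    eapply is_derive_val; [apply (Hlog (fun t => u t y) (fun t => v t y)); eauto|].
    unfold ps1; cbv beta; in_R; field; generalize (Hpos x y Hxy); lra. }
  assert (hy : forall x y, disc R0 x y -> is_derive (fun t => h x t) y (- ps2 x y)).
  { intros x y Hxy; destruct (proj2 Hh x y Hxy) as (ux & uy & vx & vy & cp & cs).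
    eapply is_derive_val; [apply (Hlog (fun t => u x t) (fun t => v x t)); eauto|].
    unfold ps2; cbv beta; in_R; field; generalize (Hpos x y Hxy); lra. }
  exists (p' 0 0); intros r Hr.
  assert (H00 : disc R0 0 0).
  { unfold disc; rewrite (Cmod_0 : Cmod (0, 0) = 0); lra. }
  assert (Hcirc : forall r a, Rabs r < R0 -> polar (disc R0) 0 0 r a).
  { intros; apply disc_circle; rewrite (Cmod_0 : Cmod (0, 0) = 0); lra. }
  assert (cps1 : forall x y, disc R0 x y -> cont2 ps1 x y).
  { intros x y Hxy; apply (hol_cont _ _ _ _ _ _ _ Hpsi Hxy). }
  assert (cps2 : forall x y, disc R0 x y -> cont2 ps2 x y).
  { intros x y Hxy; apply (hol_cont _ _ _ _ _ _ _ Hpsi' Hxy). }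
  assert (lhx : forall x y, disc R0 x y -> locally (x, y) (fun z : R * R =>
     is_derive (fun t => h t (snd z)) (fst z) (ps1 (fst z) (snd z)))).
  { intros x y Hxy; generalize (disc_open _ _ _ Hxy); apply filter_imp; intros z; apply hx. }
  assert (ch : forall x y, disc R0 x y -> cont2 h x y).
  { intros x y Hxy; apply cont2_partials with ps1 (fun x y => - ps2 x y); auto. }
  assert (der_r : forall r a, Rabs r < R0 ->
     is_derive (fun r => polar h 0 0 r a) r
       (polar ps1 0 0 r a * cos (1 * a)
        - polar ps2 0 0 r a * sin (1 * a))).
  { intros t a Ht.
    eapply is_derive_val; [apply (chain2 h ps1 (fun x y => - ps2 x y)
      (fun r => 0 + r * cos a) (fun r => 0 + r * sin a) t (cos a) (sin a)); auto|].
    - auto_derive; trivial; ring.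
    - auto_derive; trivial; ring.
    - cbv beta; rewrite Rmult_1_l; ring. }
  assert (der_a : forall r a, Rabs r < R0 ->
     is_derive (fun a => polar h 0 0 r a) a
       (- r * (polar ps1 0 0 r a * sin a
        + polar ps2 0 0 r a * cos a))).
  { intros t a Ht.
    eapply is_derive_val; [apply (chain2 h ps1 (fun x y => - ps2 x y)
      (fun a => 0 + t * cos a) (fun a => 0 + t * sin a) a (- t * sin a) (t * cos a)); auto|].
    - auto_derive; trivial; ring.
    - auto_derive; trivial; ring.
    - cbv beta; ring. }
  assert (Cc : forall f, (forall x y, disc R0 x y -> cont2 f x y) -> forall r a, Rabs r < R0 ->
     continuous (fun a => polar f 0 0 r a) a).
  { intros f Hf t a Ht. apply (cont_polar f 0 0 (fun _ => t) (fun a => a) a); cont.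
    apply Hf, Hcirc, Ht. }
  assert (Cc2 : forall f, (forall x y, disc R0 x y -> cont2 f x y) -> forall r a, Rabs r < R0 ->
     cont2 (fun r a => polar f 0 0 r a) r a).
  { intros f Hf t a Ht. apply (cont_polar f 0 0 fst snd (t, a)); cont.
    apply Hf, Hcirc, Ht. }
  assert (Hr' : Rabs r < R0) by (rewrite Rabs_pos_eq; lra).
  (* The derivative of the mean in r is the order-1 coefficient of psi, which is zero, so the mean
     may be evaluated at r = 0. *)
  assert (M0 : RInt (fun a => polar h 0 0 r a) (- PI) PI = 2 * PI * h 0 0).
  { transitivity (RInt (fun a => polar h 0 0 0 a) (- PI) PI).
    - apply (cst_of_zero_der (fun r => RInt (fun a => polar h 0 0 r a) (- PI) PI)).
      intros t Ht; rewrite Rmin_right, Rmax_left in Ht by lra.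
      assert (Ht' : Rabs t < R0) by (rewrite Rabs_pos_eq; lra).
      eapply is_derive_val.
      + apply (der_param (fun r a => polar h 0 0 r a)
          (fun r a => polar ps1 0 0 r a * cos (1 * a)
                    - polar ps2 0 0 r a * sin (1 * a))).
        * generalize (locally_abs_lt _ _ Ht'); apply filter_imp; intros; apply der_r; auto.
        * intros a; unfold cont2; cont; [apply (Cc2 ps1) | apply (Cc2 ps2)]; auto.
        * generalize (locally_abs_lt _ _ Ht'); apply filter_imp; intros t' Ht1 a.
          apply (Cc h); auto.
      + exact (circ_coef_pos _ _ _ _ _ 0 0 R0 0 t Hpsi Hcirc Ht').
    - rewrite (RInt_ext _ (fun _ => h 0 0)); [rewrite RInt_cst; rring|].
      intros a _; rewrite !Rmult_0_l, !Rplus_0_l; reflexivity. }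
  pose proof (circ_coef_neg1 _ _ _ _ _ 0 0 R0 r Hpsi Hcirc Hr') as C1.
  pose proof (circ_coef_pos _ _ _ _ _ 0 0 R0 2 r Hpsi Hcirc Hr') as C3.
  assert (M2 : RInt (fun a => polar h 0 0 r a * cos (2 * a)) (- PI) PI
     = PI * r ^ 2 * p' 0 0 / 2).
  { assert (I : RInt (fun a => 2 * (polar h 0 0 r a * cos (2 * a))
        + (- r / 2) *
          ((polar ps1 0 0 r a * cos (-1 * a)
            - polar ps2 0 0 r a * sin (-1 * a))
          - (polar ps1 0 0 r a * cos (INR 3 * a)
            - polar ps2 0 0 r a * sin (INR 3 * a)))) (- PI) PI = 0).
    (* Integration by parts with antiderivative h sin 2a: the product of sin 2a with e^{ia} splits
       into the orders -1 and 3, of which only the order -1 survives. *)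
    { rewrite RInt_deriv with (f := fun a => polar h 0 0 r a * sin (2 * a)).
      - replace (2 * - PI) with (- (2 * PI)) by ring. rewrite !sin_neg, sin_2PI. rring.
      - intros a; eapply is_derive_val.
        + apply der_mult; [apply der_a, Hr'|].
          apply (der_comp sin (fun a => 2 * a) a (cos (2 * a)) 2); [apply is_derive_sin|].
          auto_derive; trivial; ring.
        + replace (INR 3 * a) with (2 * a + a) by (simpl; ring).
          replace (-1 * a) with (- a) by ring.
          rewrite cos_plus, sin_plus, cos_neg, sin_neg, sin_2a, cos_2a.
          generalize (sin2_cos2 a); unfold Rsqr; intros E.
          set (c := cos a) in *; set (d := sin a) in *.
          set (P1 := ps1 _ _); set (P2 := ps2 _ _); set (H := h _ _).
          (* The order -1 term has degree one in cos a and sin a, the other terms in psi degree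
             three; the factor sin^2 + cos^2 evens this out. *)
          replace (P1 * c - P2 * - d) with ((P1 * c + P2 * d) * (d * d + c * c))
            by (rewrite E; ring).
          in_R; apply Rminus_diag_uniq; field.
      - intros a; cont; first [lra | along_path Cc]. }
    rewrite RInt_add, !RInt_mul, RInt_sub in I;
      try (apply cont_all_RInt; intros a; cont; first [lra | along_path Cc]; fail).
    unfold circ_coef in C1, C3. rewrite C1, C3 in I.
    in_R. set (X := RInt _ _ _) in *. lra. }
  split; [|split].
  - exists (fun t => ps1 t 0); split.
    + generalize (locally_pair_l _ _ _ (disc_open _ _ _ H00)); apply filter_imp.
      intros t Ht; apply hx, Ht.
    + apply (proj2 Hpsi 0 0 H00).
  - exists (fun t => - ps2 0 t); split.
    + generalize (locally_pair_r _ _ _ (disc_open _ _ _ H00)); apply filter_imp.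
      intros t Ht; apply hy, Ht.
    + apply der_opp, (proj2 Hpsi 0 0 H00).
  - assert (E : forall a, h (r * cos a) (r * sin a) * sin a ^ 2 =
      (1 / 2) * polar h 0 0 r a
      - (1 / 2) * (polar h 0 0 r a * cos (2 * a))).
    { intros a; rewrite !Rplus_0_l, cos_2a_sin. field. }
    apply (is_RInt_ext _ _ _ _ _ (fun a _ => eq_sym (E a))).
    assert (EX : PI * (h 0 0 - r ^ 2 * p' 0 0 / 4) =
      RInt (fun a => (1 / 2) * polar h 0 0 r a
      - (1 / 2) * (polar h 0 0 r a * cos (2 * a))) (- PI) PI).
    { rewrite RInt_sub, !RInt_mul;
        try (apply cont_all_RInt; intros a; cont; first [lra | along_path Cc]; fail).
      rewrite M0, M2. in_R; field. }
    rewrite EX. apply RInt_spec, cont_all_RInt.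
    intros a; cont; first [lra | along_path Cc].
Qed.

(** * Rotation invariance *)

Lemma polar_coords (A B : R) :
  exists t, A = sqrt (A ^ 2 + B ^ 2) * cos t /\ B = sqrt (A ^ 2 + B ^ 2) * sin t.
Proof.
  set (T := sqrt (A ^ 2 + B ^ 2)).
  assert (HT : T * T = A ^ 2 + B ^ 2) by (apply sqrt_sqrt; nra).
  assert (HT0 : 0 <= T) by apply sqrt_pos.
  destruct (Req_dec T 0) as [E|E].
  - exists 0; rewrite E; rewrite E in HT. split; nra.
  - assert (HTp : 0 < T) by lra.
    assert (Hq : (A / T) * (A / T) + (B / T) * (B / T) = 1).
    { replace ((A / T) * (A / T) + (B / T) * (B / T)) with ((A ^ 2 + B ^ 2) / (T * T))
        by (field; exact E). rewrite <- HT; field; exact E. }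
    assert (Hb : -1 <= A / T <= 1) by nra.
    assert (Hs : sqrt (1 - Rsqr (A / T)) = Rabs (B / T)).
    { rewrite <- sqrt_Rsqr_abs; f_equal; unfold Rsqr; lra. }
    destruct (Rle_dec 0 B) as [HB|HB].
    + exists (acos (A / T)). rewrite cos_acos, sin_acos, Hs by exact Hb.
      rewrite Rabs_pos_eq by (apply Rdiv_le_0_compat; lra). split; field; exact E.
    + exists (- acos (A / T)). rewrite cos_neg, sin_neg, cos_acos, sin_acos, Hs by exact Hb.
      rewrite Rabs_left by (apply Rmult_neg_pos; [lra | apply Rinv_0_lt_compat, HTp]).
      split; field; exact E.
Qed.

(** The integral of a function of the linear form A x_0 + B x_1 over a unit sphere, the remaining
    angles being integrated out up to a constant: the weights sin^{m+1} a sin^m b belong to the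
    sphere of dimension m + 2, so m = 0 and m = 1 are needed. *)
Definition zonal_inner (phi : R -> R) (m : nat) (A B a : R) : R :=
  RInt (fun b => sin b ^ m * phi (A * cos a + B * sin a * cos b)) 0 PI.
Definition zonal (phi : R -> R) (m : nat) (A B : R) : R :=
  RInt (fun a => sin a ^ S m * zonal_inner phi m A B a) 0 PI.

(** The expression is affine in cos b, with extreme values T cos (t - a) and T cos (t + a). *)
Lemma zonal_bound T t a b :
  0 <= T -> Rabs (T * cos t * cos a + T * sin t * sin a * cos b) <= T.
Proof.
  intros HT.
  assert (H : Rabs (cos t * cos a + sin t * sin a * cos b) <= 1).
  { generalize (COS_bound (t - a)) (COS_bound (t + a)) (COS_bound b).
    rewrite cos_minus, cos_plus; intros H1 H2 H3.
    apply Rabs_le; split; nra. }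
  replace (T * cos t * cos a + T * sin t * sin a * cos b)
    with (T * (cos t * cos a + sin t * sin a * cos b)) by ring.
  rewrite Rabs_mult, (Rabs_pos_eq T) by exact HT.
  rewrite <- (Rmult_1_r T) at 2; apply Rmult_le_compat_l; assumption.
Qed.

Lemma zonal_bound' A B a b :
  Rabs (A * cos a + B * sin a * cos b) <= sqrt (A ^ 2 + B ^ 2).
Proof.
  destruct (polar_coords A B) as [t [HA HB]].
  set (T := sqrt (A ^ 2 + B ^ 2)) in *.
  rewrite HA, HB. apply zonal_bound, sqrt_pos.
Qed.

(** Only |u| <= T, a bound for the linear form on the sphere, is considered: the logarithmic kernel
    to be integrated is singular further out. *)
Definition smooth_on (T : R) (phi phi' : R -> R) : Prop :=
  forall u, Rabs u <= T -> is_derive phi u (phi' u) /\ continuous phi' u.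

Lemma smooth_cont T phi phi' u : smooth_on T phi phi' -> Rabs u <= T -> continuous phi u.
Proof. intros H Hu; eapply der_cont; apply (H u Hu). Qed.

Lemma zonal_inner_cont phi phi' m A B a :
  smooth_on (sqrt (A ^ 2 + B ^ 2)) phi phi' -> continuous (zonal_inner phi m A B) a.
Proof.
  intros H.
  apply (cont_param_all (fun a b => sin b ^ m * phi (A * cos a + B * sin a * cos b)));
    [generalize PI_RGT_0; lra|].
  intros x b; cont. apply cont_comp; [cont|].
  eapply smooth_cont; [exact H | apply zonal_bound'].
Qed.

Lemma der_sin_pow m a : is_derive (fun a => sin a ^ S m) a (INR (S m) * cos a * sin a ^ m).
Proof. apply (is_derive_pow sin (S m) a (cos a)), is_derive_sin. Qed.

(* The rotation field is divergence free: with u = A cos a + B sin a cos b,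
   [sin^{m+1} a sin^m b phi'(u) (A sin a cos b - B cos a)] is
   [d/da (- sin^{m+1} a sin^m b cos b phi(u)) + d/db (cos a sin^m a sin^{m+1} b phi(u))]. *)
Lemma zonal_rotate phi phi' m A B :
  smooth_on (sqrt (A ^ 2 + B ^ 2)) phi phi' ->
  zonal phi m A B = zonal phi m (sqrt (A ^ 2 + B ^ 2)) 0.
Proof.
  destruct (polar_coords A B) as [t0 [HA HB]].
  set (T := sqrt (A ^ 2 + B ^ 2)) in *. intros Hphi.
  assert (HT : 0 <= T) by apply sqrt_pos.
  (* The path (T cos t, T sin t) joins (T, 0) at t = 0 to (A, B) at [t0]; the integral will be
     constant along it. *)
  set (U := fun t a b => T * cos t * cos a + T * sin t * sin a * cos b).
  assert (HU : forall t a b, Rabs (U t a b) <= T) by (intros; apply zonal_bound, HT).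
  assert (Hc : forall (X : UniformSpace) (x : X) (t a b : X -> R),
    continuous t x -> continuous a x -> continuous b x ->
    continuous (fun x => phi (U (t x) (a x) (b x))) x).
  { intros X x t a b h1 h2 h3. apply cont_comp; [unfold U; cont|].
    eapply smooth_cont; [exact Hphi | apply HU]. }
  assert (Hc' : forall (X : UniformSpace) (x : X) (t a b : X -> R),
    continuous t x -> continuous a x -> continuous b x ->
    continuous (fun x => phi' (U (t x) (a x) (b x))) x).
  { intros X x t a b h1 h2 h3. apply cont_comp; [unfold U; cont|].
    apply (Hphi _ (HU _ _ _)). }
  assert (Dt : forall t a b, is_derive (fun t => phi (U t a b)) t
    ((- (T * sin t) * cos a + T * cos t * sin a * cos b) * phi' (U t a b))).
  { intros t a b. apply (der_comp phi (fun t => U t a b)); [apply (Hphi _ (HU _ _ _))|].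
    unfold U; auto_derive; trivial; ring. }
  assert (Da : forall t a b, is_derive (fun a => phi (U t a b)) a
    ((- (T * cos t) * sin a + T * sin t * cos a * cos b) * phi' (U t a b))).
  { intros t a b. apply (der_comp phi (fun a => U t a b)); [apply (Hphi _ (HU _ _ _))|].
    unfold U; auto_derive; trivial; ring. }
  assert (Db : forall t a b, is_derive (fun b => phi (U t a b)) b
    ((- (T * sin t) * sin a * sin b) * phi' (U t a b))).
  { intros t a b. apply (der_comp phi (fun b => U t a b)); [apply (Hphi _ (HU _ _ _))|].
    unfold U; auto_derive; trivial; ring. }
  set (W := fun t a b =>
    (- (T * sin t) * cos a + T * cos t * sin a * cos b) * phi' (U t a b)).
  assert (HW : forall (X : UniformSpace) (x : X) (t a b : X -> R),
    continuous t x -> continuous a x -> continuous b x ->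
    continuous (fun x => W (t x) (a x) (b x)) x).
  { intros X x t a b h1 h2 h3. unfold W; cont. apply Hc'; assumption. }
  set (E := fun t a => RInt (fun b => sin b ^ m * phi (U t a b)) 0 PI).
  set (E' := fun t a => RInt (fun b => sin b ^ m * W t a b) 0 PI).
  assert (DE : forall t a, is_derive (fun t => E t a) t (E' t a)).
  { intros t a. apply (der_param_all (fun t b => sin b ^ m * phi (U t a b))
      (fun t b => sin b ^ m * W t a b)).
    - intros s b. eapply is_derive_val.
      + apply der_mult; [apply der_const | apply Dt].
      + cbv beta; unfold W; rring.
    - intros s b; unfold cont2; cont. apply (HW _ _ fst (fun _ => a) snd); cont.
    - intros s b; cont. apply (Hc _ _ (fun _ => s) (fun _ => a) (fun b => b)); cont. }
  assert (CE' : forall t a, cont2 E' t a).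
  { intros t a. apply (cont_param_all (fun (z : R * R) b => sin b ^ m * W (fst z) (snd z) b));
      [generalize PI_RGT_0; lra|].
    intros [s x] b. cont. apply (HW _ _ (fun z => fst (fst z)) (fun z => snd (fst z)) snd); cont.
    - apply continuous_comp; apply continuous_fst.
    - apply continuous_comp; [apply continuous_fst | apply continuous_snd]. }
  assert (CE : forall t a, continuous (E t) a).
  { intros t a. apply (cont_param_all (fun a b => sin b ^ m * phi (U t a b)));
      [generalize PI_RGT_0; lra|].
    intros x b. cont. apply (Hc _ _ (fun _ => t) fst snd); cont. }
  assert (Z : forall t, RInt (fun a => sin a ^ S m * E' t a) 0 PI = 0).
  { intros t.
    set (F := fun a b => - (sin a ^ S m * (sin b ^ m * cos b)) * phi (U t a b)).
    set (F' := fun a b => - (INR (S m) * cos a * sin a ^ m * (sin b ^ m * cos b)) * phi (U t a b)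
      - sin a ^ S m * (sin b ^ m * cos b) *
        ((- (T * cos t) * sin a + T * sin t * cos a * cos b) * phi' (U t a b))).
    set (Psi := fun a => RInt (F a) 0 PI).
    set (Psi' := fun a => RInt (F' a) 0 PI).
    assert (CF' : forall a b, cont2 F' a b).
    { intros a b; unfold F', cont2; cont.
      - apply (Hc _ _ (fun _ => t) fst snd); cont.
      - apply (Hc' _ _ (fun _ => t) fst snd); cont. }
    assert (CF'1 : forall a b, continuous (F' a) b).
    { intros a b; unfold F'; cont.
      - apply (Hc _ _ (fun _ => t) (fun _ => a) (fun b => b)); cont.
      - apply (Hc' _ _ (fun _ => t) (fun _ => a) (fun b => b)); cont. }
    assert (CF : forall a b, continuous (F a) b).
    { intros a b; unfold F; cont.
      apply (Hc _ _ (fun _ => t) (fun _ => a) (fun b => b)); cont. }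
    assert (DF : forall a b, is_derive (fun a => F a b) a (F' a b)).
    { intros a b; unfold F, F'. eapply is_derive_val.
      - apply der_mult; [apply der_opp, der_mult; [apply der_sin_pow | apply der_const] | apply Da].
      - cbv beta; rring. }
    assert (DPsi : forall a, is_derive Psi a (Psi' a)).
    { intros a; now apply (der_param_all F F'). }
    assert (CPsi' : forall a, continuous Psi' a).
    { intros a; apply cont_param_all; [generalize PI_RGT_0; lra | apply CF']. }
    assert (EPsi : forall a, sin a ^ S m * E' t a = Psi' a).
    { intros a. unfold E', Psi'.
      (* G is the b-component of the field. It vanishes at b = 0 and b = PI because of sin^{m+1} b,
         so G' integrates to zero and may be added to leave a pure derivative in a. *)
      set (G := fun b => cos a * sin a ^ m * sin b ^ S m * phi (U t a b)).
      set (G' := fun b => cos a * sin a ^ m * (INR (S m) * cos b * sin b ^ m) * phi (U t a b)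
        + cos a * sin a ^ m * sin b ^ S m *
          ((- (T * sin t) * sin a * sin b) * phi' (U t a b))).
      assert (CG' : forall b, continuous G' b).
      { intros b; unfold G'; cont.
        - apply (Hc _ _ (fun _ => t) (fun _ => a) (fun b => b)); cont.
        - apply (Hc' _ _ (fun _ => t) (fun _ => a) (fun b => b)); cont. }
      assert (IG : RInt G' 0 PI = 0).
      { rewrite (RInt_deriv G G').
        - unfold G; rewrite sin_PI, sin_0; simpl; ring.
        - intros b; unfold G, G'; eapply is_derive_val.
          + apply der_mult; [apply der_mult; [apply der_const | apply der_sin_pow] | apply Db].
          + cbv beta; rring.
        - apply CG'. }
      rewrite <- RInt_mul.
      - transitivity (RInt (F' a) 0 PI + RInt G' 0 PI); [|rewrite IG; rring].
        rewrite <- RInt_add; [|apply cont_all_RInt, CF'1 | apply cont_all_RInt, CG'].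
        apply RInt_ext; intros b _. unfold F', G', W.
        generalize (sin2_cos2 b); unfold Rsqr; intros Eb.
        generalize (sin2_cos2 a); unfold Rsqr; intros Ea.
        simpl (_ ^ S m).
        assert (Eb' : sin b * sin b = 1 - cos b * cos b) by lra.
        assert (Ea' : sin a * sin a = 1 - cos a * cos a) by lra.
        in_R.
        generalize (phi (U t a b)) (phi' (U t a b)) (sin a ^ m) (sin b ^ m); intros f f' sa sb.
        apply Rminus_diag_uniq.
        match goal with |- ?L = 0 => replace L with
          (f' * sa * sb * T * sin a * sin t * cos a *
             ((cos b * cos b + sin b * sin b) - 1)) by ring end.
        rewrite Eb'; ring.
      - apply cont_all_RInt; intros b; cont.
        apply (HW _ _ (fun _ => t) (fun _ => a) (fun b => b)); cont. }
    rewrite (RInt_ext _ Psi') by (intros; apply EPsi).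
    rewrite (RInt_deriv Psi Psi') by assumption.
    (* The exponent m + 1 makes the boundary terms in a vanish even for m = 0. *)
    assert (P0 : forall a, sin a = 0 -> Psi a = 0).
    { intros a Ha. unfold Psi. rewrite (RInt_ext _ (fun _ => 0)).
      - rewrite RInt_cst; rring.
      - intros b _; unfold F; rewrite Ha; simpl; rring. }
    rewrite !P0 by (apply sin_0 || apply sin_PI). rring. }
  assert (J : RInt (fun a => sin a ^ S m * E t0 a) 0 PI
            = RInt (fun a => sin a ^ S m * E 0 a) 0 PI).
  { apply (cst_of_zero_der (fun t => RInt (fun a => sin a ^ S m * E t a) 0 PI)).
    intros t _. eapply is_derive_val; [|apply (Z t)].
    apply (der_param_all (fun t a => sin a ^ S m * E t a) (fun t a => sin a ^ S m * E' t a)).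
    - intros s a. eapply is_derive_val.
      + apply der_mult; [apply der_const | apply DE].
      + cbv beta; rring.
    - intros s a; unfold cont2; cont. apply CE'.
    - intros s a; cont. apply CE. }
  unfold zonal, zonal_inner.
  transitivity (RInt (fun a => sin a ^ S m * E t0 a) 0 PI); [|rewrite J];
    apply RInt_ext; intros a _; f_equal; apply RInt_ext; intros b _; f_equal; f_equal;
    unfold U.
  - rewrite <- HA, <- HB; ring.
  - rewrite cos_0, sin_0; ring.
Qed.

(** B cos c + D sin c = T cos (c - t0). Over a full period the integral does not depend on the
    shift, and the reflection of c into 2 PI - c folds the circle onto [0, PI]. *)
Lemma circle_rotate (F F' : R -> R) B D :
  smooth_on (sqrt (B ^ 2 + D ^ 2)) F F' ->
  RInt (fun c => F (B * cos c + D * sin c)) 0 (2 * PI)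
    = 2 * RInt (fun c => F (sqrt (B ^ 2 + D ^ 2) * cos c)) 0 PI.
Proof.
  destruct (polar_coords B D) as [t0 [HB HD]].
  set (T := sqrt (B ^ 2 + D ^ 2)) in *. intros HF.
  assert (HT : 0 <= T) by apply sqrt_pos.
  assert (HU : forall x, Rabs (T * cos x) <= T).
  { intros x; rewrite Rabs_mult, (Rabs_pos_eq T) by exact HT.
    rewrite <- (Rmult_1_r T) at 2; apply Rmult_le_compat_l; [exact HT|].
    apply Rabs_le, COS_bound. }
  assert (Hc : forall (X : UniformSpace) (x : X) (a : X -> R),
    continuous a x -> continuous (fun x => F (T * cos (a x))) x).
  { intros X x a h. apply cont_comp; [cont|]. eapply smooth_cont; [exact HF | apply HU]. }
  assert (Hc' : forall (X : UniformSpace) (x : X) (a : X -> R),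
    continuous a x -> continuous (fun x => F' (T * cos (a x))) x).
  { intros X x a h. apply cont_comp; [cont|]. apply (HF _ (HU _)). }
  assert (J : RInt (fun c => F (T * cos (c - t0))) 0 (2 * PI)
            = RInt (fun c => F (T * cos (c - 0))) 0 (2 * PI)).
  { apply (cst_of_zero_der (fun t => RInt (fun c => F (T * cos (c - t))) 0 (2 * PI))).
    intros t _.
    set (W := fun t c => T * sin (c - t) * F' (T * cos (c - t))).
    eapply is_derive_val.
    - apply (der_param_all (fun t c => F (T * cos (c - t))) W).
      + intros s c. apply (der_comp F (fun t => T * cos (c - t))).
        * apply (HF _ (HU _)).
        * auto_derive; trivial; unfold Rminus; ring.
      + intros s c; unfold cont2, W; cont. apply Hc'; cont.
      + intros s c; apply Hc; cont.
    - rewrite (RInt_deriv (fun c => - F (T * cos (c - t)))).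
      + replace (2 * PI - t) with (- t + 2 * INR 1 * PI) by (simpl; ring).
        rewrite cos_period, Rminus_0_l. ring.
      + intros c. eapply is_derive_val.
        * apply der_opp, (der_comp F (fun c => T * cos (c - t)));
            [apply (HF _ (HU _)) | auto_derive; [trivial | reflexivity]].
        * unfold W; cbv beta; change (c + - t) with (c - t); rring.
      + intros c; unfold W; cont; apply Hc'; cont. }
  transitivity (RInt (fun c => F (T * cos (c - t0))) 0 (2 * PI)).
  { apply RInt_ext; intros c _; f_equal. rewrite cos_minus.
    rewrite HB at 1; rewrite HD at 1. ring. }
  rewrite J.
  rewrite (RInt_ext _ (fun c => F (T * cos c))) by (intros; do 3 f_equal; ring).
  assert (Hex : forall a b, ex_RInt (fun c => F (T * cos c)) a b).
  { intros; apply cont_all_RInt; intros; apply Hc; cont. }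
  rewrite <- (RInt_Chasles (V := R_CompleteNormedModule) _ 0 PI (2 * PI)) by apply Hex.
  assert (S : RInt (fun c => F (T * cos c)) PI (2 * PI) = RInt (fun c => F (T * cos c)) 0 PI).
  { pose proof (RInt_comp_lin (V := R_CompleteNormedModule) (fun c => F (T * cos c))
      (-1) (2 * PI) 0 PI (Hex _ _)) as K.
    replace (-1 * 0 + 2 * PI) with (2 * PI) in K by ring.
    replace (-1 * PI + 2 * PI) with PI in K by ring.
    rewrite <- (opp_RInt_swap (V := R_CompleteNormedModule)), <- K by apply Hex.
    rewrite (RInt_ext _ (fun c => -1 * F (T * cos c))).
    - rewrite RInt_mul by apply Hex. change opp with Ropp. rring.
    - intros c _. change scal with Rmult. do 3 f_equal.
      replace (-1 * c + 2 * PI) with (- c + 2 * INR 1 * PI) by (simpl; ring).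
      now rewrite cos_period, cos_neg. }
  rewrite S. change plus with Rplus. rring.
Qed.

(** * Integration over the 3-sphere *)

(** The Gram determinant is the square of the right-hand side; sin b > 0 selects the root. *)
Lemma sphere_density_eq rho a b c :
  0 < rho -> 0 < b < PI -> sphere_density rho a b c = rho ^ 3 * sin a ^ 2 * sin b.
Proof.
  intros Hr Hb.
  assert (Hs : 0 < sin b) by (apply sin_gt_0; lra).
  unfold sphere_density.
  assert (Ea : qDerive (fun s => sphere_param rho s b c) a =
    (- rho * sin a, rho * (cos a * cos b), rho * (cos a * (sin b * cos c)),
     rho * (cos a * (sin b * sin c)))).
  { unfold qDerive, sphere_param, q0, q1, q2, q3; simpl.
    repeat apply f_equal2; apply is_derive_unique; auto_derive; trivial; ring. }
  assert (Eb : qDerive (fun s => sphere_param rho a s c) b =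
    (0, - rho * (sin a * sin b), rho * (sin a * (cos b * cos c)),
     rho * (sin a * (cos b * sin c)))).
  { unfold qDerive, sphere_param, q0, q1, q2, q3; simpl.
    repeat apply f_equal2; apply is_derive_unique; auto_derive; trivial; ring. }
  assert (Ec : qDerive (fun s => sphere_param rho a b s) c =
    (0, 0, - rho * (sin a * (sin b * sin c)), rho * (sin a * (sin b * cos c)))).
  { unfold qDerive, sphere_param, q0, q1, q2, q3; simpl.
    repeat apply f_equal2; apply is_derive_unique; auto_derive; trivial; ring. }
  rewrite Ea, Eb, Ec.
  replace (gram_det _ _ _) with (Rsqr (rho ^ 3 * sin a ^ 2 * sin b)).
  - apply sqrt_Rsqr. apply Rmult_le_pos; [|lra].
    apply Rmult_le_pos; [apply pow_le; lra | apply pow2_ge_0].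
  - unfold gram_det, qdot, Rsqr, q0, q1, q2, q3; simpl.
    assert (Sa : sin a * sin a = 1 - cos a * cos a) by (generalize (sin2_cos2 a); unfold Rsqr; lra).
    assert (Sb : cos b * cos b = 1 - sin b * sin b) by (generalize (sin2_cos2 b); unfold Rsqr; lra).
    assert (Sc : sin c * sin c = 1 - cos c * cos c) by (generalize (sin2_cos2 c); unfold Rsqr; lra).
    ring [Sa Sb Sc].
Qed.

(** [RInt] has a default value, so linearity requires that all three iterated integrals exist. Inner
    integrals are asked for at interior angles only: endpoints do not affect the outer ones, and sin
    b > 0 there. *)
Definition is_sint (rho : R) (g : quat -> R) (v : R) : Prop :=
  exists (G1 : R -> R -> R) (G2 : R -> R),
    (forall a b, 0 < a < PI -> 0 < b < PI ->
       is_RInt (fun c => g (sphere_param rho a b c) * sphere_density rho a b c)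
         0 (2 * PI) (G1 a b)) /\
    (forall a, 0 < a < PI -> is_RInt (G1 a) 0 PI (G2 a)) /\
    is_RInt G2 0 PI v.

Lemma is_sint_unique rho g v : is_sint rho g v -> sphere_integral rho g = v.
Proof.
  intros (G1 & G2 & H1 & H2 & H3). unfold sphere_integral.
  generalize PI_RGT_0; intros Hpi.
  rewrite <- (is_RInt_unique _ _ _ _ H3).
  apply RInt_ext; intros a Ha; rewrite Rmin_left, Rmax_right in Ha by lra.
  rewrite <- (is_RInt_unique _ _ _ _ (H2 a Ha)).
  apply RInt_ext; intros b Hb; rewrite Rmin_left, Rmax_right in Hb by lra.
  apply (is_RInt_unique _ _ _ _ (H1 a b Ha Hb)).
Qed.

Lemma is_sint_plus rho f g u v :
  is_sint rho f u -> is_sint rho g v -> is_sint rho (fun x => f x + g x) (u + v).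
Proof.
  intros (F1 & F2 & A1 & A2 & A3) (G1 & G2 & B1 & B2 & B3).
  exists (fun a b => F1 a b + G1 a b), (fun a => F2 a + G2 a); split; [|split].
  - intros a b Ha Hb.
    eapply is_RInt_ext; [|apply (is_RInt_plus _ _ _ _ _ _ (A1 a b Ha Hb) (B1 a b Ha Hb))].
    intros c _; change plus with Rplus; rring.
  - intros a Ha; apply (is_RInt_plus _ _ _ _ _ _ (A2 a Ha) (B2 a Ha)).
  - apply (is_RInt_plus _ _ _ _ _ _ A3 B3).
Qed.

Lemma is_sint_scal rho f k u : is_sint rho f u -> is_sint rho (fun x => k * f x) (k * u).
Proof.
  intros (F1 & F2 & A1 & A2 & A3).
  exists (fun a b => k * F1 a b), (fun a => k * F2 a); split; [|split].
  - intros a b Ha Hb.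
    eapply is_RInt_ext; [|apply (is_RInt_scal _ _ _ k _ (A1 a b Ha Hb))].
    intros c _; change scal with Rmult; rring.
  - intros a Ha; apply (is_RInt_scal _ _ _ k _ (A2 a Ha)).
  - apply (is_RInt_scal _ _ _ k _ A3).
Qed.

Lemma is_sint_ext rho f g u :
  (forall a b c, 0 < a < PI -> 0 < b < PI ->
     f (sphere_param rho a b c) = g (sphere_param rho a b c)) ->
  is_sint rho f u -> is_sint rho g u.
Proof.
  intros E (F1 & F2 & A1 & A2 & A3). exists F1, F2; split; [|split]; try assumption.
  intros a b Ha Hb. eapply is_RInt_ext; [|apply (A1 a b Ha Hb)].
  intros c _; cbv beta; now rewrite E.
Qed.

Lemma is_RInt_mul (f : R -> R) k a b l :
  is_RInt f a b l -> is_RInt (fun x => k * f x) a b (k * l).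
Proof. intros H; apply (is_RInt_scal f a b k l H). Qed.

Lemma is_RInt_add (f g : R -> R) (a b u v : R) :
  is_RInt f a b u -> is_RInt g a b v -> is_RInt (fun x => f x + g x) a b (u + v).
Proof. intros H K; apply (is_RInt_plus f g a b u v H K). Qed.

Lemma is_RInt_sin_0_PI : is_RInt sin 0 PI 2.
Proof.
  replace 2 with (minus (- cos PI) (- cos 0)).
  - apply (is_RInt_derive (V := R_CompleteNormedModule) (fun x => - cos x)).
    + intros x _; auto_derive; trivial; ring.
    + intros; apply continuous_sin.
  - rewrite cos_PI, cos_0. unfold minus, plus, opp; simpl; ring.
Qed.

(** The angles b and c contribute 4 PI, the area of the unit 2-sphere of imaginary directions. *)
Lemma is_sint_slice rho g (H : R -> R) I :
  0 < rho ->
  (forall a b c, 0 < a < PI -> 0 < b < PI -> g (sphere_param rho a b c) = H a) ->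
  is_RInt (fun a => H a * sin a ^ 2) 0 PI I ->
  is_sint rho g (4 * PI * rho ^ 3 * I).
Proof.
  intros Hr Hg HI.
  exists (fun a b => 2 * PI * rho ^ 3 * (H a * sin a ^ 2) * sin b),
    (fun a => 4 * PI * rho ^ 3 * (H a * sin a ^ 2)); split; [|split].
  - intros a b Ha Hb.
    apply is_RInt_ext with (fun _ => H a * (rho ^ 3 * sin a ^ 2 * sin b)).
    + intros c _; now rewrite Hg, sphere_density_eq.
    + replace (2 * PI * rho ^ 3 * (H a * sin a ^ 2) * sin b)
        with (scal (2 * PI - 0) (H a * (rho ^ 3 * sin a ^ 2 * sin b)))
        by (change scal with Rmult; rring).
      apply (is_RInt_const (V := R_NormedModule)).
  - intros a _.
    replace (4 * PI * rho ^ 3 * (H a * sin a ^ 2))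
      with ((2 * PI * rho ^ 3 * (H a * sin a ^ 2)) * 2) by ring.
    apply is_RInt_mul, is_RInt_sin_0_PI.
  - apply is_RInt_mul, HI.
Qed.

Lemma is_RInt_sin2 : is_RInt (fun a => sin a ^ 2) 0 PI (PI / 2).
Proof.
  replace (PI / 2) with (minus ((PI - sin PI * cos PI) / 2) ((0 - sin 0 * cos 0) / 2)).
  - apply (is_RInt_derive (V := R_CompleteNormedModule) (fun x => (x - sin x * cos x) / 2)).
    + intros x _; auto_derive; trivial.
      generalize (sin2_cos2 x); unfold Rsqr; intros. nra.
    + intros x _; cont.
  - rewrite sin_PI, sin_0. unfold minus, plus, opp; simpl; field.
Qed.

Lemma is_sint_const rho k : 0 < rho -> is_sint rho (fun _ => k) (2 * PI ^ 2 * rho ^ 3 * k).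
Proof.
  intros Hr.
  replace (2 * PI ^ 2 * rho ^ 3 * k) with (4 * PI * rho ^ 3 * (k * (PI / 2))) by field.
  apply is_sint_slice with (fun _ => k); trivial.
  apply is_RInt_mul, is_RInt_sin2.
Qed.

Lemma sphere_area_eq rho : 0 < rho -> sphere_area rho = 2 * PI ^ 2 * rho ^ 3.
Proof.
  intros Hr. unfold sphere_area. rewrite (is_sint_unique _ _ _ (is_sint_const rho 1 Hr)). ring.
Qed.

Lemma cauchy_schwarz2 A B c d : c ^ 2 + d ^ 2 <= 1 -> Rabs (A * c + B * d) <= sqrt (A ^ 2 + B ^ 2).
Proof.
  intros H. rewrite <- sqrt_Rsqr_abs. apply sqrt_le_1_alt. unfold Rsqr.
  assert (0 <= (A * d - B * c) ^ 2) by apply pow2_ge_0.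
  assert (0 <= A ^ 2) by apply pow2_ge_0. assert (0 <= B ^ 2) by apply pow2_ge_0.
  nra.
Qed.

(** The vector q is turned onto the real axis one angle at a time, from the inside out: (x2, x3)
    becomes (R1, 0) on the innermost circle, (x1, R1) becomes (R2, 0) by the rotation with m = 0,
    and (x0, R2) becomes (|q|, 0) by the one with m = 1. *)
Lemma is_sint_zonal rho (phi phi' : R -> R) (q : quat) :
  0 < rho -> smooth_on (qnorm q) phi phi' ->
  is_sint rho (fun y => phi (qdot y q / rho))
    (4 * PI * rho ^ 3 * RInt (fun a => sin a ^ 2 * phi (qnorm q * cos a)) 0 PI).
Proof.
  intros Hr. destruct q as [[[x0 x1] x2] x3].
  set (R1 := sqrt (x2 ^ 2 + x3 ^ 2)). set (R2 := sqrt (x1 ^ 2 + R1 ^ 2)).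
  assert (HR1 : R1 ^ 2 = x2 ^ 2 + x3 ^ 2) by (apply pow2_sqrt; nra).
  assert (HR2 : R2 ^ 2 = x1 ^ 2 + R1 ^ 2) by (apply pow2_sqrt; nra).
  assert (HR1p : 0 <= R1) by apply sqrt_pos.
  assert (HR2p : 0 <= R2) by apply sqrt_pos.
  assert (Hn : qnorm (x0, x1, x2, x3) = sqrt (x0 ^ 2 + R2 ^ 2)).
  { unfold qnorm, qdot, q0, q1, q2, q3; simpl fst; simpl snd.
    f_equal; rewrite HR2, HR1; ring. }
  rewrite Hn; set (s := sqrt (x0 ^ 2 + R2 ^ 2)); intros Hphi.
  assert (Hs2 : forall a w, Rabs w <= R2 -> Rabs (x0 * cos a + sin a * w) <= s).
  { intros a w Hw. unfold s.
    apply Rle_trans with (sqrt (x0 ^ 2 + w ^ 2)).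
    - replace (x0 * cos a + sin a * w) with (x0 * cos a + w * sin a) by ring.
      apply cauchy_schwarz2. generalize (sin2_cos2 a); unfold Rsqr; nra.
    - apply sqrt_le_1_alt. rewrite <- (pow2_abs w).
      generalize (Rabs_pos w); nra. }
  assert (Hs1 : forall a b w, Rabs w <= R1 ->
     Rabs (x0 * cos a + sin a * (x1 * cos b + sin b * w)) <= s).
  { intros a b w Hw. apply Hs2. unfold R2.
    apply Rle_trans with (sqrt (x1 ^ 2 + w ^ 2)).
    - replace (x1 * cos b + sin b * w) with (x1 * cos b + w * sin b) by ring.
      apply cauchy_schwarz2. generalize (sin2_cos2 b); unfold Rsqr; nra.
    - apply sqrt_le_1_alt. rewrite <- (pow2_abs w).
      generalize (Rabs_pos w); nra. }
  set (phia := fun a u => phi (x0 * cos a + sin a * u)).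
  set (phia' := fun a u => sin a * phi' (x0 * cos a + sin a * u)).
  assert (Sa : forall a, smooth_on R2 (phia a) (phia' a)).
  { intros a u Hu; split.
    - apply (der_comp phi (fun u => x0 * cos a + sin a * u)).
      + apply (Hphi _ (Hs2 a u Hu)).
      + auto_derive; trivial; ring.
    - unfold phia'; cont. apply cont_comp; [cont | apply (Hphi _ (Hs2 a u Hu))]. }
  assert (Sab : forall a b, smooth_on R1 (fun w => phi (x0 * cos a + sin a * (x1 * cos b + sin b * w)))
    (fun w => sin a * sin b * phi' (x0 * cos a + sin a * (x1 * cos b + sin b * w)))).
  { intros a b u Hu; split.
    - apply (der_comp phi (fun w => x0 * cos a + sin a * (x1 * cos b + sin b * w))).
      + apply (Hphi _ (Hs1 a b u Hu)).
      + auto_derive; trivial; ring.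
    - cont. apply cont_comp; [cont | apply (Hphi _ (Hs1 a b u Hu))]. }
  assert (Hin : forall a b, zonal_inner (phia a) 0 x1 R1 b =
     RInt (fun c => phi (x0 * cos a + sin a * (x1 * cos b + sin b * (R1 * cos c)))) 0 PI).
  { intros a b; unfold zonal_inner; apply RInt_ext; intros c _.
    unfold phia; rewrite pow_O, Rmult_1_l; f_equal; ring. }
  exists (fun a b => rho ^ 3 * sin a ^ 2 * 2 * (sin b ^ 1 * zonal_inner (phia a) 0 x1 R1 b)),
    (fun a => rho ^ 3 * 2 * PI * (sin a ^ 2 * zonal_inner phi 1 x0 R2 a)); split; [|split].
  - intros a b Ha Hb.
    pose proof (circle_rotate _ _ x2 x3 (Sab a b)) as K. fold R1 in K.
    assert (Hex : ex_RInt (fun c => phi (x0 * cos a + sin a * (x1 * cos b + sin b * (x2 * cos c + x3 * sin c))))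
       0 (2 * PI)).
    { apply cont_all_RInt; intros c. apply cont_comp; [cont|].
      eapply smooth_cont; [exact Hphi|]. apply Hs1.
      unfold R1; apply cauchy_schwarz2. generalize (sin2_cos2 c); unfold Rsqr; nra. }
    rewrite Hin.
    replace (rho ^ 3 * sin a ^ 2 * 2 * (sin b ^ 1 *
      RInt (fun c => phi (x0 * cos a + sin a * (x1 * cos b + sin b * (R1 * cos c)))) 0 PI))
      with ((rho ^ 3 * sin a ^ 2 * sin b) * (2 *
      RInt (fun c => phi (x0 * cos a + sin a * (x1 * cos b + sin b * (R1 * cos c)))) 0 PI))
      by (simpl; rring).
    rewrite <- K.
    eapply is_RInt_ext; [|apply is_RInt_mul, RInt_spec, Hex].
    intros c _; cbv beta. rewrite sphere_density_eq by assumption.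
    rewrite Rmult_comm at 1. f_equal. f_equal.
    unfold qdot, sphere_param, q0, q1, q2, q3; simpl; field; lra.
  - intros a Ha.
    pose proof (zonal_rotate _ _ 0 x1 R1 (Sa a)) as K. fold R2 in K.
    (* After this rotation the last angle is absent from the integrand and contributes the length
       PI. *)
    assert (E : zonal (phia a) 0 R2 0 = PI * zonal_inner phi 1 x0 R2 a).
    { unfold zonal, zonal_inner.
      assert (Hex : ex_RInt (fun b => sin b ^ 1 * phi (x0 * cos a + R2 * sin a * cos b)) 0 PI).
      { apply cont_all_RInt; intros b. cont. apply cont_comp; [cont|].
        eapply smooth_cont; [exact Hphi|]. apply zonal_bound'. }
      rewrite <- RInt_mul by exact Hex.
      apply RInt_ext; intros b _.
      rewrite (RInt_ext _ (fun _ => phi (x0 * cos a + R2 * sin a * cos b))).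
      - rewrite RInt_cst. rring.
      - intros c _; unfold phia; rewrite pow_O, Rmult_1_l; f_equal; ring. }
    replace (rho ^ 3 * 2 * PI * (sin a ^ 2 * zonal_inner phi 1 x0 R2 a))
      with (rho ^ 3 * sin a ^ 2 * 2 * (PI * zonal_inner phi 1 x0 R2 a)) by ring.
    rewrite <- E, <- K. apply is_RInt_mul. unfold zonal.
    apply RInt_spec, cont_all_RInt; intros b; cont.
    eapply zonal_inner_cont, Sa.
  - pose proof (zonal_rotate _ _ 1 x0 R2 Hphi) as K. fold s in K.
    (* Only the angle a is left; the factor 2 is the integral of sin b. *)
    assert (E : zonal phi 1 s 0 = 2 * RInt (fun a => sin a ^ 2 * phi (s * cos a)) 0 PI).
    { unfold zonal, zonal_inner.
      assert (Hex : ex_RInt (fun a => sin a ^ 2 * phi (s * cos a)) 0 PI).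
      { apply cont_all_RInt; intros b. cont. apply cont_comp; [cont|].
        eapply smooth_cont; [exact Hphi|].
        unfold s. replace (sqrt (x0 ^ 2 + R2 ^ 2) * cos b) with
          (sqrt (x0 ^ 2 + R2 ^ 2) * cos 0 * cos b + sqrt (x0 ^ 2 + R2 ^ 2) * sin 0 * sin b * cos b)
          by (rewrite cos_0, sin_0; ring).
        apply zonal_bound, sqrt_pos. }
      rewrite <- RInt_mul by exact Hex.
      apply RInt_ext; intros a _.
      rewrite (RInt_ext _ (fun b => phi (s * cos a) * sin b)).
      - rewrite RInt_mul by (eexists; apply is_RInt_sin_0_PI).
        rewrite (is_RInt_unique _ _ _ _ is_RInt_sin_0_PI). rring.
      - intros b _. rewrite pow_1, Rmult_0_l, Rmult_0_l, Rplus_0_r. apply Rmult_comm. }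
    replace (4 * PI * rho ^ 3 * RInt (fun a => sin a ^ 2 * phi (s * cos a)) 0 PI)
      with (rho ^ 3 * 2 * PI * (2 * RInt (fun a => sin a ^ 2 * phi (s * cos a)) 0 PI)) by rring.
    rewrite <- E, <- K. apply is_RInt_mul. unfold zonal.
    apply RInt_spec, cont_all_RInt; intros b; cont.
    eapply zonal_inner_cont, Hphi.
Qed.

(** * Logarithms of linear factors *)

Lemma is_d2_unique f m n : is_d2 f m -> is_d2 f n -> m = n.
Proof. intros H1 H2; now rewrite <- (is_d2_Derive_n _ _ H1), (is_d2_Derive_n _ _ H2). Qed.

(** Along a line the squared distance to a point is a quadratic polynomial, so this formula gives
    the second derivatives of all linear factors, in the plane and in R^4. *)
Lemma is_d2_ln_quadratic c0 c1 c2 :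
  0 < c0 ->
  is_d2 (fun t => ln (c0 + c1 * t + c2 * t ^ 2) / 2) ((2 * c2 * c0 - c1 ^ 2) / (2 * c0 ^ 2)).
Proof.
  intros H0. exists (fun t => (c1 + 2 * c2 * t) / (2 * (c0 + c1 * t + c2 * t ^ 2))); split.
  - assert (C : continuous (fun t => c0 + c1 * t + c2 * t ^ 2) 0) by cont.
    assert (L : locally 0 (fun t => 0 < c0 + c1 * t + c2 * t ^ 2)).
    { apply (C (fun y => 0 < y)). apply open_gt. simpl; lra. }
    revert L; apply filter_imp; intros t Ht. auto_derive; [simpl in Ht; lra|].
    simpl in *; field; lra.
  - auto_derive; [simpl; lra | simpl; field; lra].
Qed.

(* [log |z - w|] for z = x + iy, w = al + i be *)
Definition log_lin (al be x y : R) : R := ln ((x - al) ^ 2 + (y - be) ^ 2) / 2.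

(** Passes from a full circle in a slice to the range [0, PI] of the first angle of
    [sphere_param]. *)
Lemma is_RInt_even_half (f : R -> R) (V : R) :
  (forall x, f (- x) = f x) -> is_RInt f (- PI) PI V -> is_RInt f 0 PI (V / 2).
Proof.
  intros He H. generalize PI_RGT_0; intros Hpi.
  assert (E1 : ex_RInt f 0 PI).
  { apply (ex_RInt_Chasles_2 (V := R_CompleteNormedModule) f (- PI)); [lra | now exists V]. }
  destruct E1 as [X HX].
  assert (HX' : is_RInt f (- PI) 0 X).
  { apply is_RInt_swap in HX.
    replace PI with (- - PI) in HX by ring. replace 0 with (- 0) in HX by ring.
    apply is_RInt_comp_opp in HX.
    apply is_RInt_opp in HX. unfold opp in HX; simpl in HX. rewrite Ropp_involutive in HX.
    eapply is_RInt_ext; [|exact HX]. intros x _; cbv beta; rewrite He; apply Ropp_involutive. }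
  pose proof (is_RInt_Chasles (V := R_NormedModule) f (- PI) 0 PI X X HX' HX) as K.
  apply RInt_val in K.
  apply RInt_val in H.
  replace (V / 2) with X; [exact HX|].
  rewrite H in K; unfold plus in K; simpl in K. lra.
Qed.

(* The number T measures the failure of the mean value formula for harmonic functions. *)
Definition jet_defect (h : R -> R -> R) (rho T : R) : Prop :=
  exists m, is_d2 (fun t => h t 0) m /\ is_d2 (fun t => h 0 t) (- m) /\
    is_RInt (fun a => h (rho * cos a) (rho * sin a) * sin a ^ 2) (- PI) PI
      (PI * (h 0 0 - rho ^ 2 * m / 4 + T)).

Lemma jet_defect_plus h k rho S T :
  jet_defect h rho S -> jet_defect k rho T ->
  jet_defect (fun x y => h x y + k x y) rho (S + T).
Proof.
  intros (m & A1 & A2 & A3) (n & B1 & B2 & B3). exists (m + n); split; [|split].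
  - apply is_d2_plus; assumption.
  - rewrite Ropp_plus_distr; apply is_d2_plus; assumption.
  - replace (PI * (h 0 0 + k 0 0 - rho ^ 2 * (m + n) / 4 + (S + T)))
      with (PI * (h 0 0 - rho ^ 2 * m / 4 + S) + PI * (k 0 0 - rho ^ 2 * n / 4 + T))
      by field.
    eapply is_RInt_ext; [|apply is_RInt_add; [exact A3 | exact B3]].
    intros x _; cbv beta; rring.
Qed.

Lemma jet_defect_scal c h rho T :
  jet_defect h rho T -> jet_defect (fun x y => c * h x y) rho (c * T).
Proof.
  intros (m & A1 & A2 & A3). exists (c * m); split; [|split].
  - apply is_d2_scal, A1.
  - replace (- (c * m)) with (c * - m) by ring. apply is_d2_scal, A2.
  - replace (PI * (c * h 0 0 - rho ^ 2 * (c * m) / 4 + c * T))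
      with (c * (PI * (h 0 0 - rho ^ 2 * m / 4 + T))) by field.
    eapply is_RInt_ext; [|apply is_RInt_mul; eassumption].
    intros x _; cbv beta; rring.
Qed.

Lemma jet_defect_0 rho : jet_defect (fun _ _ => 0) rho 0.
Proof.
  exists 0; split; [|split].
  - apply is_d2_const.
  - rewrite Ropp_0; apply is_d2_const.
  - apply is_RInt_ext with (fun _ => 0); [intros; rring|].
    replace (PI * (0 - rho ^ 2 * 0 / 4 + 0)) with (scal (PI - - PI) 0)
      by (change scal with Rmult; in_R; field).
    apply (is_RInt_const (V := R_NormedModule)).
Qed.

Lemma jet_defect_sum {A : Type} (h : A -> R -> R -> R) (T : A -> R) rho (l : list A) :
  (forall c, In c l -> jet_defect (h c) rho (T c)) ->
  jet_defect (fun x y => sum_over (fun c => h c x y) l) rho (sum_over T l).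
Proof.
  induction l as [|c l IH]; intros H.
  - apply jet_defect_0.
  - apply (jet_defect_plus (h c) (fun x y => sum_over (fun c => h c x y) l)).
    + apply H; now left.
    + apply IH; intros; apply H; now right.
Qed.

(* On the circle |z| = rho, |z - w| = |rho - conj(w) z / rho|, and the right-hand side has no
   zeros in a neighbourhood of the closed disc. *)
Lemma log_lin_circle al be rho :
  Cmod (al, be) < rho ->
  is_RInt (fun a => log_lin al be (rho * cos a) (rho * sin a) * sin a ^ 2) (- PI) PI
    (PI * (ln rho + (al ^ 2 - be ^ 2) / (4 * rho ^ 2))).
Proof.
  intros Hw. set (d := Cmod (al, be)) in *.
  assert (Hd0 : 0 <= d) by apply Cmod_ge_0.
  assert (Hd2 : d ^ 2 = al ^ 2 + be ^ 2).
  { unfold d, Cmod; simpl fst; simpl snd. apply pow2_sqrt. nra. }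
  assert (Hrho : 0 < rho) by lra.
  (* The zero of the reflected factor has modulus rho^2 / d. The harmonic mean of rho and that
     modulus lies strictly between them, and this form of it makes sense for d = 0 as well. *)
  set (R0 := 2 * rho ^ 2 / (rho + d)).
  assert (HR0 : rho < R0).
  { unfold R0. apply Rmult_lt_reg_r with (rho + d); [lra|].
    unfold Rdiv; rewrite Rmult_assoc, Rinv_l by lra. nra. }
  assert (HR0d : d * R0 < rho ^ 2).
  { unfold R0. apply Rmult_lt_reg_r with (rho + d); [lra|].
    replace (d * (2 * rho ^ 2 / (rho + d)) * (rho + d)) with (2 * d * rho ^ 2) by (field; lra).
    assert (0 < rho ^ 2) by nra. nra. }
  set (u := fun x y => rho - (al * x + be * y) / rho).
  set (v := fun x y => - (al * y - be * x) / rho).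
  assert (Hh : hol (disc R0) u v (fun _ _ => - al / rho) (fun _ _ => be / rho)).
  { split; [intros; apply disc_open; assumption|]. intros x y _; unfold u, v.
    conjs; try (auto_derive; trivial; field; lra); unfold cont2; cont; lra. }
  assert (Hpos : forall x y, disc R0 x y -> 0 < u x y ^ 2 + v x y ^ 2).
  { intros x y Hxy.
    assert (E : rho ^ 2 * (u x y ^ 2 + v x y ^ 2) =
      (rho ^ 2 - (al * x + be * y)) ^ 2 + (al * y - be * x) ^ 2).
    { unfold u, v; field; lra. }
    unfold disc in Hxy. set (e := Cmod (x, y)) in *.
    assert (He0 : 0 <= e) by apply Cmod_ge_0.
    assert (He2 : e ^ 2 = x ^ 2 + y ^ 2).
    { unfold e, Cmod; simpl fst; simpl snd. apply pow2_sqrt. nra. }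
    assert (Hprod : al * x + be * y <= d * e).
    { apply Rnot_lt_le; intros Hlt.
      assert (0 <= (al * y - be * x) ^ 2) by apply pow2_ge_0.
      assert ((al * x + be * y) ^ 2 + (al * y - be * x) ^ 2 = (d * e) ^ 2).
      { replace ((d * e) ^ 2) with (d ^ 2 * e ^ 2) by ring. rewrite Hd2, He2; ring. }
      assert (0 <= d * e) by nra. nra. }
    assert (Hde : d * e < rho ^ 2) by nra.
    assert (0 < (rho ^ 2 - (al * x + be * y)) ^ 2) by (apply pow_lt; lra).
    assert (0 <= (al * y - be * x) ^ 2) by apply pow2_ge_0.
    apply Rmult_lt_reg_l with (rho ^ 2); [nra|]. rewrite Rmult_0_r, E; lra. }
  destruct (hol_log_jet _ _ _ _ _ Hh Hpos) as [m Hm].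
  destruct (Hm rho) as (J1 & _ & J3); [lra|].
  (* [hol_log_jet] provides m only existentially; uniqueness of the second derivative along the real
     axis identifies it. *)
  assert (Em : m = (be ^ 2 - al ^ 2) / rho ^ 4).
  { apply (is_d2_unique _ _ _ J1).
    replace ((be ^ 2 - al ^ 2) / rho ^ 4) with
      ((2 * (d ^ 2 / rho ^ 2) * rho ^ 2 - (-2 * al) ^ 2) / (2 * (rho ^ 2) ^ 2))
      by (rewrite Hd2; field; lra).
    apply is_d2_ext_loc with (fun t => ln (rho ^ 2 + (-2 * al) * t + (d ^ 2 / rho ^ 2) * t ^ 2) / 2).
    - apply filter_forall; intros t. do 2 f_equal. unfold u, v; rewrite Hd2; field; lra.
    - apply is_d2_ln_quadratic; nra. }
  replace (PI * (ln rho + (al ^ 2 - be ^ 2) / (4 * rho ^ 2)))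
    with (PI * (ln (u 0 0 ^ 2 + v 0 0 ^ 2) / 2 - rho ^ 2 * m / 4)).
  - eapply is_RInt_ext; [|exact J3]. intros a _; cbv beta. f_equal. unfold log_lin.
    do 2 f_equal. unfold u, v.
    generalize (sin2_cos2 a); unfold Rsqr; intros E.
    replace ((rho * cos a - al) ^ 2 + (rho * sin a - be) ^ 2)
      with (rho ^ 2 * (sin a * sin a + cos a * cos a) + al ^ 2 + be ^ 2
            - 2 * rho * (al * cos a + be * sin a)) by ring.
    transitivity (rho ^ 2 + (al ^ 2 + be ^ 2) * (sin a * sin a + cos a * cos a)
      - 2 * rho * (al * cos a + be * sin a)); [field; lra|].
    rewrite E; ring.
  - rewrite Em. unfold u, v.
    replace ((rho - (al * 0 + be * 0) / rho) ^ 2 + (- (al * 0 - be * 0) / rho) ^ 2)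
      with (rho ^ 2) by (field; lra).
    rewrite ln_pow by exact Hrho. simpl (INR 2). field; lra.
Qed.

Lemma ln_quot x y : 0 < x -> 0 < y -> ln (x / y) = ln x - ln y.
Proof.
  intros Hx Hy. unfold Rdiv, Rminus.
  rewrite ln_mult, ln_Rinv by (trivial; now apply Rinv_0_lt_compat). reflexivity.
Qed.

Lemma Cmod_r (r : R) : Cmod (r, 0) = Rabs r.
Proof. exact (Cmod_R r). Qed.

(** The difference between the circle value ln rho + (al^2 - be^2) / (4 rho^2) of the reflected
    factor and the value ln |w| - rho^2 m / 4 of z - w itself at 0, where m = (be^2 - al^2) /
    |w|^4. *)
Definition lin_term (rho al be : R) : R :=
  ln (rho / Cmod (al, be)) + (al ^ 2 - be ^ 2) / 4 * (/ rho ^ 2 - rho ^ 2 / Cmod (al, be) ^ 4).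

Lemma jet_defect_lin al be rho :
  0 < Cmod (al, be) < rho -> jet_defect (log_lin al be) rho (lin_term rho al be).
Proof.
  intros Hw. pose proof (log_lin_circle al be rho (proj2 Hw)) as J.
  unfold lin_term. set (d := Cmod (al, be)) in *.
  assert (Hd2 : d ^ 2 = al ^ 2 + be ^ 2).
  { unfold d, Cmod; simpl fst; simpl snd. apply pow2_sqrt. nra. }
  assert (Hp : 0 < d ^ 2) by (apply pow_lt; lra).
  assert (Hb2 : be ^ 2 = d ^ 2 - al ^ 2) by lra.
  exists ((be ^ 2 - al ^ 2) / d ^ 4); split; [|split].
  - replace ((be ^ 2 - al ^ 2) / d ^ 4) with
      ((2 * 1 * d ^ 2 - (-2 * al) ^ 2) / (2 * (d ^ 2) ^ 2)) by (rewrite Hb2; field; lra).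
    eapply is_d2_ext_loc; [|apply is_d2_ln_quadratic, Hp].
    apply filter_forall; intros t; unfold log_lin; do 2 f_equal. rewrite Hd2; ring.
  - replace (- ((be ^ 2 - al ^ 2) / d ^ 4)) with
      ((2 * 1 * d ^ 2 - (-2 * be) ^ 2) / (2 * (d ^ 2) ^ 2))
      by (replace ((-2 * be) ^ 2) with (4 * be ^ 2) by ring; rewrite Hb2; field; lra).
    eapply is_d2_ext_loc; [|apply is_d2_ln_quadratic, Hp].
    apply filter_forall; intros t; unfold log_lin; do 2 f_equal. rewrite Hd2; ring.
  - replace (log_lin al be 0 0) with (ln d).
    2:{ unfold log_lin. replace ((0 - al) ^ 2 + (0 - be) ^ 2) with (d ^ 2) by (rewrite Hd2; ring).
        rewrite ln_pow by lra; simpl (INR 2); field. }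
    rewrite ln_quot by lra.
    match type of J with is_RInt _ _ _ ?W => match goal with |- is_RInt _ _ _ ?V =>
      replace V with W by (field; lra) end end.
    exact J.
Qed.

Lemma jet_defect_real r rho :
  r <> 0 -> Rabs r < rho -> jet_defect (log_lin r 0) rho (real_term rho r).
Proof.
  intros Hr Hlt. assert (0 < Rabs r) by (apply Rabs_pos_lt, Hr).
  replace (real_term rho r) with (lin_term rho r 0).
  - apply jet_defect_lin; rewrite Cmod_r; lra.
  - unfold lin_term, real_term. rewrite Cmod_r.
    replace (Rabs r ^ 4) with (r ^ 4) by
      (replace (Rabs r ^ 4) with ((Rabs r ^ 2) ^ 2) by ring; rewrite pow2_abs; ring).
    field; lra.
Qed.

(** On a slice |(x - q)^s| is |z - w| |z - conj w|. Both factors have the same term, and 2 (al^2 -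
    be^2) = (2 al)^2 - 2 |w|^2 brings their sum into the shape of [sphere_term]. *)
Lemma jet_defect_pair al be rho :
  0 < Cmod (al, be) < rho ->
  jet_defect (fun x y => log_lin al be x y + log_lin al (- be) x y) rho
    (ln (rho ^ 2 / Cmod (al, be) ^ 2)
     + 1 / 4 * ((rho ^ 4 - Cmod (al, be) ^ 4) / (rho ^ 2 * Cmod (al, be) ^ 4))
       * (2 * Cmod (al, be) ^ 2 - (2 * al) ^ 2)).
Proof.
  intros Hw. pose proof (jet_defect_lin al be rho Hw) as J1.
  pose proof Hw as Hw'. rewrite <- (Cmod_opp_snd al be) in Hw'.
  pose proof (jet_defect_plus _ _ _ _ _ J1 (jet_defect_lin al (- be) rho Hw')) as J.
  unfold lin_term in J. rewrite Cmod_opp_snd in J. set (d := Cmod (al, be)) in *.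
  assert (Hd2 : d ^ 2 = al ^ 2 + be ^ 2).
  { unfold d, Cmod; simpl fst; simpl snd. apply pow2_sqrt. nra. }
  match type of J with jet_defect _ _ ?S => match goal with |- jet_defect _ _ ?T =>
    replace T with S; [exact J|] end end.
  rewrite !ln_quot, !ln_pow by (try apply pow_lt; lra). simpl (INR 2).
  replace ((- be) ^ 2) with (be ^ 2) by ring. replace (be ^ 2) with (d ^ 2 - al ^ 2) by lra.
  field; lra.
Qed.

(** * Zero-free functions up to the boundary circle *)

Lemma cont_Rmin_const (c x : R) : continuous (fun t => Rmin t c) x.
Proof.
  apply filterlim_locally; intros eps; exists eps; intros y Hy.
  change (Rabs (y - x) < eps) in Hy. change (Rabs (Rmin y c - Rmin x c) < eps).
  eapply Rle_lt_trans; [|exact Hy]. unfold Rmin; repeat destruct Rle_dec; split_Rabs; lra.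
Qed.

Lemma cont_zero_left (phi : R -> R) (c : R) :
  0 < c -> continuous phi c -> (forall r, 0 < r < c -> phi r = 0) -> phi c = 0.
Proof.
  intros Hc H H0. apply NNPP; intros Hne.
  assert (Hp : 0 < Rabs (phi c)) by (apply Rabs_pos_lt, Hne).
  destruct (proj1 (filterlim_locally _ _) H (mkposreal _ Hp)) as [d Hd].
  set (r := c - Rmin d c / 2).
  assert (0 < Rmin d c) by (apply Rmin_pos; [apply cond_pos | exact Hc]).
  assert (Rmin d c <= d) by apply Rmin_l. assert (Rmin d c <= c) by apply Rmin_r.
  assert (K : Rabs (phi r - phi c) < Rabs (phi c)).
  { apply (Hd r). change (Rabs (r - c) < d). unfold r. rewrite Rabs_left; lra. }
  rewrite (H0 r) in K by (unfold r; lra).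
  rewrite Rminus_0_l, Rabs_Ropp in K. lra.
Qed.

Lemma Cmod_circle (r a : R) : 0 < r -> Cmod (r * cos a, r * sin a) = r.
Proof. intros Hr; rewrite Cmod_polar; apply Rabs_pos_eq; lra. Qed.

(* The formula holds on the circles of radius r < rho; both sides are continuous at rho. *)
Lemma hol_log_boundary rho u v p s (h : R -> R -> R) :
  0 < rho -> hol (disc rho) u v p s ->
  (forall x y, disc rho x y -> 0 < u x y ^ 2 + v x y ^ 2) ->
  (forall x y, disc rho x y -> h x y = ln (u x y ^ 2 + v x y ^ 2) / 2) ->
  (forall x y, Cmod (x, y) = rho -> cont2 h x y) ->
  jet_defect h rho 0.
Proof.
  intros Hrho Hh Hpos Heq Hbd.
  destruct (hol_log_jet _ _ _ _ _ Hh Hpos) as [m Hm].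
  assert (H00 : disc rho 0 0).
  { unfold disc; rewrite (Cmod_0 : Cmod (0, 0) = 0); lra. }
  (* The jets at 0 do not depend on the radius, so any admissible radius serves. *)
  destruct (Hm (rho / 2)) as (J1 & J2 & _); [lra|].
  assert (Hi := hol_mul_neg_i _ _ _ _ _ Hh).
  assert (Hcin : forall x y, disc rho x y -> cont2 h x y).
  { intros x y Hxy.
    apply (continuous_ext_loc _ (fun z : R * R => ln (u (fst z) (snd z) ^ 2 + v (fst z) (snd z) ^ 2) / 2)).
    - generalize (disc_open _ _ _ Hxy); apply filter_imp; intros z Hz; symmetry; apply Heq, Hz.
    - pose proof (hol_cont _ _ _ _ _ _ _ Hh Hxy) as cu.
      pose proof (hol_cont _ _ _ _ _ _ _ Hi Hxy) as cv.
      unfold cont2 in cu, cv. cont; [simpl; apply Hpos, Hxy | lra]. }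
  exists m; split; [|split].
  - eapply is_d2_ext_loc; [|exact J1].
    generalize (locally_pair_l _ _ _ (disc_open _ _ _ H00)); apply filter_imp.
    intros t Ht; symmetry; apply Heq, Ht.
  - eapply is_d2_ext_loc; [|exact J2].
    generalize (locally_pair_r _ _ _ (disc_open _ _ _ H00)); apply filter_imp.
    intros t Ht; symmetry; apply Heq, Ht.
  - assert (Hdisc : forall r a, 0 < r < rho -> disc rho (r * cos a) (r * sin a)).
    { intros r a Hr; unfold disc; rewrite Cmod_circle; lra. }
    (* Freezing the radius at rho defines the mean on both sides of rho without using h beyond the
       closed disc, where nothing is known about it. *)
    set (f := fun r a => h (Rmin r rho * cos a) (Rmin r rho * sin a) * sin a ^ 2).
    assert (Hcont : forall r a, 0 < r -> cont2 h (Rmin r rho * cos a) (Rmin r rho * sin a)).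
    { intros r a Hr. unfold Rmin; destruct Rle_dec.
      - destruct (Req_dec r rho) as [->|Hne].
        + apply Hbd, Cmod_circle, Hrho.
        + apply Hcin, Hdisc; lra.
      - apply Hbd, Cmod_circle, Hrho. }
    assert (Hex : forall r, 0 < r -> ex_RInt (f r) (- PI) PI).
    { intros r Hr; apply cont_all_RInt; intros a; unfold f; cont.
      apply cont_comp2; cont. apply Hcont, Hr. }
    assert (I : forall r, 0 < r < rho -> RInt (f r) (- PI) PI = PI * (h 0 0 - r ^ 2 * m / 4)).
    { intros r Hr. destruct (Hm r Hr) as (_ & _ & J3).
      apply RInt_val.
      apply is_RInt_ext with (fun a => h (r * cos a) (r * sin a) * sin a ^ 2).
      { intros a _; unfold f; rewrite Rmin_left by lra; reflexivity. }
      rewrite Heq by exact H00.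
      eapply is_RInt_ext; [|exact J3]. intros a _; cbv beta. f_equal. symmetry.
      apply Heq, Hdisc, Hr. }
    assert (Z : RInt (f rho) (- PI) PI - PI * (h 0 0 - Rmin rho rho ^ 2 * m / 4) = 0).
    { apply (cont_zero_left
        (fun r => RInt (f r) (- PI) PI - PI * (h 0 0 - Rmin r rho ^ 2 * m / 4)) rho Hrho).
      - assert (K := cont_Rmin_const rho rho). cont; [|lra].
        apply cont_param.
        + generalize PI_RGT_0; lra.
        + intros a _; unfold f.
          assert (K' : continuous (fun z : R * R => Rmin (fst z) rho) (rho, a)).
          { apply (cont_comp (fun t => Rmin t rho)); [cont | exact K]. }
          cont; apply cont_comp2; cont. apply Hcont, Hrho.
        + exists (mkposreal rho Hrho); intros r Hr. apply Hex.
          change (Rabs (r - rho) < rho) in Hr. split_Rabs; lra.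
      - intros r Hr; rewrite I, Rmin_left by lra. ring. }
    rewrite Rmin_left in Z by lra.
    replace (PI * (h 0 0 - rho ^ 2 * m / 4 + 0)) with (RInt (f rho) (- PI) PI) by (rewrite Rplus_0_r; lra).
    eapply is_RInt_ext; [|apply RInt_spec, Hex, Hrho].
    intros a _; unfold f; rewrite Rmin_left by lra; reflexivity.
Qed.

(** * Quaternions *)

Ltac quat_simpl :=
  unfold slice_pt, qconj, qzero, qone, qdot, q0, q1, q2, q3;
  repeat (progress (unfold qreal, minus, plus, scal, opp, mult; simpl)).

Lemma qdot_pos x : 0 <= qdot x x.
Proof. destruct x as [[[a b] c] d]; unfold qdot, q0, q1, q2, q3; simpl; nra. Qed.

Lemma qnorm_sq x : qnorm x ^ 2 = qdot x x.
Proof. apply pow2_sqrt, qdot_pos. Qed.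

Lemma qnorm_ge0 x : 0 <= qnorm x.
Proof. apply sqrt_pos. Qed.

Lemma qnorm_zero : qnorm qzero = 0.
Proof.
  unfold qnorm, qdot, qzero, qreal, q0, q1, q2, q3; simpl.
  replace (_ + _) with 0 by ring. apply sqrt_0.
Qed.

Lemma qnorm_pos x : x <> qzero -> 0 < qnorm x.
Proof.
  intros H. apply sqrt_lt_R0. destruct x as [[[a b] c] d].
  destruct (qdot_pos (a, b, c, d)) as [K|K]; [exact K|exfalso].
  unfold qdot, q0, q1, q2, q3 in K; simpl in K.
  apply H. unfold qzero, qreal.
  assert (a = 0) by nra. assert (b = 0) by nra. assert (c = 0) by nra. assert (d = 0) by nra.
  now subst.
Qed.

Lemma qnorm_mul x y : qnorm (qmul x y) = qnorm x * qnorm y.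
Proof.
  unfold qnorm. rewrite <- sqrt_mult_alt by apply qdot_pos. f_equal.
  destruct x as [[[a b] c] d], y as [[[e f] g] h].
  unfold qdot, qmul, q0, q1, q2, q3; simpl; ring.
Qed.

Lemma qnorm_one : qnorm qone = 1.
Proof.
  unfold qnorm, qdot, qone, qreal, q0, q1, q2, q3; simpl.
  replace (_ + _) with 1 by ring. apply sqrt_1.
Qed.

Lemma qnorm_inv x : 0 < qnorm x -> qnorm (qinv x) = / qnorm x.
Proof.
  intros H. assert (Hd := qnorm_sq x).
  assert (E : qdot (qinv x) (qinv x) = (/ qnorm x) ^ 2).
  { assert (K : qdot (qinv x) (qinv x) = (/ qdot x x) ^ 2 * qdot x x).
    { unfold qinv. set (k := / qdot x x). destruct x as [[[a b] c] d].
      quat_simpl; ring. }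
    rewrite K, <- Hd; field; lra. }
  unfold qnorm at 1; rewrite E. apply sqrt_pow2. apply Rlt_le, Rinv_0_lt_compat, H.
Qed.

Lemma qnorm_pow_nat x n : qnorm (qpow_nat x n) = qnorm x ^ n.
Proof. induction n as [|n IH]; simpl; [apply qnorm_one | now rewrite qnorm_mul, IH]. Qed.

Lemma qnorm_pow x n : 0 < qnorm x -> qnorm (qpow x n) = powerRZ (qnorm x) n.
Proof.
  intros H; destruct n as [|p|p]; simpl.
  - apply qnorm_one.
  - apply qnorm_pow_nat.
  - rewrite qnorm_inv; rewrite qnorm_pow_nat; [reflexivity | apply pow_lt, H].
Qed.

Lemma ln_powerRZ x n : 0 < x -> ln (powerRZ x n) = IZR n * ln x.
Proof.
  intros H; destruct n as [|p|p]; simpl.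
  - rewrite ln_1; ring.
  - rewrite ln_pow by exact H. now rewrite INR_IZR_INZ, positive_nat_Z.
  - rewrite ln_Rinv by (apply pow_lt, H). rewrite ln_pow by exact H.
    rewrite INR_IZR_INZ, positive_nat_Z. change (Z.neg p) with (- Z.pos p)%Z.
    rewrite opp_IZR; ring.
Qed.

Lemma qnorm_pow_pos x n : 0 < qnorm x -> 0 < qnorm (qpow x n).
Proof. intros H; rewrite qnorm_pow by exact H; apply powerRZ_lt, H. Qed.

Lemma ln_qnorm_mul x y : 0 < qnorm x -> 0 < qnorm y ->
  ln (qnorm (qmul x y)) = ln (qnorm x) + ln (qnorm y).
Proof. intros; rewrite qnorm_mul; now apply ln_mult. Qed.

Lemma ln_qnorm_pow x n : 0 < qnorm x -> ln (qnorm (qpow x n)) = IZR n * ln (qnorm x).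
Proof. intros H; rewrite qnorm_pow, ln_powerRZ by exact H; reflexivity. Qed.

(** True at x = 0 as well, since [ln] takes the value 0 at 0. *)
Lemma ln_qnorm_eq x : ln (qnorm x) = ln (qdot x x) / 2.
Proof.
  destruct (qdot_pos x) as [H|H].
  - rewrite <- qnorm_sq, ln_pow; [simpl; field|]. apply sqrt_lt_R0, H.
  - unfold qnorm; rewrite <- H, sqrt_0.
    unfold ln; destruct (Rlt_dec 0 0) as [h|h]; [exfalso; exact (Rlt_irrefl 0 h) | lra].
Qed.

(** * The defect of the mean value formula on the ball *)

Definition axis (F : quat -> R) (e : quat) (t : R) : R := F (plus qzero (scal t e)).

(** T is the error in the mean value formula F(0) + (rho^2 / 8) Delta F(0), which is exact for
    biharmonic functions of four variables. The factor 2 PI^2 rho^3 is the area of the sphere. *)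
Definition sph_defect (F : quat -> R) (rho T : R) : Prop :=
  exists m0 m1 m2 m3,
    is_d2 (axis F (1, 0, 0, 0)) m0 /\ is_d2 (axis F (0, 1, 0, 0)) m1 /\
    is_d2 (axis F (0, 0, 1, 0)) m2 /\ is_d2 (axis F (0, 0, 0, 1)) m3 /\
    is_sint rho F (2 * PI ^ 2 * rho ^ 3 * (F qzero + rho ^ 2 / 8 * (m0 + m1 + m2 + m3) + T)).

Lemma sph_defect_formula F rho T :
  0 < rho -> sph_defect F rho T ->
  F qzero = 1 / sphere_area rho * sphere_integral rho F - rho ^ 2 / 8 * laplacian F qzero - T.
Proof.
  intros Hr (m0 & m1 & m2 & m3 & H0 & H1 & H2 & H3 & HI).
  rewrite (is_sint_unique _ _ _ HI), sphere_area_eq by exact Hr.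
  unfold laplacian, second_partial.
  apply is_d2_Derive_n in H0, H1, H2, H3. unfold axis in *.
  rewrite H0, H1, H2, H3.
  generalize PI_RGT_0; intros Hpi. field; lra.
Qed.

Lemma sph_defect_plus F G rho S T :
  sph_defect F rho S -> sph_defect G rho T -> sph_defect (fun x => F x + G x) rho (S + T).
Proof.
  intros (m0 & m1 & m2 & m3 & H0 & H1 & H2 & H3 & HI)
    (n0 & n1 & n2 & n3 & K0 & K1 & K2 & K3 & KI).
  exists (m0 + n0), (m1 + n1), (m2 + n2), (m3 + n3).
  conjs; try (apply is_d2_plus; assumption).
  replace (2 * PI ^ 2 * rho ^ 3 * _) with
    (2 * PI ^ 2 * rho ^ 3 * (F qzero + rho ^ 2 / 8 * (m0 + m1 + m2 + m3) + S)
     + 2 * PI ^ 2 * rho ^ 3 * (G qzero + rho ^ 2 / 8 * (n0 + n1 + n2 + n3) + T)) by field.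
  apply is_sint_plus; assumption.
Qed.

Lemma sph_defect_scal c F rho T :
  sph_defect F rho T -> sph_defect (fun x => c * F x) rho (c * T).
Proof.
  intros (m0 & m1 & m2 & m3 & H0 & H1 & H2 & H3 & HI).
  exists (c * m0), (c * m1), (c * m2), (c * m3).
  conjs; try (apply is_d2_scal; assumption).
  replace (2 * PI ^ 2 * rho ^ 3 * _) with
    (c * (2 * PI ^ 2 * rho ^ 3 * (F qzero + rho ^ 2 / 8 * (m0 + m1 + m2 + m3) + T))) by field.
  apply is_sint_scal; assumption.
Qed.

Lemma sph_defect_const c rho : 0 < rho -> sph_defect (fun _ => c) rho 0.
Proof.
  intros Hr. exists 0, 0, 0, 0. conjs; try apply is_d2_const.
  replace (c + rho ^ 2 / 8 * (0 + 0 + 0 + 0) + 0) with c by field.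
  apply is_sint_const, Hr.
Qed.

Lemma sphere_param_norm rho a b c : 0 < rho -> qnorm (sphere_param rho a b c) = rho.
Proof.
  intros Hr. unfold qnorm.
  replace (qdot _ _) with (rho ^ 2); [apply sqrt_pow2; lra|].
  unfold qdot, sphere_param, q0, q1, q2, q3; simpl.
  assert (Sa : sin a * sin a = 1 - cos a * cos a) by (generalize (sin2_cos2 a); unfold Rsqr; lra).
  assert (Sb : sin b * sin b = 1 - cos b * cos b) by (generalize (sin2_cos2 b); unfold Rsqr; lra).
  assert (Sc : sin c * sin c = 1 - cos c * cos c) by (generalize (sin2_cos2 c); unfold Rsqr; lra).
  ring [Sa Sb Sc].
Qed.

Lemma axis_qnorm t e : qdot e e = 1 -> qnorm (plus qzero (scal t e)) = Rabs t.
Proof.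
  intros He. rewrite <- sqrt_Rsqr_abs. unfold qnorm; f_equal.
  transitivity (t * t * qdot e e); [|rewrite He; unfold Rsqr; ring].
  destruct e as [[[a b] c] d].
  quat_simpl; ring.
Qed.

(** Only the germ at 0 and the values on the sphere enter. Hence the dummy or unspecified values of
    log |f| at zeros and poles inside the ball are harmless. *)
Lemma sph_defect_ext F G rho T d :
  0 < rho -> 0 < d -> (forall x, qnorm x < d \/ qnorm x = rho -> F x = G x) ->
  sph_defect F rho T -> sph_defect G rho T.
Proof.
  intros Hr Hd E (m0 & m1 & m2 & m3 & H0 & H1 & H2 & H3 & HI).
  assert (A : forall e, qdot e e = 1 -> locally 0 (fun t => axis F e t = axis G e t)).
  { intros e He; exists (mkposreal d Hd); intros t Ht. apply E; left.
    rewrite axis_qnorm by exact He. change (Rabs (t - 0) < d) in Ht.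
    now rewrite Rminus_0_r in Ht. }
  exists m0, m1, m2, m3.
  conjs; try (eapply is_d2_ext_loc; [apply A | eassumption];
    unfold qdot, q0, q1, q2, q3; simpl; ring).
  rewrite <- (E qzero) by (left; rewrite qnorm_zero; exact Hd).
  eapply is_sint_ext; [|exact HI]. intros a b c _ _; apply E; right.
  apply sphere_param_norm, Hr.
Qed.

Lemma qdot_minus_axis t e q :
  qdot (minus (plus qzero (scal t e)) q) (minus (plus qzero (scal t e)) q)
  = qdot q q + (-2 * qdot e q) * t + qdot e e * t ^ 2.
Proof.
  destruct e as [[[a b] c] d], q as [[[x y] z] w].
  quat_simpl; ring.
Qed.

Lemma qdot_minus y q : qdot (minus y q) (minus y q) = qdot y y + qdot q q - 2 * qdot y q.
Proof.
  destruct y as [[[a b] c] d], q as [[[x z] w] v].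
  quat_simpl; ring.
Qed.

(* By rotation invariance, the mean of [log |y - q|] over the sphere is that for q = |q|. *)
Lemma sph_defect_linear q rho :
  0 < qnorm q < rho -> sph_defect (fun y => ln (qnorm (minus y q))) rho (real_term rho (qnorm q)).
Proof.
  intros Hq. set (s := qnorm q) in *.
  assert (Hqq : qdot q q = s ^ 2) by (symmetry; apply qnorm_sq).
  assert (Hs2 : 0 < s ^ 2) by (apply pow_lt; lra).
  assert (D : forall e, qdot e e = 1 -> is_d2 (axis (fun y => ln (qnorm (minus y q))) e)
    ((s ^ 2 - 2 * qdot e q ^ 2) / s ^ 4)).
  { intros e He.
    replace ((s ^ 2 - 2 * qdot e q ^ 2) / s ^ 4) with
      ((2 * 1 * s ^ 2 - (-2 * qdot e q) ^ 2) / (2 * (s ^ 2) ^ 2)) by (field; lra).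
    eapply is_d2_ext_loc; [|apply is_d2_ln_quadratic, Hs2].
    apply filter_forall; intros t. unfold axis.
    rewrite ln_qnorm_eq, qdot_minus_axis, He, Hqq. reflexivity. }
  do 4 eexists. conjs; try (apply D; unfold qdot, q0, q1, q2, q3; simpl; ring).
  (* On the sphere |y - q|^2 = rho^2 + s^2 - 2 rho w with w = <y, q> / rho, so log |y - q| is a
     function of one linear form, bounded by s. *)
  set (phi := fun w => ln (rho ^ 2 + s ^ 2 - 2 * rho * w) / 2).
  set (phi' := fun w => - rho / (rho ^ 2 + s ^ 2 - 2 * rho * w)).
  assert (Hpos : forall w, Rabs w <= s -> 0 < rho ^ 2 + s ^ 2 - 2 * rho * w).
  { intros w Hw. assert (w <= s) by (split_Rabs; lra).
    assert (0 < (rho - s) ^ 2) by (apply pow_lt; lra). nra. }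
  assert (Hphi : smooth_on s phi phi').
  { intros w Hw; specialize (Hpos w Hw); split.
    - unfold phi, phi'. auto_derive; [simpl in *; lra | simpl in *; field; lra].
    - unfold phi'; cont. lra. }
  pose proof (is_sint_zonal rho phi phi' q) as Z. fold s in Z.
  specialize (Z ltac:(lra) Hphi).
  replace (2 * PI ^ 2 * rho ^ 3 * _)
    with (4 * PI * rho ^ 3 * RInt (fun a => sin a ^ 2 * phi (s * cos a)) 0 PI).
  - eapply is_sint_ext; [|exact Z]. intros a b c _ _; cbv beta.
    assert (Hy := sphere_param_norm rho a b c ltac:(lra)).
    set (y := sphere_param rho a b c) in *.
    rewrite ln_qnorm_eq, qdot_minus, <- (qnorm_sq y), Hy, Hqq.
    unfold phi; do 2 f_equal. field; lra.
  - assert (Hsr : Rabs s < rho) by (rewrite Rabs_pos_eq; lra).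
    assert (Hs0 : s <> 0) by lra.
    (* For q = s on the real axis the integral is half of the one over the circle in the plane,
       already known. *)
    destruct (jet_defect_real s rho Hs0 Hsr) as (m & J1 & _ & J3).
    apply is_RInt_even_half in J3.
    2:{ intros a; rewrite cos_neg, sin_neg; unfold log_lin.
        replace ((- sin a) ^ 2) with (sin a ^ 2) by ring. do 3 f_equal; ring. }
    assert (Em : m = - / s ^ 2).
    { apply (is_d2_unique _ _ _ J1).
      replace (- / s ^ 2) with ((2 * 1 * s ^ 2 - (-2 * s) ^ 2) / (2 * (s ^ 2) ^ 2)) by (field; lra).
      eapply is_d2_ext_loc; [|apply is_d2_ln_quadratic, Hs2].
      apply filter_forall; intros t; unfold log_lin; do 2 f_equal; ring. }
    assert (EI : RInt (fun a => sin a ^ 2 * phi (s * cos a)) 0 PI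
      = PI * (log_lin s 0 0 0 - rho ^ 2 * m / 4 + real_term rho s) / 2).
    { apply RInt_val.
      eapply is_RInt_ext; [|exact J3]. intros a _; cbv beta.
      rewrite Rmult_comm; f_equal. unfold phi, log_lin; do 2 f_equal.
      generalize (sin2_cos2 a); unfold Rsqr; intros E. nra. }
    rewrite EI, Em.
    rewrite ln_qnorm_eq, qdot_minus, Hqq.
    replace (qdot qzero qzero) with 0 by (unfold qdot, qzero, qreal, q0, q1, q2, q3; simpl; ring).
    replace (qdot qzero q) with 0 by (unfold qdot, qzero, qreal, q0, q1, q2, q3; simpl; ring).
    unfold log_lin.
    replace ((0 - s) ^ 2 + (0 - 0) ^ 2) with (0 + s ^ 2 - 2 * 0) by ring.
    (* Summing (s^2 - 2 <e, q>^2) / s^4 over the four axes gives 2 / s^2, that is -2 m for m = -1 /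
       s^2. *)
    assert (Eq : qdot (1, 0, 0, 0) q ^ 2 + qdot (0, 1, 0, 0) q ^ 2 + qdot (0, 0, 1, 0) q ^ 2
      + qdot (0, 0, 0, 1) q ^ 2 = s ^ 2).
    { rewrite <- Hqq. unfold qdot, q0, q1, q2, q3; simpl; ring. }
    set (e0 := qdot (1, 0, 0, 0) q ^ 2) in *. set (e1 := qdot (0, 1, 0, 0) q ^ 2) in *.
    set (e2 := qdot (0, 0, 1, 0) q ^ 2) in *. set (e3 := qdot (0, 0, 0, 1) q ^ 2) in *.
    replace e3 with (s ^ 2 - e0 - e1 - e2) by lra.
    field; lra.
Qed.

Lemma quat_eq (x y : quat) :
  q0 x = q0 y -> q1 x = q1 y -> q2 x = q2 y -> q3 x = q3 y -> x = y.
Proof.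
  destruct x as [[[a b] c] d], y as [[[e f] g] h]; unfold q0, q1, q2, q3; simpl.
  now intros -> -> -> ->.
Qed.

Lemma minus_neq (x y : quat) : x <> y -> minus x y <> qzero.
Proof.
  intros H E; apply H.
  generalize (f_equal q0 E) (f_equal q1 E) (f_equal q2 E) (f_equal q3 E).
  destruct x as [[[a b] c] d], y as [[[e f] g] h]. quat_simpl; intros.
  apply quat_eq; unfold q0, q1, q2, q3; simpl; lra.
Qed.

Lemma pql_log (a q : nat -> quat) (M : nat -> Z) (N : nat) (y : quat) :
  (forall k, (k <= N)%nat -> a k <> qzero) ->
  (forall k, (1 <= k <= N)%nat -> y <> q k) ->
  0 < qnorm (pql a q M N y) /\
  ln (qnorm (pql a q M N y)) = sum_n (fun k => ln (qnorm (a k))) N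
    + sum_n_m (fun k => IZR (M k) * ln (qnorm (minus y (q k)))) 1 N.
Proof.
  induction N as [|N IH]; intros Ha Hq; simpl.
  - split; [apply qnorm_pos, Ha; lia|].
    rewrite sum_O, sum_n_m_zero by lia. unfold zero; simpl; rring.
  - destruct IH as [I1 I2]; [intros; apply Ha; lia | intros; apply Hq; lia|].
    assert (P1 : 0 < qnorm (minus y (q (S N)))) by (apply qnorm_pos, minus_neq, Hq; lia).
    assert (P2 : 0 < qnorm (a (S N))) by (apply qnorm_pos, Ha; lia).
    assert (P3 := qnorm_pow_pos _ (M (S N)) P1).
    assert (P4 : 0 < qnorm (qmul (pql a q M N y) (qpow (minus y (q (S N))) (M (S N)))))
      by (rewrite qnorm_mul; now apply Rmult_lt_0_compat).
    split; [rewrite qnorm_mul; now apply Rmult_lt_0_compat|].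
    rewrite !ln_qnorm_mul, ln_qnorm_pow, I2 by assumption.
    rewrite sum_Sn, (sum_n_Sm _ 1 N) by lia. change plus with Rplus; rring.
Qed.

(** Near 0 and on the sphere log |f| is a constant plus a signed sum of the functions log |x - q_k|,
    since the norm is multiplicative; the constant has defect 0. *)
Lemma pql_formula Omega (f : qhat_fun) rho (a q : nat -> quat) (M : nat -> Z) (N : nat) :
  0 < rho -> (forall x, qnorm x <= rho -> Omega x) ->
  is_pql Omega f a q M N ->
  (forall k, (1 <= k <= N)%nat -> q k <> qzero) ->
  (forall k, (1 <= k <= N)%nat -> qnorm (q k) < rho) ->
  log_abs f qzero = 1 / sphere_area rho * sphere_integral rho (log_abs f)
    - rho ^ 2 / 8 * laplacian (log_abs f) qzero
    - sum_n_m (fun k => IZR (M k) * real_term rho (qnorm (q k))) 1 N.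
Proof.
  intros Hr HO (Ha & HM & Hf) Hq0 Hqr.
  apply sph_defect_formula; [exact Hr|].
  (* The radius of a ball around 0 that contains no q_k; it exists because no q_k is 0. *)
  assert (Hd : exists d, 0 < d <= rho /\ forall k, (1 <= k <= N)%nat -> d <= qnorm (q k)).
  { clear - Hr Hq0. induction N as [|N IH].
    - exists rho; split; [lra | intros; lia].
    - destruct IH as (d & Hd & Hk); [intros; apply Hq0; lia|].
      exists (Rmin d (qnorm (q (S N)))); split.
      + split; [apply Rmin_pos; [lra | apply qnorm_pos, Hq0; lia]|].
        eapply Rle_trans; [apply Rmin_l | lra].
      + intros k Hk'. destruct (Nat.eq_dec k (S N)) as [->|Hne]; [apply Rmin_r|].
        eapply Rle_trans; [apply Rmin_l | apply Hk; lia]. }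
  destruct Hd as (d & Hd & Hdk).
  apply sph_defect_ext with (d := d) (F := fun y => sum_n (fun k => ln (qnorm (a k))) N
    + sum_n_m (fun k => IZR (M k) * ln (qnorm (minus y (q k)))) 1 N); [exact Hr | lra | |].
  - intros x Hx.
    assert (Hne : forall k, (1 <= k <= N)%nat -> x <> q k).
    { intros k Hk ->. specialize (Hdk k Hk); specialize (Hqr k Hk). lra. }
    unfold log_abs. rewrite (Hf x).
    + symmetry; apply pql_log; assumption.
    + apply HO; lra.
    + intros; now apply Hne.
  - rewrite <- (Rplus_0_l (sum_n_m (fun k => IZR (M k) * real_term rho (qnorm (q k))) 1 N)).
    apply sph_defect_plus; [apply sph_defect_const, Hr|].
    clear - Hr Hq0 Hqr. induction N as [|N IH].
    + rewrite sum_n_m_zero by lia.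
      apply sph_defect_ext with (d := 1) (F := fun _ => 0); [exact Hr | lra | |].
      * intros; now rewrite sum_n_m_zero by lia.
      * apply sph_defect_const, Hr.
    + rewrite sum_n_Sm by lia.
      apply sph_defect_ext with (d := 1) (F := fun y =>
        sum_n_m (fun k => IZR (M k) * ln (qnorm (minus y (q k)))) 1 N
        + IZR (M (S N)) * ln (qnorm (minus y (q (S N))))); [exact Hr | lra | |].
      * intros; now rewrite (sum_n_Sm _ 1 N) by lia.
      * apply sph_defect_plus.
        -- apply IH; intros; [apply Hq0 | apply Hqr]; lia.
        -- apply sph_defect_scal, sph_defect_linear. split; [|apply Hqr; lia].
           apply qnorm_pos, Hq0; lia.
Qed.

(** * Spheres and slices *)

(** With the real part it labels the sphere through x by a point of the closed upper half-plane. *)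
Definition im (x : quat) : R := sqrt (q1 x ^ 2 + q2 x ^ 2 + q3 x ^ 2).
Definition qi : quat := (0, 1, 0, 0).
Definition qj : quat := (0, 0, 1, 0).

Lemma im_ge0 x : 0 <= im x.
Proof. apply sqrt_pos. Qed.

Lemma im_sq x : im x ^ 2 = q1 x ^ 2 + q2 x ^ 2 + q3 x ^ 2.
Proof. apply pow2_sqrt. nra. Qed.

Lemma imag_unit_iff J : imag_unit J <-> q0 J = 0 /\ q1 J ^ 2 + q2 J ^ 2 + q3 J ^ 2 = 1.
Proof.
  unfold imag_unit; split.
  - intros E.
    generalize (f_equal q0 E) (f_equal q1 E) (f_equal q2 E) (f_equal q3 E).
    destruct J as [[[a b] c] d]. unfold qmul; quat_simpl; intros E0 E1 E2 E3.
    assert (a = 0); [|split; nra].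
    apply NNPP; intros Ha.
    assert (b = 0) by nra. assert (c = 0) by nra. assert (d = 0) by nra. subst; nra.
  - destruct J as [[[a b] c] d]. quat_simpl; intros [-> H].
    apply quat_eq; unfold qmul; quat_simpl; nra.
Qed.

Lemma imag_unit_opp J : imag_unit J -> imag_unit (opp J).
Proof.
  rewrite !imag_unit_iff; destruct J as [[[a b] c] d]; quat_simpl; intros [-> H]; split; nra.
Qed.

Lemma imag_unit_qi : imag_unit qi.
Proof. apply imag_unit_iff; unfold qi; quat_simpl; split; ring. Qed.

Lemma imag_unit_qj : imag_unit qj.
Proof. apply imag_unit_iff; unfold qj; quat_simpl; split; ring. Qed.

Lemma slice_pt_eq al J be :
  imag_unit J -> slice_pt al J be = (al, be * q1 J, be * q2 J, be * q3 J).
Proof.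
  intros [H _]%imag_unit_iff. destruct J as [[[a b] c] d]; unfold q0 in H; simpl in H; subst.
  apply quat_eq; quat_simpl; ring.
Qed.

Lemma q0_slice_pt al J be : imag_unit J -> q0 (slice_pt al J be) = al.
Proof. intros H; now rewrite slice_pt_eq. Qed.

Lemma im_slice_pt al J be : imag_unit J -> im (slice_pt al J be) = Rabs be.
Proof.
  intros H; rewrite slice_pt_eq by exact H. apply imag_unit_iff in H; destruct H as [_ H].
  change (sqrt ((be * q1 J) ^ 2 + (be * q2 J) ^ 2 + (be * q3 J) ^ 2) = Rabs be).
  rewrite <- sqrt_Rsqr_abs; f_equal.
  transitivity (be * be * (q1 J ^ 2 + q2 J ^ 2 + q3 J ^ 2)); [ring|].
  rewrite H; unfold Rsqr; ring.
Qed.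

Lemma qnorm_q0_im x : qnorm x = Cmod (q0 x, im x).
Proof.
  unfold qnorm, Cmod; f_equal; simpl fst; simpl snd; rewrite im_sq; unfold qdot; ring.
Qed.

Lemma qnorm_slice_pt al J be : imag_unit J -> qnorm (slice_pt al J be) = Cmod (al, be).
Proof.
  intros H; rewrite qnorm_q0_im, q0_slice_pt, im_slice_pt by exact H.
  unfold Cmod; simpl fst; simpl snd; now rewrite pow2_abs.
Qed.

Lemma slice_decomp x : exists J, imag_unit J /\ x = slice_pt (q0 x) J (im x).
Proof.
  destruct (Req_dec (im x) 0) as [H|H].
  - exists qi; split; [apply imag_unit_qi|]. rewrite slice_pt_eq, H by apply imag_unit_qi.
    assert (K := im_sq x); rewrite H in K.
    apply quat_eq; destruct x as [[[a b] c] d]; unfold q0, q1, q2, q3 in *; simpl in *; nra.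
  - set (J := (0, q1 x / im x, q2 x / im x, q3 x / im x) : quat).
    assert (HJ : imag_unit J).
    { apply imag_unit_iff; unfold J; split; [reflexivity|].
      change ((q1 x / im x) ^ 2 + (q2 x / im x) ^ 2 + (q3 x / im x) ^ 2 = 1).
      transitivity ((q1 x ^ 2 + q2 x ^ 2 + q3 x ^ 2) / im x ^ 2); [field; exact H|].
      rewrite <- im_sq; field; exact H. }
    exists J; split; [exact HJ|]. rewrite slice_pt_eq by exact HJ.
    apply quat_eq.
    + reflexivity.
    + change (q1 x = im x * (q1 x / im x)); field; exact H.
    + change (q2 x = im x * (q2 x / im x)); field; exact H.
    + change (q3 x = im x * (q3 x / im x)); field; exact H.
Qed.

Lemma on_sphere_iff a x : on_sphere a x <-> q0 a = q0 x /\ im a = im x.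
Proof.
  split.
  - intros (al & be & I & J & HI & HJ & -> & ->).
    rewrite !q0_slice_pt, !im_slice_pt by assumption; split; reflexivity.
  - intros [E1 E2]. destruct (slice_decomp a) as (I & HI & Ea), (slice_decomp x) as (J & HJ & Ex).
    exists (q0 x), (im x), I, J; conjs; trivial. rewrite <- E1, <- E2; exact Ea.
Qed.

Lemma is_real_quat_iff x : is_real_quat x <-> im x = 0.
Proof.
  split.
  - intros [r ->]. unfold im, qreal, q1, q2, q3; simpl.
    replace (_ + _) with 0 by ring; apply sqrt_0.
  - intros H. destruct (slice_decomp x) as (J & HJ & E). exists (q0 x).
    rewrite E at 1; rewrite slice_pt_eq, H by exact HJ. unfold qreal; repeat f_equal; ring.
Qed.

Lemma circ_iff D x : sym_open D -> (circ D x <-> D (q0 x, im x)).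
Proof.
  intros [_ Hs]; split.
  - intros (al & be & J & HD & HJ & ->).
    rewrite q0_slice_pt, im_slice_pt by exact HJ.
    unfold Rabs; destruct Rcase_abs; [apply (Hs (al, be) HD) | exact HD].
  - intros HD. destruct (slice_decomp x) as (J & HJ & E).
    exists (q0 x), (im x), J; auto.
Qed.

Lemma circ_slice_pt D al J be : sym_open D -> imag_unit J ->
  (circ D (slice_pt al J be) <-> D (al, be)).
Proof.
  intros Hs HJ; split.
  - intros H; apply circ_iff in H; [|exact Hs].
    rewrite q0_slice_pt, im_slice_pt in H by exact HJ.
    revert H; unfold Rabs; destruct Rcase_abs; [|trivial].
    intros H; apply (proj2 Hs) in H; unfold Cconj in H; simpl in H.
    now rewrite Ropp_involutive in H.
  - intros H; exists al, be, J; auto.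
Qed.

(** * Stem functions of slice preserving functions *)

Lemma der_fst {U V : NormedModule R_AbsRing} (f : R -> U * V) x (l : U * V) :
  is_derive (V := prod_NormedModule R_AbsRing U V) f x l ->
  is_derive (V := U) (fun t => fst (f t)) x (fst l).
Proof.
  intros H. unfold is_derive.
  eapply filterdiff_ext_lin.
  - apply (filterdiff_comp' (V := prod_NormedModule R_AbsRing U V) f fst x _ fst H).
    apply filterdiff_linear, is_linear_fst.
  - intros y; reflexivity.
Qed.

Lemma der_snd {U V : NormedModule R_AbsRing} (f : R -> U * V) x (l : U * V) :
  is_derive (V := prod_NormedModule R_AbsRing U V) f x l ->
  is_derive (V := V) (fun t => snd (f t)) x (snd l).
Proof.
  intros H. unfold is_derive.
  eapply filterdiff_ext_lin.
  - apply (filterdiff_comp' (V := prod_NormedModule R_AbsRing U V) f snd x _ snd H).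
    apply filterdiff_linear, is_linear_snd.
  - intros y; reflexivity.
Qed.

Lemma cont_fst {T U V : UniformSpace} (f : T -> U * V) x :
  continuous f x -> continuous (fun t => fst (f t)) x.
Proof.
  intros H; apply (continuous_comp f fst x H). destruct (f x); apply continuous_fst.
Qed.

Lemma cont_snd {T U V : UniformSpace} (f : T -> U * V) x :
  continuous f x -> continuous (fun t => snd (f t)) x.
Proof.
  intros H; apply (continuous_comp f snd x H). destruct (f x); apply continuous_snd.
Qed.

(* f(x + Jy) = a + Jb near the sphere, with a + ib holomorphic: f is slice preserving and
   regular there. *)
Definition real_stem (f : qhat_fun) (E : R -> R -> Prop) (a b p s : R -> R -> R) : Prop :=
  hol E a b p s /\ (forall x y J, E x y -> imag_unit J ->
     f (slice_pt x J y) = Some (plus (qreal (a x y)) (scal (b x y) J))).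

(** The values F_1 + I F_2 and F_1 - I F_2 both lie in C_I, hence so do F_1 and F_2. Taking I = i
    and I = j leaves only real values, and their derivatives are the real components of those of the
    stem. *)
Lemma real_stem_of_stem Omega (f : qhat_fun) (E : C -> Prop) (F : C -> HC) :
  slice_preserving Omega f ->
  (forall al be J, E (al, be) -> imag_unit J -> Omega (slice_pt al J be)) ->
  open E -> stem_holomorphic E F ->
  (forall al be J, E (al, be) -> imag_unit J ->
     f (slice_pt al J be) = Some (plus (fst (F (al, be))) (qmul J (snd (F (al, be)))))) ->
  exists p s, real_stem f (fun x y => E (x, y))
    (fun x y => q0 (fst (F (x, y)))) (fun x y => q0 (snd (F (x, y)))) p s.
Proof.
  intros Hsp HO Hop (Fa & Fb & HF) Hf.
  exists (fun x y => q0 (fst (Fa (x, y)))), (fun x y => q0 (snd (Fa (x, y)))).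
  split; [split|].
  - intros x y Hxy. apply (Hop (x, y)) in Hxy. revert Hxy; apply filter_imp.
    intros [a b]; exact (fun h => h).
  - intros x y Hxy. destruct (HF (x, y) Hxy) as (Ha & Hb & Ca & Cb & E0).
    simpl in Ha, Hb.
    assert (E12 : q0 (fst (Fb (x, y))) = - q0 (snd (Fa (x, y))) /\
      q0 (snd (Fb (x, y))) = q0 (fst (Fa (x, y)))).
    { generalize (f_equal (fun w => q0 (snd w)) E0) (f_equal (fun w => q0 (fst w)) E0).
      unfold iota_mul. destruct (Fa (x, y)) as [[[[a0 a1] a2] a3] [[[a4 a5] a6] a7]].
      destruct (Fb (x, y)) as [[[[b0 b1] b2] b3] [[[b4 b5] b6] b7]].
      unfold plus, zero; simpl; quat_simpl; unfold zero; simpl; lra. }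
    destruct E12 as [E1 E2].
    conjs.
    + apply der_fst in Ha. do 3 apply der_fst in Ha. exact Ha.
    + apply der_fst in Hb. do 3 apply der_fst in Hb.
      eapply is_derive_val; [exact Hb | exact E1].
    + apply der_snd in Ha. do 3 apply der_fst in Ha. exact Ha.
    + apply der_snd in Hb. do 3 apply der_fst in Hb.
      eapply is_derive_val; [exact Hb | exact E2].
    + assert (K := cont_fst _ _ (cont_fst _ _ (cont_fst _ _ (cont_fst _ _ Ca)))).
      unfold cont2. apply continuous_ext with (2 := K). intros [a b]; reflexivity.
    + assert (K := cont_fst _ _ (cont_fst _ _ (cont_fst _ _ (cont_snd _ _ Ca)))).
      unfold cont2. apply continuous_ext with (2 := K). intros [a b]; reflexivity.
  - intros x y J Hxy HJ. rewrite (Hf x y J Hxy HJ). f_equal.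
    (* The value at -I also belongs to C_I, because x - Iy lies in the same slice. *)
    assert (V : forall I, imag_unit I -> forall L, L = I \/ L = opp I ->
      in_slice I (plus (fst (F (x, y))) (qmul L (snd (F (x, y)))))).
    { intros I HI L HL.
      assert (HLu : imag_unit L) by (destruct HL as [-> | ->]; [|apply imag_unit_opp]; exact HI).
      apply (Hsp I (slice_pt x L y)); [exact HI | apply HO; assumption | | apply Hf; assumption].
      destruct HL as [-> | ->]; [now exists x, y|].
      exists x, (- y). unfold slice_pt; f_equal.
      destruct I as [[[i0 i1] i2] i3]; apply quat_eq; quat_simpl; ring. }
    assert (Vi1 := V qi imag_unit_qi qi (or_introl eq_refl)).
    assert (Vi2 := V qi imag_unit_qi (opp qi) (or_intror eq_refl)).
    assert (Vj1 := V qj imag_unit_qj qj (or_introl eq_refl)).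
    assert (Vj2 := V qj imag_unit_qj (opp qj) (or_intror eq_refl)).
    assert (Hi : forall w, in_slice qi w -> q2 w = 0 /\ q3 w = 0).
    { intros w (al & be & ->); rewrite slice_pt_eq by apply imag_unit_qi.
      unfold qi; quat_simpl; split; ring. }
    assert (Hj : forall w, in_slice qj w -> q1 w = 0 /\ q3 w = 0).
    { intros w (al & be & ->); rewrite slice_pt_eq by apply imag_unit_qj.
      unfold qj; quat_simpl; split; ring. }
    apply Hi in Vi1, Vi2; apply Hj in Vj1, Vj2.
    destruct (F (x, y)) as [[[[a0 a1] a2] a3] [[[b0 b1] b2] b3]].
    revert Vi1 Vi2 Vj1 Vj2; unfold qi, qj, qmul; quat_simpl; intros.
    assert (a1 = 0) by lra. assert (a2 = 0) by lra. assert (a3 = 0) by lra.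
    assert (b1 = 0) by lra. assert (b2 = 0) by lra. assert (b3 = 0) by lra. subst.
    apply imag_unit_iff in HJ; destruct HJ as [HJ0 _].
    destruct J as [[[j0 j1] j2] j3]; apply quat_eq; revert HJ0; quat_simpl; intros; subst; ring.
Qed.

Lemma slice_pt_opp x J y : slice_pt x J (- y) = slice_pt x (opp J) y.
Proof. destruct J as [[[a b] c] d]; apply quat_eq; quat_simpl; ring. Qed.

Lemma cont_zero_punctured (phi : R -> R) :
  continuous phi 0 -> (exists d, 0 < d /\ forall t, 0 < t < d -> phi t = 0) -> phi 0 = 0.
Proof.
  intros H (d & Hd & H0).
  assert (K : (fun t => phi (d - t)) d = 0).
  { apply (cont_zero_left (fun t => phi (d - t)) d); [exact Hd | |].
    - apply (cont_comp phi (fun t => d - t)); [cont|]. now rewrite Rminus_diag.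
    - intros r Hr; apply H0; lra. }
  cbv beta in K. now rewrite Rminus_diag in K.
Qed.

Lemma cont_coords {T : UniformSpace} (g : T -> quat) x :
  continuous g x ->
  continuous (fun t => q0 (g t)) x /\ continuous (fun t => q1 (g t)) x /\
  continuous (fun t => q2 (g t)) x /\ continuous (fun t => q3 (g t)) x.
Proof.
  intros H. pose proof (cont_fst _ _ H) as H1. pose proof (cont_fst _ _ H1) as H2.
  conjs; [apply (cont_fst _ _ H2) | apply (cont_snd _ _ H2) | apply (cont_snd _ _ H1)
    | apply (cont_snd _ _ H)].
Qed.

(* Two stems that agree off one sphere give the same value on it: move along the real
   direction, which leaves the sphere at once. *)
Lemma stem_value_unique (E1 E2 : C -> Prop) (F1 F2 : C -> HC) (x y : R) (J : quat) :
  sym_open E1 -> sym_open E2 -> E1 (x, y) -> E2 (x, y) ->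
  stem_holomorphic E1 F1 -> stem_holomorphic E2 F2 ->
  (forall t, t <> 0 -> E1 (x + t, y) -> E2 (x + t, y) ->
     plus (fst (F1 (x + t, y))) (qmul J (snd (F1 (x + t, y))))
     = plus (fst (F2 (x + t, y))) (qmul J (snd (F2 (x + t, y))))) ->
  plus (fst (F1 (x, y))) (qmul J (snd (F1 (x, y))))
  = plus (fst (F2 (x, y))) (qmul J (snd (F2 (x, y)))).
Proof.
  intros [O1 _] [O2 _] H1 H2 (Fa & Fb & HF) (Ga & Gb & HG) Heq.
  set (V := fun (F : C -> HC) t => plus (fst (F (x + t, y))) (qmul J (snd (F (x + t, y))))).
  assert (L : exists d, 0 < d /\ forall t, 0 < t < d -> V F1 t = V F2 t).
  { destruct (filter_and _ _ (O1 _ H1) (O2 _ H2)) as [d Hd].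
    exists d; split; [apply cond_pos|]. intros t Ht.
    assert (B : ball (x, y) d (x + t, y)).
    { split; [|apply ball_center]. change (Rabs (x + t - x) < d).
      replace (x + t - x) with t by ring. rewrite Rabs_pos_eq; lra. }
    destruct (Hd _ B). apply Heq; [lra | assumption | assumption]. }
  assert (CV : forall F F', is_derive (fun t : R => F (t, y)) x F' ->
     continuous (fun t => q0 (V F t)) 0 /\ continuous (fun t => q1 (V F t)) 0 /\
     continuous (fun t => q2 (V F t)) 0 /\ continuous (fun t => q3 (V F t)) 0).
  { intros F F' HD.
    assert (C : continuous (fun t => F (x + t, y) : HC) 0).
    { apply (continuous_comp (fun t => x + t) (fun t => F (t, y))); [cont|].
      rewrite Rplus_0_r. apply (ex_derive_continuous (fun t : R => F (t, y)) x).
      exists F'; exact HD. }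
    destruct (cont_coords _ _ (cont_fst _ _ C)) as (K0 & K1 & K2 & K3).
    destruct (cont_coords _ _ (cont_snd _ _ C)) as (L0 & L1 & L2 & L3).
    unfold V, qmul; quat_simpl; unfold q0, q1, q2, q3 in *; conjs; cont. }
  destruct (CV F1 _ (proj1 (HF _ H1))) as (A0 & A1 & A2 & A3).
  destruct (CV F2 _ (proj1 (HG _ H2))) as (B0 & B1 & B2 & B3).
  destruct L as (d & Hd & L).
  assert (Fin : forall pr : quat -> R, continuous (fun t => pr (V F1 t)) 0 ->
    continuous (fun t => pr (V F2 t)) 0 -> pr (V F1 0) = pr (V F2 0)).
  { intros pr C1 C2. apply Rminus_diag_uniq.
    apply (cont_zero_punctured (fun t => pr (V F1 t) - pr (V F2 t))); [cont|].
    exists d; split; [exact Hd|]. intros t Ht; rewrite (L t Ht); ring. }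
  assert (R : V F1 0 = V F2 0) by (apply quat_eq; apply Fin; assumption).
  unfold V in R. now rewrite Rplus_0_r in R.
Qed.

(** At a singular sphere the definition offers, point by point, an extension or a pole. The
    extension at one point decides for the whole sphere: it forbids a pole at any other point, and
    by [stem_value_unique] every other extension takes the same values there. *)
Lemma semiregular_stem D f al be J0 :
  semiregular D f -> D (al, be) -> imag_unit J0 -> f (slice_pt al J0 be) <> None ->
  exists (E : C -> Prop) (F : C -> HC),
    sym_open E /\ E (al, be) /\ (forall z, E z -> D z) /\ stem_holomorphic E F /\
    forall x y J, E (x, y) -> imag_unit J ->
      f (slice_pt x J y) = Some (plus (fst (F (x, y))) (qmul J (snd (F (x, y))))).
Proof.
  intros (HsD & D' & f0 & HD' & (HsD' & F0 & _ & HF0h & HF0i) & Hf0 & Hsing) HD HJ0 HN.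
  destruct (classic (D' (al, be))) as [Hin|Hout].
  { exists D', F0. conjs; auto. intros x y J Hxy HJ.
    rewrite (Hf0 (slice_pt x J y)) by (now apply circ_slice_pt). f_equal; now apply HF0i. }
  set (x0 := slice_pt al J0 be) in *.
  assert (Hx0 : ~ circ D' x0) by (intros K; apply circ_slice_pt in K; auto).
  destruct (Hsing x0) as [(E & h & Hext & Hfx)|[_ Hp]]; [now apply circ_slice_pt | exact Hx0 | | contradiction].
  destruct Hext as (Hreg & HcE & Hoff).
  pose proof Hreg as (HsE & F & _ & HFh & HFi).
  assert (HEz : E (al, be)) by (apply (circ_slice_pt E al J0 be HsE HJ0), HcE).
  (* Off the sphere of [x0] the extension lives over [D']; the sphere itself lies over [D] by the
     symmetry of [D]. *)
  assert (HED : forall z, E z -> D z).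
  { intros [x y] Hxy.
    destruct (classic (on_sphere x0 (slice_pt x qi y))) as [Hon|Hoff'].
    - apply on_sphere_iff in Hon; unfold x0 in Hon.
      rewrite !q0_slice_pt, !im_slice_pt in Hon by (exact HJ0 || apply imag_unit_qi).
      destruct Hon as [<- Hab].
      assert (Hc : y = be \/ y = - be) by (revert Hab; unfold Rabs; repeat destruct Rcase_abs; lra).
      destruct Hc as [-> | ->]; [exact HD | apply (proj2 HsD _ HD)].
    - apply HD'. apply (circ_slice_pt D' x qi y HsD' imag_unit_qi).
      apply Hoff; [apply circ_slice_pt; auto; apply imag_unit_qi | exact Hoff']. }
  exists E, F. conjs; auto. intros x y J Hxy HJ.
  rewrite <- (HFi x y J Hxy HJ).
  assert (HcEy : circ E (slice_pt x J y)) by (now apply circ_slice_pt).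
  destruct (classic (on_sphere x0 (slice_pt x J y))) as [Hon|Hoff'].
  2:{ destruct (Hoff _ HcEy Hoff') as [K1 K2]. rewrite (Hf0 _ K1), K2; reflexivity. }
  set (x1 := slice_pt x J y) in *.
  assert (Hsph : q0 x0 = q0 x1 /\ im x0 = im x1) by (now apply on_sphere_iff).
  assert (Hx1 : ~ circ D' x1).
  { intros K; apply Hx0. apply (circ_iff D' _ HsD') in K; apply (circ_iff D' _ HsD').
    destruct Hsph as [-> ->]; exact K. }
  assert (Hoff1 : forall y0, circ E y0 -> ~ on_sphere x1 y0 -> circ D' y0 /\ h y0 = f0 y0).
  { intros y0 Hy0 Hs; apply Hoff; [exact Hy0|]. intros K; apply Hs.
    apply on_sphere_iff in K; apply on_sphere_iff. destruct Hsph, K; split; congruence. }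
  destruct (Hsing x1) as [(E2 & h2 & Hext2 & Hfx2)|[[_ Hnp] _]].
  - apply circ_slice_pt; auto.
  - exact Hx1.
  - rewrite Hfx2; f_equal.
    destruct Hext2 as ((HsE2 & F2 & _ & HF2h & HF2i) & HcE2 & Hoff2).
    assert (HE2z : E2 (x, y)) by (apply (circ_slice_pt E2 x J y HsE2 HJ), HcE2).
    unfold x1. rewrite (HFi x y J Hxy HJ), (HF2i x y J HE2z HJ).
    apply (stem_value_unique E2 E F2 F x y J); auto.
    intros t Ht He2 He.
    assert (Hns : ~ on_sphere x1 (slice_pt (x + t) J y)).
    { intros K; apply on_sphere_iff in K; destruct K as [K _]; unfold x1 in K.
      rewrite !q0_slice_pt in K by exact HJ. lra. }
    rewrite <- (HFi (x + t) y J He HJ), <- (HF2i (x + t) y J He2 HJ).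
    rewrite (proj2 (Hoff1 (slice_pt (x + t) J y) ltac:(now apply circ_slice_pt) Hns)).
    apply (proj2 (Hoff2 (slice_pt (x + t) J y) ltac:(now apply circ_slice_pt) Hns)).
  (* The extension at [x0] is also one at [x1], which lies on the same sphere. *)
  - exfalso; apply Hnp. exists E, h. split; [exact Hreg | split; assumption].
Qed.

Lemma semiregular_real_stem Omega D f al be J0 :
  (forall x, Omega x <-> circ D x) -> semiregular D f -> slice_preserving Omega f ->
  D (al, be) -> imag_unit J0 -> f (slice_pt al J0 be) <> None ->
  exists E a b p s, real_stem f E a b p s /\ E al be.
Proof.
  intros HO Hs Hsp HD HJ HN.
  destruct (semiregular_stem D f al be J0 Hs HD HJ HN) as (E & F & HE & Hz & HED & Hh & Hf).
  destruct (real_stem_of_stem Omega f E F Hsp) as (p & s & K); auto; [|apply HE|].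
  - intros x y J Hxy HJ'. apply HO, circ_slice_pt; auto. apply Hs.
  - do 5 eexists; split; [exact K | exact Hz].
Qed.

Lemma regular_real_stem (g : quat -> quat) rho :
  regular (fun z : C => Cmod z < rho) g ->
  slice_preserving (fun x => qnorm x < rho) (fun x => Some (g x)) ->
  exists a b p s, real_stem (fun x => Some (g x)) (disc rho) a b p s.
Proof.
  intros ((Ho & _) & F & _ & Hh & Hi) Hsp.
  destruct (real_stem_of_stem _ _ (fun z : C => Cmod z < rho) F Hsp) as (p & s & K); auto.
  - intros x y J Hxy HJ; now rewrite qnorm_slice_pt.
  - intros x y J Hxy HJ; f_equal; now apply Hi.
  - do 4 eexists; exact K.
Qed.

Lemma real_stem_qdot a b J : imag_unit J ->
  qdot (plus (qreal a) (scal b J)) (plus (qreal a) (scal b J)) = a ^ 2 + b ^ 2.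
Proof.
  intros [H0 H1]%imag_unit_iff. destruct J as [[[j0 j1] j2] j3].
  revert H0 H1; quat_simpl; intros -> H1.
  transitivity (a ^ 2 + b ^ 2 * (j1 * (j1 * 1) + j2 * (j2 * 1) + j3 * (j3 * 1))); [ring | rewrite H1; ring].
Qed.

Lemma real_stem_log f E a b p s x y J :
  real_stem f E a b p s -> E x y -> imag_unit J ->
  log_abs f (slice_pt x J y) = ln (a x y ^ 2 + b x y ^ 2) / 2.
Proof.
  intros (_ & H) Hxy HJ. unfold log_abs.
  now rewrite (H x y J Hxy HJ), ln_qnorm_eq, real_stem_qdot.
Qed.

Lemma real_stem_pos f E a b p s x y J :
  real_stem f E a b p s -> E x y -> imag_unit J -> f (slice_pt x J y) <> Some qzero ->
  0 < a x y ^ 2 + b x y ^ 2.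
Proof.
  intros (_ & H) Hxy HJ Hne. rewrite (H x y J Hxy HJ) in Hne.
  rewrite <- (real_stem_qdot _ _ J HJ), <- qnorm_sq. apply pow_lt, qnorm_pos.
  intros K; exact (Hne (f_equal Some K)).
Qed.

(** * Logarithms of factorizations *)

Definition nonzero_at (al be x y : R) : Prop := 0 < (x - al) ^ 2 + (y - be) ^ 2.

Notation pair_nonzero c x y :=
  (nonzero_at (q0 (fst c)) (im (fst c)) x y /\ nonzero_at (q0 (fst c)) (- im (fst c)) x y)
  (only parsing).
Notation real_log c x y := (IZR (snd c) * log_lin (fst c) 0 x y) (only parsing).
Notation pair_log c x y :=
  (log_lin (q0 (fst c)) (im (fst c)) x y + log_lin (q0 (fst c)) (- im (fst c)) x y)
  (only parsing).

Definition fac_nonzero (rl : list (R * Z)) (sl : list (quat * Z)) (x y : R) : Prop :=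
  (forall c, In c rl -> nonzero_at (fst c) 0 x y) /\
  (forall c, In c sl -> pair_nonzero c x y).

Definition fac_log (rl : list (R * Z)) (sl : list (quat * Z)) (x y : R) : R :=
  sum_over (fun c => real_log c x y) rl
  + sum_over (fun c => IZR (snd c) * pair_log c x y) sl.

Lemma nonzero_at_neq al be x y : (x, y) <> (al, be) -> nonzero_at al be x y.
Proof.
  intros H. unfold nonzero_at.
  assert (0 <= (x - al) ^ 2) by apply pow2_ge_0. assert (0 <= (y - be) ^ 2) by apply pow2_ge_0.
  destruct (Req_dec x al) as [->|Hx].
  - destruct (Req_dec y be) as [->|Hy]; [now exfalso|].
    assert (0 < (y - be) ^ 2) by (apply pow2_gt_0; lra). lra.
  - assert (0 < (x - al) ^ 2) by (apply pow2_gt_0; lra). lra.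
Qed.

Lemma nonzero_at_Cmod al be x y : Cmod (x, y) <> Cmod (al, be) -> nonzero_at al be x y.
Proof. intros H; apply nonzero_at_neq; congruence. Qed.

Lemma nonzero_at_locally al be x y :
  nonzero_at al be x y -> locally (x, y) (fun z : R * R => nonzero_at al be (fst z) (snd z)).
Proof.
  intros H.
  assert (C : continuous (fun z : R * R => (fst z - al) ^ 2 + (snd z - be) ^ 2) (x, y)) by cont.
  apply (C (fun t => 0 < t)). apply open_gt, H.
Qed.

Lemma forall_in_filter {T A : Type} (F : (T -> Prop) -> Prop) {HF : Filter F}
    (P : A -> T -> Prop) (l : list A) :
  (forall c, In c l -> F (P c)) -> F (fun z => forall c, In c l -> P c z).
Proof.
  induction l as [|c l IH]; intros H.
  - apply filter_forall; intros z c [].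
  - generalize (filter_and _ _ (H c (or_introl eq_refl)) (IH (fun d h => H d (or_intror h)))).
    apply filter_imp; intros z [A1 A2] d [<-|Hd]; auto.
Qed.

Lemma fac_nonzero_locally rl sl x y :
  fac_nonzero rl sl x y -> locally (x, y) (fun z : R * R => fac_nonzero rl sl (fst z) (snd z)).
Proof.
  intros [H1 H2]. apply filter_and.
  - apply forall_in_filter; [typeclasses eauto|].
    intros c Hc; apply nonzero_at_locally, H1, Hc.
  - apply forall_in_filter; [typeclasses eauto|].
    intros c Hc; apply filter_and; apply nonzero_at_locally, H2, Hc.
Qed.

Lemma log_lin_cont al be x y : nonzero_at al be x y -> cont2 (log_lin al be) x y.
Proof. intros H; unfold cont2, log_lin; cont; lra. Qed.

Lemma sum_over_cont {T : UniformSpace} {A : Type} (h : A -> T -> R) (l : list A) (x : T) :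
  (forall c, In c l -> continuous (h c) x) ->
  continuous (fun z => sum_over (fun c => h c z) l) x.
Proof.
  induction l as [|c l IH]; intros H.
  - apply cont_const.
  - apply (cont_plus (h c) (fun z => sum_over (fun c => h c z) l)).
    + apply H; now left.
    + apply IH; intros; apply H; now right.
Qed.

Lemma fac_log_cont rl sl x y : fac_nonzero rl sl x y -> cont2 (fac_log rl sl) x y.
Proof.
  intros [H1 H2]; unfold cont2, fac_log; apply cont_plus.
  - apply sum_over_cont.
    intros c Hc; cont. apply log_lin_cont, H1, Hc.
  - apply sum_over_cont.
    intros c Hc; cont; apply log_lin_cont, H2, Hc.
Qed.

Lemma jet_defect_fac rl sl rho :
  (forall c, In c rl -> fst c <> 0 /\ Rabs (fst c) < rho) ->
  (forall c, In c sl -> 0 < qnorm (fst c) < rho) ->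
  jet_defect (fac_log rl sl) rho
    (sum_over (fun c => IZR (snd c) * real_term rho (fst c)) rl
     + sum_over (fun c => IZR (snd c) * sphere_term rho (fst c)) sl).
Proof.
  intros Hr Hs. unfold fac_log.
  apply jet_defect_plus.
  - apply jet_defect_sum.
    intros c Hc; apply jet_defect_scal, jet_defect_real; apply Hr, Hc.
  - apply jet_defect_sum. intros c Hc; apply jet_defect_scal.
    specialize (Hs c Hc). rewrite qnorm_q0_im in Hs.
    assert (K := jet_defect_pair (q0 (fst c)) (im (fst c)) rho Hs).
    rewrite <- qnorm_q0_im in K. unfold sphere_term.
    replace (q0 (plus (fst c) (qconj (fst c)))) with (2 * q0 (fst c)); [exact K|].
    destruct (fst c) as [[[a b] d] e]; quat_simpl; ring.
Qed.

Lemma qdot_sub_real al J be r : imag_unit J ->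
  qdot (minus (slice_pt al J be) (qreal r)) (minus (slice_pt al J be) (qreal r))
  = (al - r) ^ 2 + (be - 0) ^ 2.
Proof.
  intros HJ. rewrite slice_pt_eq by exact HJ. apply imag_unit_iff in HJ; destruct HJ as [_ HJ].
  transitivity ((al - r) ^ 2 + be ^ 2 * (q1 J ^ 2 + q2 J ^ 2 + q3 J ^ 2)); [|rewrite HJ; ring].
  unfold qdot. generalize (q1 J) (q2 J) (q3 J); intros a b c. quat_simpl; ring.
Qed.

(** The polynomial (x - q)^s has real coefficients, so on every slice it acts as the complex
    polynomial (z - w)(z - conj w) with w = [q0 q] + i [im q]. *)
Lemma qdot_qsym q al J be : imag_unit J ->
  qdot (qsym q (slice_pt al J be)) (qsym q (slice_pt al J be))
  = ((al - q0 q) ^ 2 + (be - im q) ^ 2) * ((al - q0 q) ^ 2 + (be - - im q) ^ 2).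
Proof.
  intros HJ. rewrite slice_pt_eq by exact HJ. apply imag_unit_iff in HJ; destruct HJ as [_ HJ].
  assert (Hi := im_sq q). set (i := im q) in *.
  generalize dependent i; intros i Hi.
  assert (HJ' : q3 J ^ 2 = 1 - q1 J ^ 2 - q2 J ^ 2) by lra. clear HJ; revert HJ'.
  generalize (q1 J) (q2 J) (q3 J); intros a b c Hc.
  (* A and B are the real and imaginary parts of (z - w)(z - conj w). *)
  set (A := al ^ 2 - be ^ 2 - 2 * al * q0 q + (q0 q ^ 2 + i ^ 2)).
  set (B := 2 * al * be - 2 * be * q0 q).
  assert (E : qsym q (al, be * a, be * b, be * c) = (A, B * a, B * b, B * c)).
  { unfold A, B; rewrite Hi. destruct q as [[[x y] z] w].
    assert (Hc' : c * c = 1 - a * a - b * b) by (simpl in Hc; lra).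
    apply quat_eq; unfold qsym, qmul; quat_simpl; try ring.
    transitivity (al * al - be * be * (a * a + b * b + c * c) - 2 * al * x + (x * x + y * y + z * z + w * w));
      [ring | rewrite Hc'; ring]. }
  rewrite E. transitivity (A ^ 2 + B ^ 2 * (a ^ 2 + b ^ 2 + c ^ 2)).
  - quat_simpl; ring.
  - rewrite Hc; unfold A, B; ring.
Qed.

Lemma fold_qmul_log {A : Type} (h : A -> quat) (T : A -> R) (l : list A) :
  (forall c, In c l -> 0 < qnorm (h c) /\ ln (qnorm (h c)) = T c) ->
  0 < qnorm (fold_right qmul qone (map h l)) /\
  ln (qnorm (fold_right qmul qone (map h l))) = sum_over T l.
Proof.
  induction l as [|c l IH]; intros H; simpl.
  - rewrite qnorm_one, ln_1; split; [lra | reflexivity].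
  - destruct (H c (or_introl eq_refl)) as [P1 E1].
    destruct (IH (fun d h => H d (or_intror h))) as [P2 E2].
    split; [rewrite qnorm_mul; now apply Rmult_lt_0_compat|].
    rewrite ln_qnorm_mul, E1, E2 by assumption. reflexivity.
Qed.

Lemma factor_prod_log rl sl x y J :
  imag_unit J -> fac_nonzero rl sl x y ->
  0 < qnorm (factor_prod rl sl (slice_pt x J y)) /\
  ln (qnorm (factor_prod rl sl (slice_pt x J y))) = fac_log rl sl x y.
Proof.
  intros HJ [H1 H2]. unfold factor_prod, fac_log.
  destruct (fold_qmul_log (fun c : R * Z => qpow (minus (slice_pt x J y) (qreal (fst c))) (snd c))
    (fun c => real_log c x y) rl) as [P1 E1].
  { intros c Hc. assert (P : 0 < qnorm (minus (slice_pt x J y) (qreal (fst c)))).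
    { apply sqrt_lt_R0. rewrite qdot_sub_real by exact HJ. apply H1, Hc. }
    split; [apply qnorm_pow_pos, P|]. rewrite ln_qnorm_pow by exact P. f_equal.
    rewrite ln_qnorm_eq, qdot_sub_real by exact HJ. reflexivity. }
  destruct (fold_qmul_log (fun c : quat * Z => qpow (qsym (fst c) (slice_pt x J y)) (snd c))
    (fun c => IZR (snd c) * pair_log c x y) sl) as [P2 E2].
  { intros c Hc. destruct (H2 c Hc) as [N1 N2].
    assert (P : 0 < qnorm (qsym (fst c) (slice_pt x J y))).
    { apply sqrt_lt_R0. rewrite qdot_qsym by exact HJ. now apply Rmult_lt_0_compat. }
    split; [apply qnorm_pow_pos, P|]. rewrite ln_qnorm_pow by exact P. f_equal.
    rewrite ln_qnorm_eq, qdot_qsym, ln_mult by assumption. unfold log_lin; field. }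
  split; [rewrite qnorm_mul; now apply Rmult_lt_0_compat|].
  now rewrite ln_qnorm_mul, E1, E2 by assumption.
Qed.

Lemma fac_nonzero_not_pole rl sl x y J :
  imag_unit J -> fac_nonzero rl sl x y -> ~ factor_pole rl sl (slice_pt x J y).
Proof.
  intros HJ [H1 H2] [(r & n & Hin & _ & E)|(q & n & Hin & _ & Hon)].
  - specialize (H1 _ Hin). simpl in H1. unfold nonzero_at in H1.
    rewrite <- (qdot_sub_real x J y r HJ), E in H1. revert H1; quat_simpl; intros; lra.
  - destruct (H2 _ Hin) as [N1 N2]; simpl in N1, N2; unfold nonzero_at in N1, N2.
    apply on_sphere_iff in Hon. rewrite q0_slice_pt, im_slice_pt in Hon by exact HJ.
    destruct Hon as [<- Hi]. rewrite Hi in N1, N2.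
    revert N1 N2; unfold Rabs; destruct Rcase_abs; intros; simpl in *; lra.
Qed.

(** The three imaginary axes all show the second derivative -m of H in y. Since (rho^2 / 8)(-2 m) =
    -rho^2 m / 4, the two mean value formulas match and T carries over unchanged. *)
Lemma jet_to_sph (F : quat -> R) (H : R -> R -> R) rho T d :
  0 < rho -> 0 < d ->
  (forall x y J, imag_unit J -> Cmod (x, y) < d \/ Cmod (x, y) = rho ->
     F (slice_pt x J y) = H x y) ->
  jet_defect H rho T -> sph_defect F rho T.
Proof.
  intros Hr Hd HF (m & A1 & A2 & A3).
  assert (F0 : F qzero = H 0 0).
  { rewrite <- (HF 0 0 qi imag_unit_qi) by (left; rewrite (Cmod_0 : Cmod (0, 0) = 0); exact Hd).
    f_equal. rewrite slice_pt_eq by apply imag_unit_qi. unfold qi; apply quat_eq; quat_simpl; ring. }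
  assert (Hl : forall P : R -> Prop, (forall t, Rabs t < d -> P t) -> locally 0 P).
  { intros P HP; exists (mkposreal d Hd); intros t Ht. apply HP.
    change (Rabs (t - 0) < d) in Ht. now rewrite Rminus_0_r in Ht. }
  assert (Dr : is_d2 (axis F (1, 0, 0, 0)) m).
  { eapply is_d2_ext_loc; [|exact A1]. apply Hl; intros t Ht. symmetry. unfold axis.
    rewrite <- (HF t 0 qi imag_unit_qi) by (left; rewrite Cmod_r; exact Ht).
    f_equal. rewrite slice_pt_eq by apply imag_unit_qi. unfold qi; apply quat_eq; quat_simpl; ring. }
  assert (Di : forall e, imag_unit e -> is_d2 (axis F e) (- m)).
  { intros e He. eapply is_d2_ext_loc; [|exact A2]. apply Hl; intros t Ht. symmetry. unfold axis.
    rewrite <- (HF 0 t e He).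
    - reflexivity.
    - left. unfold Cmod; simpl fst; simpl snd. rewrite <- (sqrt_Rsqr_abs t) in Ht.
      replace (0 ^ 2 + t ^ 2) with (Rsqr t) by (unfold Rsqr; ring). exact Ht. }
  exists m, (- m), (- m), (- m). conjs.
  - exact Dr.
  - apply Di, imag_unit_iff; quat_simpl; split; ring.
  - apply Di, imag_unit_iff; quat_simpl; split; ring.
  - apply Di, imag_unit_iff; quat_simpl; split; ring.
  - replace (2 * PI ^ 2 * rho ^ 3 * _) with
      (4 * PI * rho ^ 3 * (PI * (H 0 0 - rho ^ 2 * m / 4 + T) / 2)) by (rewrite F0; field).
    apply is_sint_slice with (fun a => H (rho * cos a) (rho * sin a)); [exact Hr | |].
    (* On the circle H is even in y, because x - Jy is x + (-J)y and F takes the same value for both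
       units. *)
    2:{ apply is_RInt_even_half; [|exact A3]. intros a; rewrite cos_neg, sin_neg.
        assert (K := Cmod_circle rho a Hr).
        rewrite <- (HF _ (rho * - sin a) qi imag_unit_qi), Ropp_mult_distr_r_reverse, slice_pt_opp
          by (right; rewrite Ropp_mult_distr_r_reverse, Cmod_opp_snd; exact K).
        rewrite (HF _ _ _ (imag_unit_opp _ imag_unit_qi)) by (right; exact K).
        f_equal; ring. }
    intros a b c _ _.
    (* The direction of the imaginary part of [sphere_param]: the point with angles a, b, c is rho
       (cos a + J sin a). *)
    set (J := (0, cos b, sin b * cos c, sin b * sin c) : quat).
    assert (HJ : imag_unit J).
    { apply imag_unit_iff; unfold J; split; [reflexivity|].
      change ((cos b) ^ 2 + (sin b * cos c) ^ 2 + (sin b * sin c) ^ 2 = 1).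
      transitivity (cos b * cos b + sin b * sin b * (sin c * sin c + cos c * cos c)); [ring|].
      assert (Sc := sin2_cos2 c); assert (Sb := sin2_cos2 b). unfold Rsqr in Sc, Sb.
      rewrite Sc; lra. }
    rewrite <- (HF _ _ J HJ) by (right; apply Cmod_circle, Hr).
    f_equal. rewrite slice_pt_eq by exact HJ. unfold sphere_param, J.
    apply quat_eq; quat_simpl; ring.
Qed.

(* On the ball, [log |f|] is that of the factors plus [log |a + ib|]; near the boundary
   it comes from the local stems of f. *)
Lemma slice_core (f : qhat_fun) rho rl sl a b p s :
  0 < rho ->
  (forall c, In c rl -> fst c <> 0 /\ Rabs (fst c) < rho) ->
  (forall c, In c sl -> 0 < qnorm (fst c) < rho) ->
  hol (disc rho) a b p s ->
  (forall x y, disc rho x y -> 0 < a x y ^ 2 + b x y ^ 2) ->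
  (forall x y J, imag_unit J -> disc rho x y -> fac_nonzero rl sl x y ->
     log_abs f (slice_pt x J y) = fac_log rl sl x y + ln (a x y ^ 2 + b x y ^ 2) / 2) ->
  (forall x y, Cmod (x, y) = rho -> exists E A B P S, real_stem f E A B P S /\ E x y /\
     0 < A x y ^ 2 + B x y ^ 2) ->
  sph_defect (log_abs f) rho
    (sum_over (fun c => IZR (snd c) * real_term rho (fst c)) rl
     + sum_over (fun c => IZR (snd c) * sphere_term rho (fst c)) sl).
Proof.
  intros Hr Hrl Hsl Hh Hpos Hin Hbd.
  (* The second branch covers the circle and beyond, where no factorization is given. Near the
     circle both branches equal log |f| minus the factors, which makes h continuous there. *)
  set (h := fun x y => if Rlt_dec (Cmod (x, y)) rho then ln (a x y ^ 2 + b x y ^ 2) / 2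
     else log_abs f (slice_pt x qi y) - fac_log rl sl x y).
  assert (Hh1 : forall x y, disc rho x y -> h x y = ln (a x y ^ 2 + b x y ^ 2) / 2).
  { intros x y Hxy; unfold h; destruct Rlt_dec; [reflexivity | contradiction]. }
  assert (Hnz : forall x y, Cmod (x, y) = rho -> fac_nonzero rl sl x y).
  { intros x y Hxy; split; intros c Hc.
    - apply nonzero_at_Cmod. rewrite Hxy, Cmod_r. generalize (proj2 (Hrl c Hc)); lra.
    - specialize (Hsl c Hc). rewrite qnorm_q0_im in Hsl. split; apply nonzero_at_Cmod.
      + lra.
      + rewrite Cmod_opp_snd; lra. }
  assert (Jh : jet_defect h rho 0).
  { apply (hol_log_boundary rho a b p s); auto.
    intros x y Hxy. destruct (Hbd x y Hxy) as (E & A & B & P & S & HS & HE & HAB).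
    apply (continuous_ext_loc _ (fun z : R * R =>
        ln (A (fst z) (snd z) ^ 2 + B (fst z) (snd z) ^ 2) / 2 - fac_log rl sl (fst z) (snd z))).
    - pose proof (proj1 (proj1 HS) x y HE) as L1.
        pose proof (fac_nonzero_locally _ _ _ _ (Hnz x y Hxy)) as L2.
        generalize (filter_and _ _ L1 L2); apply filter_imp. intros [x' y'] [E1 N1]; cbn [fst snd] in *.
        rewrite <- (real_stem_log f E A B P S x' y' qi HS E1 imag_unit_qi).
        unfold h; destruct Rlt_dec as [Hlt|Hge]; [|reflexivity].
        rewrite (Hin x' y' qi imag_unit_qi Hlt N1). rring.
    - pose proof (hol_cont _ _ _ _ _ _ _ (proj1 HS) HE) as cu.
        pose proof (hol_cont _ _ _ _ _ _ _ (hol_mul_neg_i _ _ _ _ _ (proj1 HS)) HE) as cv.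
        pose proof (fac_log_cont _ _ _ _ (Hnz x y Hxy)) as cf.
        unfold cont2 in *. cont; lra. }
  pose proof (jet_defect_plus _ _ _ _ _ (jet_defect_fac rl sl rho Hrl Hsl) Jh) as J.
  rewrite Rplus_0_r in J.
  assert (N0 : fac_nonzero rl sl 0 0).
  { split; intros c Hc.
    - apply nonzero_at_neq. intros E; inversion E as [E0]. now apply (proj1 (Hrl c Hc)).
    - specialize (Hsl c Hc). rewrite qnorm_q0_im in Hsl.
      split; apply nonzero_at_Cmod; rewrite (Cmod_0 : Cmod (0, 0) = 0).
      + lra.
      + rewrite Cmod_opp_snd; lra. }
  destruct (fac_nonzero_locally _ _ _ _ N0) as [d Hd].
  assert (Hmin : 0 < Rmin d rho) by (apply Rmin_pos; [apply cond_pos | exact Hr]).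
  apply (jet_to_sph _ (fun x y => fac_log rl sl x y + h x y) rho _ (Rmin d rho)); auto.
  intros x y J0 HJ0 [Hxy|Hxy].
  - assert (Hdx : disc rho x y) by (unfold disc; eapply Rlt_le_trans; [exact Hxy | apply Rmin_r]).
    rewrite Hh1 by exact Hdx. apply Hin; [exact HJ0 | exact Hdx|].
    apply (Hd (x, y)). assert (Hxd : Cmod (x, y) < d) by (eapply Rlt_le_trans; [exact Hxy | apply Rmin_l]).
    assert (Hmax := Rmax_Cmod (x, y)). simpl in Hmax.
    split; [change (Rabs (x - 0) < d) | change (Rabs (y - 0) < d)]; rewrite Rminus_0_r.
    + eapply Rle_lt_trans; [apply Rmax_l|]. eapply Rle_lt_trans; [exact Hmax | exact Hxd].
    + eapply Rle_lt_trans; [apply Rmax_r|]. eapply Rle_lt_trans; [exact Hmax | exact Hxd].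
  - unfold h. destruct Rlt_dec as [Hlt|_]; [lra|].
    destruct (Hbd x y Hxy) as (E & A & B & P & S & HS & HE & _).
    rewrite !(real_stem_log f E A B P S x y _ HS HE) by (exact HJ0 || apply imag_unit_qi).
    ring.
Qed.

(** * Zeros, poles and exponents *)

Lemma sum_over_add {A : Type} (g h : A -> R) (l : list A) :
  sum_over (fun c => g c + h c) l = sum_over g l + sum_over h l.
Proof. unfold sum_over; induction l as [|c l IH]; simpl; [ring | rewrite IH; ring]. Qed.

Lemma sum_over_ext {A : Type} (g h : A -> R) (l : list A) :
  (forall c, In c l -> g c = h c) -> sum_over g l = sum_over h l.
Proof.
  unfold sum_over; induction l as [|c l IH]; intros H; simpl; [reflexivity|].
  rewrite (H c (or_introl eq_refl)), IH; auto. intros; apply H; now right.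
Qed.

Lemma sum_over_zero {A : Type} (g : A -> R) (l : list A) :
  (forall c, In c l -> g c = 0) -> sum_over g l = 0.
Proof.
  intros H; rewrite (sum_over_ext g (fun _ => 0) l H).
  unfold sum_over; induction l as [|c l IH]; simpl; [reflexivity|].
  rewrite IH; [ring | intros; apply H; now right].
Qed.

Lemma sum_over_single {A : Type} (P : A -> Prop) (g : A -> R) (l : list A) (c : A) :
  In c l -> P c -> ForallOrdPairs (fun a b => ~ (P a /\ P b)) l ->
  (forall d, In d l -> ~ P d -> g d = 0) -> sum_over g l = g c.
Proof.
  intros Hin Hc HF H0; induction HF as [|d l Hd HF IH]; [destruct Hin|].
  change (g d + sum_over g l = g c).
  rewrite Forall_forall in Hd.
  destruct (classic (P d)) as [Pd|Pd].
  - assert (c = d) as ->.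
    { destruct Hin as [E|Hin]; [now symmetry|]. exfalso; now apply (Hd c Hin). }
    rewrite sum_over_zero; [ring|]. intros e He. apply H0; [now right|].
    intros Pe; now apply (Hd e He).
  - destruct Hin as [->|Hin]; [contradiction|].
    rewrite (H0 d (or_introl eq_refl) Pd), IH; auto; [ring|].
    intros e He; apply H0; now right.
Qed.

Lemma ForallOrdPairs_imp {A : Type} (P Q : A -> A -> Prop) (l : list A) :
  (forall a b, P a b -> Q a b) -> ForallOrdPairs P l -> ForallOrdPairs Q l.
Proof.
  intros H HF; induction HF as [|d l Hd HF IH]; constructor; auto.
  eapply Forall_impl; [|exact Hd]; auto.
Qed.

(** * The order of f at a point and uniqueness of exponents *)

Definition ind (al be x y : R) : R :=
  if excluded_middle_informative ((al, be) = (x, y)) then 1 else 0.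

Lemma ind_eq al be x y : (al, be) = (x, y) -> ind al be x y = 1.
Proof. intros H; unfold ind; destruct excluded_middle_informative; tauto. Qed.

Lemma ind_neq al be x y : (al, be) <> (x, y) -> ind al be x y = 0.
Proof. intros H; unfold ind; destruct excluded_middle_informative; tauto. Qed.

(* The order of a factorization at x + iy, for y >= 0. *)
Definition fac_ord (rl : list (R * Z)) (sl : list (quat * Z)) (x y : R) : R :=
  sum_over (fun c => IZR (snd c) * ind (fst c) 0 x y) rl
  + sum_over (fun c => IZR (snd c) * (ind (q0 (fst c)) (im (fst c)) x y
                                      + ind (q0 (fst c)) (- im (fst c)) x y)) sl.

Definition right_lim (phi : R -> R) (l : R) : Prop := filterlim phi (at_right 0) (locally l).

Lemma right_lim_add phi psi l m :
  right_lim phi l -> right_lim psi m -> right_lim (fun t => phi t + psi t) (l + m).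
Proof.
  intros H K. eapply filterlim_comp_2; [exact H | exact K|].
  apply (filterlim_plus (V := R_NormedModule) l m).
Qed.

Lemma right_lim_mul phi psi l m :
  right_lim phi l -> right_lim psi m -> right_lim (fun t => phi t * psi t) (l * m).
Proof.
  intros H K. eapply filterlim_comp_2; [exact H | exact K|].
  apply (filterlim_mult (K := R_AbsRing) l m).
Qed.

Lemma right_lim_cont phi : continuous phi 0 -> right_lim phi (phi 0).
Proof.
  intros H. eapply filterlim_filter_le_1; [|exact H]. apply filter_le_within.
Qed.

Lemma right_lim_unique phi l m : right_lim phi l -> right_lim phi m -> l = m.
Proof.
  intros H K. apply (filterlim_locally_unique (V := R_NormedModule) phi l m H K).
Qed.

Lemma right_lim_ext phi psi l :
  at_right 0 (fun t => phi t = psi t) -> right_lim phi l -> right_lim psi l.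
Proof. intros H; apply filterlim_ext_loc, H. Qed.

Lemma right_lim_inv_ln : right_lim (fun t => / ln t) 0.
Proof.
  apply (filterlim_comp _ _ _ ln Rinv _ (Rbar_locally m_infty)).
  - apply is_lim_ln_0.
  - apply (filterlim_Rbar_inv m_infty). discriminate.
Qed.

Lemma right_lim_sum {A : Type} (h : A -> R -> R) (T : A -> R) (l : list A) :
  (forall c, In c l -> right_lim (h c) (T c)) ->
  right_lim (fun t => sum_over (fun c => h c t) l) (sum_over T l).
Proof.
  induction l as [|c l IH]; intros H.
  - apply (right_lim_cont (fun _ => 0)), cont_const.
  - apply (right_lim_add (h c) (fun t => sum_over (fun c => h c t) l)).
    + apply H; now left.
    + apply IH; intros; apply H; now right.
Qed.

Lemma at_right_small : at_right 0 (fun t => 0 < t < 1).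
Proof.
  exists (mkposreal 1 Rlt_0_1); intros t Ht Hp.
  change (Rabs (t - 0) < 1) in Ht. split_Rabs; lra.
Qed.

(** If w is the point approached, |z - w| = t and the quotient is 1; otherwise log |z - w| converges
    while ln t tends to minus infinity. *)
Lemma log_lin_order al be x y :
  right_lim (fun t => log_lin al be (x + t) y / ln t) (ind al be x y).
Proof.
  destruct (classic ((al, be) = (x, y))) as [E|E].
  - rewrite ind_eq by exact E. inversion E; subst.
    apply right_lim_ext with (fun _ => 1); [|apply (right_lim_cont (fun _ => 1)), cont_const].
    generalize at_right_small; apply filter_imp; intros t Ht.
    assert (ln t < 0) by (rewrite <- ln_1; apply ln_increasing; lra).
    unfold log_lin. replace ((x + t - x) ^ 2 + (y - y) ^ 2) with (t ^ 2) by ring.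
    rewrite ln_pow by lra. simpl (INR 2). field; lra.
  - rewrite ind_neq by exact E.
    rewrite <- (Rmult_0_r (log_lin al be (x + 0) y)).
    apply right_lim_mul; [|apply right_lim_inv_ln].
    apply (right_lim_cont (fun t => log_lin al be (x + t) y)).
    apply cont_comp2; cont. apply log_lin_cont, nonzero_at_neq.
    rewrite Rplus_0_r; congruence.
Qed.

Lemma fac_log_order rl sl x y :
  right_lim (fun t => fac_log rl sl (x + t) y / ln t) (fac_ord rl sl x y).
Proof.
  apply right_lim_ext with (fun t =>
    sum_over (fun c => IZR (snd c) * (log_lin (fst c) 0 (x + t) y / ln t)) rl
    + sum_over (fun c => IZR (snd c) * (log_lin (q0 (fst c)) (im (fst c)) (x + t) y / ln t
        + log_lin (q0 (fst c)) (- im (fst c)) (x + t) y / ln t)) sl).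
  - apply filter_forall; intros t. unfold fac_log.
    assert (S : forall (A : Type) (g : A -> R) (l : list A) k,
      sum_over g l * k = sum_over (fun c => g c * k) l).
    { intros A g l k; unfold sum_over; induction l as [|c l IH]; simpl; [ring | rewrite <- IH; ring]. }
    unfold Rdiv. rewrite Rmult_plus_distr_r, !S.
    f_equal; apply sum_over_ext; intros; ring.
  - assert (C : forall k : R, right_lim (fun _ => k) k).
    { intros k; apply (right_lim_cont (fun _ => k)), cont_const. }
    apply right_lim_add.
    + apply right_lim_sum.
      intros c _; apply right_lim_mul; [apply C | apply log_lin_order].
    + apply right_lim_sum.
      intros c _; apply right_lim_mul; [apply C|]. apply right_lim_add; apply log_lin_order.
Qed.

Lemma nonzero_at_right al be x y : at_right 0 (fun t => nonzero_at al be (x + t) y).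
Proof.
  destruct (classic ((al, be) = (x, y))) as [E|E].
  - inversion E; subst. generalize at_right_small; apply filter_imp; intros t Ht.
    unfold nonzero_at. nra.
  - assert (L : locally 0 (fun t => nonzero_at al be (x + t) y)).
    { assert (C : continuous (fun t => (x + t - al) ^ 2 + (y - be) ^ 2) 0) by cont.
      apply (C (fun t => 0 < t)), open_gt. rewrite Rplus_0_r.
      apply nonzero_at_neq; congruence. }
    apply filter_le_within, L.
Qed.

Lemma fac_nonzero_right rl sl x y : at_right 0 (fun t => fac_nonzero rl sl (x + t) y).
Proof.
  apply filter_and.
  - apply forall_in_filter; [typeclasses eauto|].
    intros c _; apply nonzero_at_right.
  - apply forall_in_filter; [typeclasses eauto|].
    intros c _; apply filter_and; apply nonzero_at_right.
Qed.

Lemma factorization_log f rho rl sl g x y J a b p s :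
  factorization f rho rl sl g -> real_stem (fun x => Some (g x)) (disc rho) a b p s ->
  imag_unit J -> disc rho x y -> fac_nonzero rl sl x y ->
  log_abs f (slice_pt x J y) = fac_log rl sl x y + ln (a x y ^ 2 + b x y ^ 2) / 2.
Proof.
  intros (_ & _ & _ & _ & _ & _ & Hg0 & Hf) HS HJ Hxy Hnz.
  assert (Hn : qnorm (slice_pt x J y) < rho) by (now rewrite qnorm_slice_pt).
  rewrite <- (real_stem_log _ _ _ _ _ _ x y J HS Hxy HJ). unfold log_abs.
  destruct (Hf _ Hn) as [_ Hf2]. rewrite (Hf2 (fac_nonzero_not_pole _ _ _ _ _ HJ Hnz)).
  destruct (factor_prod_log rl sl x y J HJ Hnz) as [P E].
  rewrite ln_qnorm_mul, E; [reflexivity | exact P | apply qnorm_pos, Hg0, Hn].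
Qed.

Lemma factorization_stem f rho rl sl g :
  factorization f rho rl sl g ->
  exists a b p s, real_stem (fun x => Some (g x)) (disc rho) a b p s /\
    forall x y, disc rho x y -> 0 < a x y ^ 2 + b x y ^ 2.
Proof.
  intros (_ & _ & _ & _ & Hreg & Hsp & Hg0 & _).
  destruct (regular_real_stem g rho Hreg Hsp) as (a & b & p & s & HS).
  exists a, b, p, s; split; [exact HS|]. intros x y Hxy.
  apply (real_stem_pos _ _ _ _ _ _ x y qi HS Hxy imag_unit_qi).
  intros K; apply (Hg0 (slice_pt x qi y)); [|congruence].
  now rewrite qnorm_slice_pt by apply imag_unit_qi.
Qed.

(** The function under the limit involves f but no factorization, so the order is the same for all
    factorizations of f. The zero-free part is bounded and disappears against ln t. *)
Lemma factorization_order f rho rl sl g x y :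
  factorization f rho rl sl g -> disc rho x y ->
  right_lim (fun t => log_abs f (slice_pt (x + t) qi y) / ln t) (fac_ord rl sl x y).
Proof.
  intros HF Hxy. destruct (factorization_stem _ _ _ _ _ HF) as (a & b & p & s & HS & Hpos).
  apply right_lim_ext with (fun t => fac_log rl sl (x + t) y / ln t
    + ln (a (x + t) y ^ 2 + b (x + t) y ^ 2) / 2 * / ln t).
  - assert (L : locally 0 (fun t => disc rho (x + t) y)).
    { assert (C : continuous (fun t : R => Cmod (x + t, y)) 0).
      { apply (cont_comp2 (fun a b => Cmod (a, b)) (fun t => x + t) (fun _ => y)); cont.
        apply (continuous_ext _ _ _ (fun z : R * R => f_equal Cmod (eq_sym (surjective_pairing z)))).
        apply Cmod_cont. }
      apply (C (fun t => t < rho)), open_lt. now rewrite Rplus_0_r. }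
    assert (L' : at_right 0 (fun t => disc rho (x + t) y)) by (apply filter_le_within, L).
    generalize (filter_and _ _ L' (fac_nonzero_right rl sl x y)).
    apply filter_imp; intros t [Hd Hn].
    rewrite (factorization_log f rho rl sl g (x + t) y qi a b p s HF HS imag_unit_qi Hd Hn).
    unfold Rdiv; ring.
  - rewrite <- (Rplus_0_r (fac_ord rl sl x y)).
    apply right_lim_add; [apply fac_log_order|].
    rewrite <- (Rmult_0_r (ln (a (x + 0) y ^ 2 + b (x + 0) y ^ 2) / 2)).
    apply right_lim_mul; [|apply right_lim_inv_ln].
    apply (right_lim_cont (fun t => ln (a (x + t) y ^ 2 + b (x + t) y ^ 2) / 2)).
    assert (Hxy0 : disc rho (x + 0) y) by (now rewrite Rplus_0_r).
    pose proof (hol_cont _ _ _ _ _ _ _ (proj1 HS) Hxy0) as cu.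
    pose proof (hol_cont _ _ _ _ _ _ _ (hol_mul_neg_i _ _ _ _ _ (proj1 HS)) Hxy0) as cv.
    assert (Ca : continuous (fun t => a (x + t) y) 0) by (apply cont_comp2; cont).
    assert (Cb : continuous (fun t => b (x + t) y) 0) by (apply cont_comp2; cont).
    specialize (Hpos _ _ Hxy0). cont; lra.
Qed.

Lemma fac_ord_real f rho rl sl g r n :
  factorization f rho rl sl g -> In (r, n) rl -> fac_ord rl sl r 0 = IZR n.
Proof.
  intros (_ & Hdr & Hsl & _) Hin. unfold fac_ord.
  rewrite (sum_over_single (fun c : R * Z => fst c = r) _ rl (r, n)); trivial.
  - rewrite sum_over_zero.
    + simpl; rewrite ind_eq by reflexivity; ring.
    + intros [q k] Hq; simpl. destruct (Hsl q k Hq) as (_ & Hre & _).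
      rewrite is_real_quat_iff in Hre.
      rewrite !ind_neq; [ring | |]; intros E; inversion E; lra.
  - eapply ForallOrdPairs_imp; [|exact Hdr]. intros [u ?] [v ?]; simpl; intros H [-> ->]; now apply H.
  - intros [u k] _; simpl; intros Hu. rewrite ind_neq; [ring | congruence].
Qed.

(** The point has positive imaginary part, so it meets no real key, and no key through its conjugate
    in the lower half-plane; spheres being listed once, a single entry remains. *)
Lemma fac_ord_sphere f rho rl sl g q n :
  factorization f rho rl sl g -> In (q, n) sl -> fac_ord rl sl (q0 q) (im q) = IZR n.
Proof.
  intros (_ & _ & Hsl & Hds & _) Hin. unfold fac_ord.
  assert (Hq : 0 < im q).
  { destruct (Hsl q n Hin) as (_ & Hre & _). rewrite is_real_quat_iff in Hre.
    destruct (im_ge0 q); [assumption | congruence]. }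
  rewrite (sum_over_single (fun c : quat * Z => on_sphere q (fst c)) _ sl (q, n)); trivial.
  - rewrite sum_over_zero.
    + simpl; rewrite ind_eq, ind_neq; [ring | | reflexivity]. intros E; inversion E; lra.
    + intros [r k] _; simpl. rewrite ind_neq; [ring|]. intros E; inversion E; lra.
  - simpl; now apply on_sphere_iff.
  - eapply ForallOrdPairs_imp; [|exact Hds]. intros [u ?] [v ?]; simpl; intros H [H1 H2].
    apply H. apply on_sphere_iff in H1, H2; apply on_sphere_iff. destruct H1, H2; split; congruence.
  - intros [u k] Hu; simpl; intros Hn. destruct (Hsl u k Hu) as (_ & Hre & _).
    rewrite !ind_neq; [ring | |]; intros E; inversion E.
    + assert (Hi := im_ge0 u); lra.
    + apply Hn, on_sphere_iff; split; congruence.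
Qed.

(** Each exponent in the hypotheses comes with its own factorization; equality of orders transfers
    it to one fixed factorization. *)
Lemma real_exponent_unique f rho rl sl g r n k :
  factorization f rho rl sl g -> In (r, n) rl -> real_exponent f rho r k -> n = k.
Proof.
  intros HF Hin (rl' & sl' & g' & HF' & Hin').
  apply eq_IZR. rewrite <- (fac_ord_real _ _ _ _ _ _ _ HF Hin), <- (fac_ord_real _ _ _ _ _ _ _ HF' Hin').
  assert (Hd : disc rho r 0).
  { unfold disc; rewrite Cmod_r. apply (proj1 HF r n Hin). }
  eapply right_lim_unique; eapply factorization_order; eassumption.
Qed.

Lemma sphere_exponent_unique f rho rl sl g q n k a :
  factorization f rho rl sl g -> In (q, n) sl -> on_sphere a q ->
  sphere_exponent f rho a k -> n = k.
Proof.
  intros HF Hin Ha (rl' & sl' & g' & q' & HF' & Hin' & Ha').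
  apply on_sphere_iff in Ha, Ha'. destruct Ha as [E1 E2], Ha' as [E3 E4].
  apply eq_IZR. rewrite <- (fac_ord_sphere _ _ _ _ _ _ _ HF Hin), <- (fac_ord_sphere _ _ _ _ _ _ _ HF' Hin').
  rewrite <- E1, <- E2, <- E3, <- E4.
  assert (Hd : disc rho (q0 a) (im a)).
  { unfold disc; rewrite E1, E2, <- qnorm_q0_im. apply (proj1 (proj2 (proj2 HF)) q n Hin). }
  eapply right_lim_unique; eapply factorization_order; eassumption.
Qed.

(** * Zeros and poles read off from a factorization *)

Lemma Some_inj {A : Type} (a b : A) : Some a = Some b -> a = b.
Proof. congruence. Qed.

Lemma fold_qmul_zero {A : Type} (h : A -> quat) (l : list A) :
  qnorm (fold_right qmul qone (map h l)) = 0 <-> exists c, In c l /\ qnorm (h c) = 0.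
Proof.
  induction l as [|c l IH]; simpl.
  - rewrite qnorm_one; split; [lra | intros (c & [] & _)].
  - rewrite qnorm_mul; split.
    + intros [H|H]%Rmult_integral; [now exists c; auto|].
      apply IH in H; destruct H as (d & Hd & E); exists d; auto.
    + intros (d & [<-|Hd] & E); [rewrite E; ring|].
      rewrite (proj2 IH) by (now exists d). ring.
Qed.

Lemma qnorm_0_iff x : qnorm x = 0 <-> x = qzero.
Proof.
  split; [|intros ->; apply qnorm_zero]. intros H.
  destruct (classic (x = qzero)) as [E|E]; [exact E|]. apply qnorm_pos in E; lra.
Qed.

Lemma qnorm_pow_zero x n : qnorm (qpow x n) = 0 -> qnorm x = 0.
Proof.
  intros H. destruct (qnorm_ge0 x) as [K|K]; [|now symmetry].
  apply (qnorm_pow_pos x n) in K; lra.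
Qed.

Lemma qnorm_pow_zero_pos x n : (0 < n)%Z -> qnorm x = 0 -> qnorm (qpow x n) = 0.
Proof.
  destruct n as [|p|p]; intros Hn H; try lia. simpl. rewrite qnorm_pow_nat, H.
  apply pow_ne_zero. generalize (Pos2Nat.is_pos p); lia.
Qed.

Lemma minus_eq_zero (x y : quat) : minus x y = qzero <-> x = y.
Proof.
  split.
  - intros H; destruct (classic (x = y)) as [E|E]; [exact E|].
    now apply minus_neq in E.
  - intros ->. exact (plus_opp_r y).
Qed.

Lemma sum_sq_zero (a b : R) : a ^ 2 + b ^ 2 = 0 -> a = 0 /\ b = 0.
Proof. intros H; split; nra. Qed.

Lemma qnorm_qsym_zero q x : qnorm (qsym q x) = 0 <-> on_sphere q x.
Proof.
  destruct (slice_decomp x) as (J & HJ & E).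
  assert (K : qdot (qsym q x) (qsym q x) =
    ((q0 x - q0 q) ^ 2 + (im x - im q) ^ 2) * ((q0 x - q0 q) ^ 2 + (im x - - im q) ^ 2)).
  { rewrite E at 1 2. now apply qdot_qsym. }
  rewrite on_sphere_iff. rewrite <- qnorm_sq in K.
  assert (I1 := im_ge0 x); assert (I2 := im_ge0 q); split.
  - intros H; rewrite H in K. symmetry in K. rewrite pow_i in K by lia.
    apply Rmult_integral in K.
    destruct K as [K|K]; apply sum_sq_zero in K; destruct K; split; lra.
  - intros [E1 E2]. rewrite E1, E2 in K.
    nra.
Qed.

(** Signs of exponents are left open: [qinv] maps 0 to 0, so a factor with negative exponent also
    vanishes at its root. *)
Lemma factor_prod_zero rl sl x :
  qnorm (factor_prod rl sl x) = 0 ->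
  (exists r n, In (r, n) rl /\ x = qreal r) \/ (exists q n, In (q, n) sl /\ on_sphere q x).
Proof.
  unfold factor_prod; rewrite qnorm_mul. intros [H|H]%Rmult_integral; apply fold_qmul_zero in H.
  - left. destruct H as ([r n] & Hin & H). apply qnorm_pow_zero in H.
    apply qnorm_0_iff in H; apply (proj1 (minus_eq_zero _ _)) in H.
    exists r, n; split; [exact Hin | exact H].
  - right. destruct H as ([q n] & Hin & H). apply qnorm_pow_zero in H.
    apply qnorm_qsym_zero in H. exists q, n; split; [exact Hin | exact H].
Qed.

Lemma key_unique {A : Type} (Rel : A -> A -> Prop) (l : list (A * Z)) c d :
  ForallOrdPairs (fun c d => ~ Rel (fst c) (fst d)) l -> In c l -> In d l ->
  Rel (fst c) (fst d) -> Rel (fst d) (fst c) -> c = d.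
Proof.
  intros HF Hc Hd H1 H2. destruct (ForallOrdPairs_In HF c d Hc Hd) as [E|[N|N]]; tauto.
Qed.

Lemma on_sphere_sym a x : on_sphere a x -> on_sphere x a.
Proof. rewrite !on_sphere_iff; intros []; split; congruence. Qed.

Lemma on_sphere_trans a x y : on_sphere a x -> on_sphere x y -> on_sphere a y.
Proof. rewrite !on_sphere_iff; intros [] []; split; congruence. Qed.

Lemma on_sphere_real q r : on_sphere q (qreal r) -> is_real_quat q.
Proof.
  rewrite on_sphere_iff, is_real_quat_iff. intros [_ ->].
  apply is_real_quat_iff; now exists r.
Qed.

Lemma qreal_inj r s : qreal r = qreal s -> r = s.
Proof. unfold qreal; congruence. Qed.

(* [fac_at (fun n => n < 0)] unfolds to [factor_pole]. *)
Definition fac_at (P : Z -> Prop) (rl : list (R * Z)) (sl : list (quat * Z)) (x : quat) : Prop :=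
  (exists r n, In (r, n) rl /\ P n /\ x = qreal r) \/
  (exists q n, In (q, n) sl /\ P n /\ on_sphere q x).

Lemma factorization_pole_iff f rho rl sl g x :
  factorization f rho rl sl g -> qnorm x < rho -> (f x = None <-> factor_pole rl sl x).
Proof.
  intros (_ & _ & _ & _ & _ & _ & _ & Hf) Hx. destruct (Hf x Hx) as [H1 H2]. split; [|exact H1].
  intros E; apply NNPP; intros N. rewrite (H2 N) in E; discriminate.
Qed.

Lemma factorization_zero_iff f rho rl sl g x :
  factorization f rho rl sl g -> qnorm x < rho ->
  (f x = Some qzero <-> fac_at (fun n => (0 < n)%Z) rl sl x).
Proof.
  intros HF Hx. pose proof HF as (Hr & Hdr & Hs & Hds & _ & _ & Hg & Hf).
  destruct (Hf x Hx) as [H1 H2]. split.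
  - intros E. assert (N : ~ factor_pole rl sl x) by (intros N; rewrite (H1 N) in E; discriminate).
    rewrite (H2 N) in E. apply Some_inj in E. apply qnorm_0_iff in E. rewrite qnorm_mul in E.
    apply Rmult_integral in E. destruct E as [E|E];
      [|apply qnorm_0_iff in E; now apply Hg in E].
    (* A vanishing factor with negative exponent would make x a pole, which [N] excludes; exponents
       being nonzero, the sign is positive. *)
    apply factor_prod_zero in E. destruct E as [(r & n & Hin & Ex)|(q & n & Hin & Hon)].
    + left; exists r, n; conjs; trivial. destruct (Hr r n Hin) as [_ Hn].
      assert (~ (n < 0)%Z) by (intros K; apply N; left; now exists r, n). lia.
    + right; exists q, n; conjs; trivial. destruct (Hs q n Hin) as (_ & _ & Hn).
      assert (~ (n < 0)%Z) by (intros K; apply N; right; now exists q, n). lia.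
  - intros E.
    assert (N : ~ factor_pole rl sl x).
    (* Exponents of opposite signs at one point would need two keys there, but keys are distinct and
       spherical keys are not real. *)
    { intros [(r' & n' & Hin' & Hn' & E')|(q' & n' & Hin' & Hn' & E')];
      destruct E as [(r & n & Hin & Hn & E)|(q & n & Hin & Hn & E)].
      - rewrite E in E'; apply qreal_inj in E'.
        assert (K := key_unique eq rl _ _ Hdr Hin Hin' E' (eq_sym E')). inversion K; lia.
      - rewrite E' in E; apply on_sphere_real in E. exact (proj1 (proj2 (Hs q n Hin)) E).
      - rewrite E in E'; apply on_sphere_real in E'. exact (proj1 (proj2 (Hs q' n' Hin')) E').
      - assert (O : on_sphere q q') by (eapply on_sphere_trans; [exact E | now apply on_sphere_sym]).
        assert (K := key_unique on_sphere sl _ _ Hds Hin Hin' O (on_sphere_sym _ _ O)).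
        inversion K; lia. }
    rewrite (H2 N). f_equal. apply qnorm_0_iff. rewrite qnorm_mul.
    replace (qnorm (factor_prod rl sl x)) with 0; [ring|]. symmetry.
    unfold factor_prod; rewrite qnorm_mul.
    destruct E as [(r & n & Hin & Hn & E)|(q & n & Hin & Hn & E)].
    + rewrite (proj2 (fold_qmul_zero _ rl)); [ring|]. exists (r, n); split; [exact Hin|].
      apply qnorm_pow_zero_pos; [exact Hn|]. apply qnorm_0_iff, minus_eq_zero, E.
    + rewrite (proj2 (fold_qmul_zero _ sl)); [ring|]. exists (q, n); split; [exact Hin|].
      apply qnorm_pow_zero_pos; [exact Hn|]. apply qnorm_qsym_zero, E.
Qed.

Lemma qnorm_qreal r : qnorm (qreal r) = Rabs r.
Proof.
  rewrite qnorm_q0_im. replace (im (qreal r)) with 0; [exact (Cmod_r r)|].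
  symmetry; apply is_real_quat_iff; now exists r.
Qed.

Lemma qnorm_on_sphere a x : on_sphere a x -> qnorm a = qnorm x.
Proof. rewrite on_sphere_iff, !qnorm_q0_im; now intros [-> ->]. Qed.

Lemma on_sphere_refl a : on_sphere a a.
Proof. now apply on_sphere_iff. Qed.

Lemma fac_at_real f rho rl sl g (P : Z -> Prop) r :
  factorization f rho rl sl g ->
  (fac_at P rl sl (qreal r) <-> exists n, In (r, n) rl /\ P n).
Proof.
  intros HF. split.
  - intros [(s & n & Hin & Hn & E)|(q & n & Hin & _ & E)].
    + apply qreal_inj in E; subst; now exists n.
    + apply on_sphere_real in E. exfalso.
      now apply (proj1 (proj2 (proj1 (proj2 (proj2 HF)) q n Hin))).
  - intros (n & Hin & Hn); left; now exists r, n.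
Qed.

Lemma fac_at_sphere f rho rl sl g (P : Z -> Prop) a :
  factorization f rho rl sl g ->
  (~ is_real_quat a /\ (forall x, on_sphere a x -> fac_at P rl sl x) <->
   exists q n, In (q, n) sl /\ P n /\ on_sphere a q).
Proof.
  intros HF. split.
  - intros [Hre H].
    destruct (H a (on_sphere_refl a)) as [(s & n & Hin & Hn & E)|(q & n & Hin & Hn & E)].
    + exfalso; apply Hre; now exists s.
    + exists q, n; conjs; trivial. now apply on_sphere_sym.
  - intros (q & n & Hin & Hn & Hon). split.
    + intros [r Er]. rewrite Er in Hon. apply on_sphere_sym, on_sphere_real in Hon.
      now apply (proj1 (proj2 (proj1 (proj2 (proj2 HF)) q n Hin))).
    + intros x Hx. right; exists q, n; conjs; trivial.
      eapply on_sphere_trans; [apply on_sphere_sym|]; eassumption.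
Qed.

Lemma factorization_real_zero f rho rl sl g r :
  factorization f rho rl sl g -> Rabs r < rho ->
  (real_zero f r <-> exists n, In (r, n) rl /\ (0 < n)%Z).
Proof.
  intros HF Hr. unfold real_zero. rewrite <- qnorm_qreal in Hr.
  rewrite (factorization_zero_iff _ _ _ _ _ _ HF Hr). exact (fac_at_real _ _ _ _ _ _ r HF).
Qed.

Lemma factorization_real_pole f rho rl sl g r :
  factorization f rho rl sl g -> Rabs r < rho ->
  (real_pole f r <-> exists n, In (r, n) rl /\ (n < 0)%Z).
Proof.
  intros HF Hr. unfold real_pole. rewrite <- qnorm_qreal in Hr.
  rewrite (factorization_pole_iff _ _ _ _ _ _ HF Hr).
  exact (fac_at_real _ _ _ _ _ (fun n => (n < 0)%Z) r HF).
Qed.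

Lemma factorization_sphere_zero f rho rl sl g a :
  factorization f rho rl sl g -> qnorm a < rho ->
  (spherical_zero f a <-> exists q n, In (q, n) sl /\ (0 < n)%Z /\ on_sphere a q).
Proof.
  intros HF Ha. rewrite <- (fac_at_sphere _ _ _ _ _ (fun n => (0 < n)%Z) a HF).
  split; intros [H1 H2]; split; trivial; intros x Hx;
    (assert (Hxr : qnorm x < rho) by (now rewrite <- (qnorm_on_sphere a x)));
    apply (factorization_zero_iff _ _ _ _ _ x HF Hxr), H2, Hx.
Qed.

Lemma factorization_sphere_pole f rho rl sl g a :
  factorization f rho rl sl g -> qnorm a < rho ->
  (spherical_pole f a <-> exists q n, In (q, n) sl /\ (n < 0)%Z /\ on_sphere a q).
Proof.
  intros HF Ha. rewrite <- (fac_at_sphere _ _ _ _ _ (fun n => (n < 0)%Z) a HF).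
  split; intros [H1 H2]; split; trivial; intros x Hx;
    (assert (Hxr : qnorm x < rho) by (now rewrite <- (qnorm_on_sphere a x)));
    apply (factorization_pole_iff _ _ _ _ _ x HF Hxr), H2, Hx.
Qed.

(** * Counting with multiplicity *)

Lemma count_cons {A : Type} (P : A -> Prop) (s : A) (l : list A) :
  count P (s :: l) =
  ((if excluded_middle_informative (P s) then 1 else 0) + count P l)%Z.
Proof.
  unfold count; simpl. destruct excluded_middle_informative; [simpl length; lia | lia].
Qed.

Lemma count_none {A : Type} (P : A -> Prop) (l : list A) :
  (forall s, In s l -> ~ P s) -> count P l = 0%Z.
Proof.
  induction l as [|s l IH]; intros H; [reflexivity|].
  rewrite count_cons, IH by (intros; apply H; now right).
  destruct excluded_middle_informative as [K|_]; [|reflexivity].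
  exfalso; exact (H s (or_introl eq_refl) K).
Qed.

(** Adding s to the list raises the count of exactly one key, the one related to s, and t takes the
    same value at both. [Rel] will be equality for real points and [on_sphere] for spheres. *)
Lemma count_sum {A : Type} (Rel : A -> A -> Prop) (keys : list (A * Z)) (l : list A) (t : A -> R) :
  (forall s, In s l -> exists c, In c keys /\ Rel (fst c) s) ->
  ForallOrdPairs (fun c d => forall s, ~ (Rel (fst c) s /\ Rel (fst d) s)) keys ->
  (forall c s, Rel c s -> t s = t c) ->
  sum_over (fun c => IZR (count (Rel (fst c)) l) * t (fst c)) keys = sum_over t l.
Proof.
  intros Hl HF Ht. induction l as [|s l IH].
  - apply sum_over_zero; intros; unfold count; simpl; ring.
  - rewrite (sum_over_ext _ (fun c =>
      (if excluded_middle_informative (Rel (fst c) s) then t (fst c) else 0)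
      + IZR (count (Rel (fst c)) l) * t (fst c))).
    + rewrite sum_over_add, IH by (intros; apply Hl; now right).
      change (sum_over t (s :: l)) with (t s + sum_over t l). f_equal.
      destruct (Hl s (or_introl eq_refl)) as (c & Hc & Hcs).
      rewrite (sum_over_single (fun d => Rel (fst d) s) _ keys c Hc Hcs).
      * destruct excluded_middle_informative; [symmetry; now apply Ht | contradiction].
      * eapply ForallOrdPairs_imp; [|exact HF]. intros a b H; apply H.
      * intros d _ Hd; destruct excluded_middle_informative; [contradiction | reflexivity].
    + intros c _. rewrite count_cons, plus_IZR.
      destruct excluded_middle_informative; ring.
Qed.

Lemma exponent_sum {A : Type} (Rel : A -> A -> Prop) (keys : list (A * Z)) (zs ps : list A)
    (t : A -> R) :
  (forall s, In s zs -> exists c, In c keys /\ Rel (fst c) s) ->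
  (forall s, In s ps -> exists c, In c keys /\ Rel (fst c) s) ->
  ForallOrdPairs (fun c d => forall s, ~ (Rel (fst c) s /\ Rel (fst d) s)) keys ->
  (forall c s, Rel c s -> t s = t c) ->
  (forall c, In c keys -> snd c = (count (Rel (fst c)) zs - count (Rel (fst c)) ps)%Z) ->
  sum_over (fun c => IZR (snd c) * t (fst c)) keys = sum_over t zs - sum_over t ps.
Proof.
  intros Hz Hp HF Ht Hn.
  rewrite <- (count_sum Rel keys zs t Hz HF Ht), <- (count_sum Rel keys ps t Hp HF Ht).
  apply (Rplus_eq_reg_r (sum_over (fun c => IZR (count (Rel (fst c)) ps) * t (fst c)) keys)).
  rewrite <- sum_over_add. unfold Rminus; rewrite Rplus_assoc, Rplus_opp_l, Rplus_0_r.
  apply sum_over_ext; intros c Hc. rewrite (Hn c Hc), minus_IZR; ring.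
Qed.

(** A key with n > 0 is a zero and one with n < 0 a pole, never both, so one of the two counts is 0
    and the other is |n|. *)
Lemma real_exponent_sum f rho rl sl g rs ps (t : R -> R) :
  factorization f rho rl sl g -> lists_real_zeros f rho rs -> lists_real_poles f rho ps ->
  sum_over (fun c => IZR (snd c) * t (fst c)) rl = sum_over t rs - sum_over t ps.
Proof.
  intros HF [Hz1 Hz2] [Hp1 Hp2]. pose proof HF as (Hr & Hdr & _).
  apply (exponent_sum (fun r s => s = r)).
  - intros s Hs; destruct (Hz1 s Hs) as [Hlt (n & Hin & _)%(factorization_real_zero _ _ _ _ _ _ HF)];
      [now exists (s, n) | exact Hlt].
  - intros s Hs; destruct (Hp1 s Hs) as [Hlt (n & Hin & _)%(factorization_real_pole _ _ _ _ _ _ HF)];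
      [now exists (s, n) | exact Hlt].
  - eapply ForallOrdPairs_imp; [|exact Hdr]. intros [u ?] [v ?] H s [-> E]; now apply H.
  - now intros c s ->.
  - intros [r n] Hin; simpl. destruct (Hr r n Hin) as [Hlt Hn].
    destruct (Z_lt_le_dec n 0) as [Hneg|Hpos].
    + assert (P : real_pole f r) by (apply (factorization_real_pole f rho rl sl g r HF Hlt); eauto).
      rewrite (real_exponent_unique _ _ _ _ _ _ _ _ HF Hin (Hp2 r Hlt P)).
      rewrite (count_none _ rs); [lia|]. intros s Hs ->. destruct (Hz1 r Hs) as [_ Z0].
      unfold real_pole in P; unfold real_zero in Z0; congruence.
    + assert (P : real_zero f r).
      { apply (factorization_real_zero f rho rl sl g r HF Hlt). exists n; split; [exact Hin | lia]. }
      rewrite (real_exponent_unique _ _ _ _ _ _ _ _ HF Hin (Hz2 r Hlt P)) at 1.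
      rewrite (count_none _ ps); [lia|]. intros s Hs ->. destruct (Hp1 r Hs) as [_ Z0].
      unfold real_zero in P; unfold real_pole in Z0; congruence.
Qed.

Lemma sphere_exponent_sum f rho rl sl g as_ bs (t : quat -> R) :
  (forall a x, on_sphere a x -> t x = t a) ->
  factorization f rho rl sl g ->
  lists_spherical_zeros f rho as_ -> lists_spherical_poles f rho bs ->
  sum_over (fun c => IZR (snd c) * t (fst c)) sl = sum_over t as_ - sum_over t bs.
Proof.
  intros Ht HF [Hz1 Hz2] [Hp1 Hp2]. pose proof HF as (_ & _ & Hs & Hds & _).
  apply (exponent_sum on_sphere).
  - intros s Hin.
    destruct (Hz1 s Hin) as [? (q & n & Hq & _ & Hon)%(factorization_sphere_zero _ _ _ _ _ _ HF)];
      [|assumption]. exists (q, n); split; [exact Hq | now apply on_sphere_sym].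
  - intros s Hin.
    destruct (Hp1 s Hin) as [? (q & n & Hq & _ & Hon)%(factorization_sphere_pole _ _ _ _ _ _ HF)];
      [|assumption]. exists (q, n); split; [exact Hq | now apply on_sphere_sym].
  - eapply ForallOrdPairs_imp; [|exact Hds]. intros [u ?] [v ?] H s [H1 H2]; apply H.
    eapply on_sphere_trans; [exact H1 | now apply on_sphere_sym].
  - exact Ht.
  - intros [q n] Hin; simpl. destruct (Hs q n Hin) as (Hlt & Hre & Hn).
    destruct (Z_lt_le_dec n 0) as [Hneg|Hpos].
    + assert (P : spherical_pole f q).
      { apply (factorization_sphere_pole f rho rl sl g q HF Hlt).
        exists q, n; auto using on_sphere_refl. }
      rewrite (sphere_exponent_unique _ _ _ _ _ _ _ _ _ HF Hin (on_sphere_refl q) (Hp2 q Hlt P)).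
      rewrite (count_none _ as_); [lia|]. intros s Hin' Hon. destruct (Hz1 s Hin') as [_ [_ Z0]].
      specialize (Z0 s (on_sphere_refl s)). destruct P as [_ P0].
      specialize (P0 s Hon). congruence.
    + assert (P : spherical_zero f q).
      { apply (factorization_sphere_zero f rho rl sl g q HF Hlt).
        exists q, n; conjs; [exact Hin | lia | apply on_sphere_refl]. }
      rewrite (sphere_exponent_unique _ _ _ _ _ _ _ _ _ HF Hin (on_sphere_refl q) (Hz2 q Hlt P)) at 1.
      rewrite (count_none _ bs); [lia|]. intros s Hin' Hon. destruct (Hp1 s Hin') as [_ [_ Z0]].
      specialize (Z0 s (on_sphere_refl s)). destruct P as [_ P0].
      specialize (P0 s Hon). congruence.
Qed.

Lemma sphere_term_on_sphere rho a x : on_sphere a x -> sphere_term rho x = sphere_term rho a.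
Proof.
  intros H. unfold sphere_term. rewrite <- (qnorm_on_sphere a x H).
  assert (E : forall y, q0 (plus y (qconj y)) = 2 * q0 y).
  { intros [[[u v] w] z]; quat_simpl; ring. }
  rewrite !E. apply on_sphere_iff in H; destruct H as [-> _]; reflexivity.
Qed.

(* Without zeros and poles, [f] itself gives the holomorphic function on the disc. *)
Lemma hol_glue f rho :
  (forall x y, disc rho x y -> exists E a b p s, real_stem f E a b p s /\ E x y) ->
  exists a b p s, hol (disc rho) a b p s /\
    forall x y J, disc rho x y -> imag_unit J ->
      f (slice_pt x J y) = Some (plus (qreal (a x y)) (scal (b x y) J)).
Proof.
  intros Hloc.
  set (a := fun x y => match f (slice_pt x qi y) with Some w => q0 w | None => 0 end).
  set (b := fun x y => match f (slice_pt x qi y) with Some w => q1 w | None => 0 end).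
  assert (Hab : forall E A B P S, real_stem f E A B P S -> forall x y, E x y ->
    a x y = A x y /\ b x y = B x y).
  { intros E A B P S (_ & H) x y Hxy. unfold a, b.
    rewrite (H x y qi Hxy imag_unit_qi). unfold qi; quat_simpl; split; ring. }
  exists a, b, (fun x y => Derive (fun t => a t y) x), (fun x y => Derive (fun t => b t y) x).
  split.
  - apply hol_of_local; [intros; now apply disc_open|]. intros x y Hxy.
    destruct (Hloc x y Hxy) as (E & A & B & P & S & HS & HE).
    exists E, A, B, P, S; conjs; [apply HS | exact HE | exact (Hab E A B P S HS)].
  - intros x y J Hxy HJ. destruct (Hloc x y Hxy) as (E & A & B & P & S & HS & HE).
    destruct (Hab _ _ _ _ _ HS x y HE) as [-> ->].
    exact (proj2 HS x y J HE HJ).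
Qed.

(** * The formula in both cases *)

Lemma slice_preserving_formula Omega D (f : qhat_fun) rho rs ps as_ bs :
  0 < rho -> (forall x, qnorm x <= rho -> Omega x) ->
  f qzero <> Some qzero -> f qzero <> None ->
  (forall y, qnorm y = rho -> f y <> Some qzero /\ f y <> None) ->
  (forall x, Omega x <-> circ D x) -> semiregular D f -> slice_preserving Omega f ->
  lists_real_zeros f rho rs -> lists_real_poles f rho ps ->
  lists_spherical_zeros f rho as_ -> lists_spherical_poles f rho bs ->
  sph_defect (log_abs f) rho
    (sum_over (real_term rho) rs - sum_over (real_term rho) ps
     + (sum_over (sphere_term rho) as_ - sum_over (sphere_term rho) bs)).
Proof.
  intros Hr HO Hf0 Hfi Hbd HOD Hsr Hsp Hrs Hps Has Hbs.
  assert (Hstem : forall x y J, imag_unit J -> Cmod (x, y) <= rho -> f (slice_pt x J y) <> None ->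
    exists E a b p s, real_stem f E a b p s /\ E x y).
  { intros x y J HJ Hxy HN.
    apply (semiregular_real_stem Omega D f x y J); auto.
    apply (circ_slice_pt D x J y (proj1 Hsr) HJ), HOD, HO. now rewrite qnorm_slice_pt. }
  assert (Hcirc : forall x y, Cmod (x, y) = rho -> exists E a b p s, real_stem f E a b p s /\
     E x y /\ 0 < a x y ^ 2 + b x y ^ 2).
  { intros x y Hxy. destruct (Hbd (slice_pt x qi y)) as [B1 B2].
    { now rewrite qnorm_slice_pt by apply imag_unit_qi. }
    destruct (Hstem x y qi imag_unit_qi ltac:(lra) B2) as (E & a & b & p & s & HS & HE).
    exists E, a, b, p, s; conjs; trivial.
    exact (real_stem_pos f E a b p s x y qi HS HE imag_unit_qi B1). }
  (* A factorization is provided by the exponent attached to any zero or pole of the lists. If there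
     is none, the ball contains neither real nor spherical zeros or poles and all four lists are
     empty. *)
  destruct (classic (exists rl sl g, factorization f rho rl sl g)) as [(rl & sl & g & HF)|HnF].
  - rewrite <- (real_exponent_sum f rho rl sl g rs ps (real_term rho) HF Hrs Hps).
    rewrite <- (sphere_exponent_sum f rho rl sl g as_ bs (sphere_term rho)
      (sphere_term_on_sphere rho) HF Has Hbs).
    destruct (factorization_stem _ _ _ _ _ HF) as (a & b & p & s & HS & Hpos).
    pose proof HF as (Hrl & _ & Hsl & _).
    apply (slice_core f rho rl sl a b p s Hr); auto.
    + intros [r n] Hin; destruct (Hrl r n Hin) as [Hlt Hn]; simpl; split; [|exact Hlt].
      intros ->. assert (Hn' : (n < 0 \/ 0 < n)%Z) by lia. destruct Hn' as [Hn'|Hn'].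
      * apply Hfi. apply (factorization_real_pole f rho rl sl g 0 HF Hlt). now exists n.
      * apply Hf0. apply (factorization_real_zero f rho rl sl g 0 HF Hlt). now exists n.
    + intros [q n] Hin; destruct (Hsl q n Hin) as (Hlt & Hre & _); simpl; split; [|exact Hlt].
      apply qnorm_pos. intros ->. apply Hre. now exists 0.
    + apply HS.
    + intros x y J HJ Hxy Hnz. now apply (factorization_log f rho rl sl g x y J a b p s).
  - assert (Nrz : forall r, Rabs r < rho -> real_zero f r -> False).
    { intros r Hlt Hz. destruct (proj2 Hrs r Hlt Hz) as (rl & sl & g & HF & _). apply HnF; eauto. }
    assert (Nrp : forall r, Rabs r < rho -> real_pole f r -> False).
    { intros r Hlt Hz. destruct (proj2 Hps r Hlt Hz) as (rl & sl & g & HF & _). apply HnF; eauto. }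
    assert (Nsz : forall a, qnorm a < rho -> spherical_zero f a -> False).
    { intros a Hlt Hz. destruct (proj2 Has a Hlt Hz) as (rl & sl & g & q & HF & _).
      apply HnF; eauto. }
    assert (Nsp : forall a, qnorm a < rho -> spherical_pole f a -> False).
    { intros a Hlt Hz. destruct (proj2 Hbs a Hlt Hz) as (rl & sl & g & q & HF & _).
      apply HnF; eauto. }
    assert (nil_of : forall (A : Type) (l : list A) (P Q : A -> Prop),
      (forall r, In r l -> P r /\ Q r) -> (forall r, P r -> Q r -> False) -> l = nil).
    { intros A [|r l] P Q H1 H2; [reflexivity|].
      destruct (H1 r (or_introl eq_refl)); exfalso; eauto. }
    rewrite (nil_of _ _ _ _ (proj1 Hrs) Nrz), (nil_of _ _ _ _ (proj1 Hps) Nrp),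
      (nil_of _ _ _ _ (proj1 Has) Nsz), (nil_of _ _ _ _ (proj1 Hbs) Nsp).
    (* On one sphere f takes the values a + bJ with common real a and b. A zero or pole at a single
       non-real point therefore fills its sphere, and the absence of spherical ones excludes all of
       them. *)
    assert (Hsph : forall x y, qnorm x < rho -> on_sphere x y -> f x <> None ->
      exists a b I J, imag_unit I /\ imag_unit J /\
        f x = Some (plus (qreal a) (scal b I)) /\ f y = Some (plus (qreal a) (scal b J))).
    { intros x y Hx Hon Hf.
      destruct (slice_decomp x) as (I & HI & Ex), (slice_decomp y) as (J & HJ & Ey).
      apply on_sphere_iff in Hon. destruct Hon as [E1 E2]. rewrite <- E1, <- E2 in Ey.
      rewrite Ex in Hf. destruct (Hstem (q0 x) (im x) I HI) as (E' & a & b & p & s & HS & HE).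
      { rewrite <- qnorm_q0_im; lra. }
      { exact Hf. }
      exists (a (q0 x) (im x)), (b (q0 x) (im x)), I, J; conjs; trivial.
      - rewrite Ex at 1; now apply HS.
      - rewrite Ey at 1; now apply HS. }
    assert (Hnone : forall x, qnorm x < rho -> f x <> None).
    { intros x Hx E. destruct (classic (is_real_quat x)) as [[r ->]|Hre].
      - rewrite qnorm_qreal in Hx. exact (Nrp r Hx E).
      - apply (Nsp x Hx). split; [exact Hre|]. intros y Hon; apply NNPP; intros Hy.
        destruct (Hsph y x) as (a & b & I & J & _ & _ & _ & K); trivial.
        + now rewrite <- (qnorm_on_sphere x y).
        + now apply on_sphere_sym.
        + congruence. }
    assert (Hzero : forall x, qnorm x < rho -> f x <> Some qzero).
    { intros x Hx E. destruct (classic (is_real_quat x)) as [[r ->]|Hre].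
      - rewrite qnorm_qreal in Hx. exact (Nrz r Hx E).
      - apply (Nsz x Hx). split; [exact Hre|]. intros y Hon.
        destruct (Hsph x y Hx Hon (Hnone x Hx)) as (a & b & I & J & HI & HJ & Kx & ->).
        rewrite Kx in E. apply Some_inj, (proj2 (qnorm_0_iff _)) in E. f_equal.
        apply qnorm_0_iff. unfold qnorm in *. now rewrite real_stem_qdot in * by assumption. }
    destruct (hol_glue f rho) as (a & b & p & s & Hh & Hab).
    { intros x y Hxy. apply (Hstem x y qi imag_unit_qi); [apply Rlt_le, Hxy|].
      apply Hnone. now rewrite qnorm_slice_pt by apply imag_unit_qi. }
    change (sph_defect (log_abs f) rho (0 - 0 + (0 - 0))).
    replace (0 - 0 + (0 - 0)) with (0 + 0) by ring.
    apply (slice_core f rho nil nil a b p s Hr); auto.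
    + intros c [].
    + intros c [].
    + intros x y Hxy. rewrite <- (real_stem_qdot _ _ qi imag_unit_qi), <- qnorm_sq.
      apply pow_lt, qnorm_pos. intros E. apply (Hzero (slice_pt x qi y)).
      * now rewrite qnorm_slice_pt by apply imag_unit_qi.
      * rewrite (Hab x y qi Hxy imag_unit_qi). exact (f_equal Some E).
    + intros x y J HJ Hxy _. unfold log_abs. rewrite (Hab x y J Hxy HJ).
      rewrite ln_qnorm_eq, real_stem_qdot by exact HJ.
      unfold fac_log, sum_over; simpl; ring.
Qed.

Theorem theorem3p3 :
  forall (Omega : quat -> Prop) (f : qhat_fun) (rho : R),
    is_domain Omega ->
    0 < rho ->
    (forall x, qnorm x <= rho -> Omega x) ->
    f qzero <> Some qzero -> f qzero <> None ->
    (forall y, qnorm y = rho -> f y <> Some qzero /\ f y <> None) ->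
    (forall (D : C -> Prop) (rs ps : list R) (as_ bs : list quat),
       (forall x, Omega x <-> circ D x) ->
       semiregular D f ->
       slice_preserving Omega f ->
       lists_real_zeros f rho rs ->
       lists_real_poles f rho ps ->
       lists_spherical_zeros f rho as_ ->
       lists_spherical_poles f rho bs ->
       log_abs f qzero =
         1 / sphere_area rho * sphere_integral rho (log_abs f)
         - rho ^ 2 / 8 * laplacian (log_abs f) qzero
         + sum_over (real_term rho) ps
         - sum_over (real_term rho) rs
         + sum_over (sphere_term rho) bs
         - sum_over (sphere_term rho) as_)
    /\
    (forall (N : nat) (a q : nat -> quat) (M : nat -> Z),
       is_pql Omega f a q M N ->
       (forall k, (1 <= k <= N)%nat -> q k <> qzero) ->
       (forall k, (1 <= k <= N)%nat -> qnorm (q k) < rho) ->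
       log_abs f qzero =
         1 / sphere_area rho * sphere_integral rho (log_abs f)
         - rho ^ 2 / 8 * laplacian (log_abs f) qzero
         - sum_n_m (fun k => IZR (M k) * real_term rho (qnorm (q k))) 1 N).
Proof.
  intros Omega f rho _ Hr HO Hf0 Hfi Hbd; split.
  - intros D rs ps as_ bs HOD Hsr Hsp Hrs Hps Has Hbs.
    rewrite (sph_defect_formula _ _ _ Hr (slice_preserving_formula Omega D f rho rs ps as_ bs
      Hr HO Hf0 Hfi Hbd HOD Hsr Hsp Hrs Hps Has Hbs)).
    ring.
  - intros N a q M Hpql Hq0 Hqr. exact (pql_formula Omega f rho a q M N Hr HO Hpql Hq0 Hqr).
Qed.
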